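(* Let $L,m,\varsigma,\beta,\gamma,h_2,h_3,A,B_1,B_2,B_3,B_4,C>0$ be constants such that $\tilde A=A-\frac{\gamma^2\beta B_3^2}{B_4}>0$ and $\tilde B=B_1-\frac{\gamma B_2B_3}{B_4}>0$, put $\tilde C=C+\frac{\gamma h_2h_3B_2^2}{B_4}$, and let $k_1>0$. Let $\mathcal H$ and $\tilde{\mathcal A}$ be the Hilbert space and the closed-loop operator defined in the context. Then the closed-loop system $$\dot\Phi(t)=\tilde{\mathcal A}\,\Phi(t),\qquad \Phi(0)=\Phi^0,\qquad t\ge 0,$$ is strongly stable in $\mathcal H$: for every $\Phi^0\in\mathcal H$ the solution satisfies $\lim_{t\to\infty}\|\Phi(t)\|_{\mathcal H}=0$.
   Context: All function spaces are complex-valued on the interval $(0,L)$; subscripts $x$ denote derivatives in $x$ and $D_x=d/dx$. The operator $P_\varsigma=(\varsigma\tilde C I-D_x^2)^{-1}$ on $L^2(0,L)$ is the inverse of $\varsigma\tilde C I-D_x^2$ with domain $\{\psi\in H^2(0,L):\psi(0)=\psi_x(L)=0\}$; equivalently $P_\varsigma f(x)=\int_0^L g(x,z)f(z)\,dz$ with $g(x,z)=\frac{\cosh[\sqrt{\tilde C\varsigma}(z-L)]\,\sinh[\sqrt{\tilde C\varsigma}\,x]}{\sqrt{\tilde C\varsigma}\cosh[\sqrt{\tilde C\varsigma}L]}$ for $x\le z$ and $g(x,z)=g(z,x)$ for $x\ge z$. Put $J_\varsigma=\varsigma\tilde C P_\varsigma-I$, a bounded, self-adjoint, non-positive operator on $L^2(0,L)$.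 State space: $V=\{\psi\in H^2(0,L):\psi(0)=\psi_x(0)=0\}$, $\mathcal H=V\times L^2(0,L)$ with inner product $$\langle (u_1,u_2),(v_1,v_2)\rangle_{\mathcal H}=\int_0^L m\,u_2\bar v_2\,dx+a(u_1,v_1),$$ $$a(u,v)=\int_0^L\Big(\tilde A\,u_{xx}\bar v_{xx}-\gamma\beta\varsigma h_2h_3\tilde B^2\,(J_\varsigma u_x)\,\bar v_x\Big)dx .$$ The underlying control system, with state $\Phi=(w,\dot w)$ and scalar control $V(t)$ (the voltage), is the electrostatic Mead–Marcus smart beam $$m\ddot w+\tilde A w_{xxxx}+\gamma\beta\varsigma h_2h_3\tilde B^2(J_\varsigma w_x)_x=-\frac{\gamma}{B_4}\big[\varsigma h_2h_3\tilde BB_2(P_\varsigma\delta_L)_x+B_3(\delta_L)_x\big]V(t),$$ $$w(0)=w_x(0)=w_{xx}(L)=0,\qquad \tilde A w_{xxx}(L)+\gamma\beta\varsigma h_2h_3\tilde B^2J_\varsigma w_x(L)=0,$$ where $\delta_L$ is the Dirac mass at $x=L$, closed by the feedback $$V(t)=-k_1\,\ell(\dot w(t)),\qquad \ell(\psi)=\varsigma h_2h_3\tilde BB_2\,(P_\varsigma\psi_x)(L)+B_3\,\psi_x(L)\quad(\psi\in V).$$ In variational form (the distributions $(\delta_L)_x$ and $(P_\varsigma\delta_L)_x$ act on test functions $\psi$ as $-\psi_x(L)$ and $-(P_\varsigma\psi_x)(L)$), the closed-loop operator $\tilde{\mathcal A}:\mathrm{Dom}(\tilde{\mathcal A})\subset\mathcal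 H\to\mathcal H$ is: $\mathrm{Dom}(\tilde{\mathcal A})$ is the set of $(z_1,z_2)\in V\times V$ for which there is $f\in L^2(0,L)$ with $$\int_0^L m f\bar\psi\,dx=-a(z_1,\psi)-\frac{k_1\gamma}{B_4}\,\ell(z_2)\,\overline{\ell(\psi)}\qquad\text{for all }\psi\in V,$$ and then $\tilde{\mathcal A}(z_1,z_2)=(z_2,f)$. The operator $\tilde{\mathcal A}$ generates a $C_0$-semigroup of contractions on $\mathcal H$, and ''solution'' means $\Phi(t)=e^{\tilde{\mathcal A}t}\Phi^0$. *)

(* Defs.v *)
From HB Require Import structures.
From mathcomp Require Import all_boot all_order all_algebra.
From mathcomp Require Import all_classical all_reals all_analysis.
From mathcomp Require Import complex.

Set Implicit Arguments.
Unset Strict Implicit.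
Unset Printing Implicit Defensive.
Import Order.TTheory GRing.Theory Num.Theory.
Import numFieldNormedType.Exports.

Local Open Scope classical_set_scope.
Local Open Scope complex_scope.
Local Open Scope ring_scope.

(* Functions on an interval are represented by total functions R -> R[i]; every
   notion below depends only on their values on [0, len], and the L^2 notions
   only on their values almost everywhere. *)

Definition cintegral (R : realType) (D : set R) (f : R -> R[i]) : R[i] :=
  (\int[@lebesgue_measure R]_(x in D) complex.Re (f x)) +i*
  (\int[@lebesgue_measure R]_(x in D) complex.Im (f x)).

Definition L2 (R : realType) (len : R) : set (R -> R[i]) :=
  [set f : R -> R[i] | [/\
    measurable_fun `]0, len[ (fun x => complex.Re (f x)),
    measurable_fun `]0, len[ (fun x => complex.Im (f x)) &
    (@lebesgue_measure R).-integrable `]0, len[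
      (fun x => (complex.Re (f x) ^+ 2 + complex.Im (f x) ^+ 2)%:E)]].

Definition ae_equal (R : realType) (len : R) (f g : R -> R[i]) : Prop :=
  {ae (@lebesgue_measure R), forall x, x \in `]0, len[ -> f x = g x}.

Definition primitive (R : realType) (len : R) (f g : R -> R[i]) : Prop :=
  forall x, x \in `[0, len] -> f x = f 0 + cintegral `]0, x[ g.

(* By the one-dimensional embedding a class in H^2(0, len) is represented by its C^1 representative psi on
   [0, len]: psi and psi_x are absolutely continuous and psi_xx is in L^2.
   Here p = (psi_x, psi_xx); psi determines p.1 on [0, len], endpoints
   included, and p.2 almost everywhere. *)
Definition H2_derivatives (R : realType) (len : R) (psi : R -> R[i]) :
    set ((R -> R[i]) * (R -> R[i])) :=
  [set p | [/\ primitive len psi p.1, primitive len p.1 p.2 & L2 len p.2]].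

Definition H2 (R : realType) (len : R) : set (R -> R[i]) :=
  [set psi | exists p, H2_derivatives len psi p].

Definition Dx (R : realType) (len : R) (psi : R -> R[i]) : R -> R[i] :=
  (xget (0, 0) (H2_derivatives len psi)).1.

Definition Dxx (R : realType) (len : R) (psi : R -> R[i]) : R -> R[i] :=
  (xget (0, 0) (H2_derivatives len psi)).2.

Record beam (R : realType) := Beam {
  beam_len : R; beam_mass : R; beam_varsigma : R; beam_beta : R;
  beam_gamma : R; beam_h2 : R; beam_h3 : R;
  beam_A : R; beam_B1 : R; beam_B2 : R; beam_B3 : R; beam_B4 : R; beam_C : R }.

Definition Atilde (R : realType) (b : beam R) : R :=
  beam_A b - beam_gamma b ^+ 2 * beam_beta b * beam_B3 b ^+ 2 / beam_B4 b.

Definition Btilde (R : realType) (b : beam R) : R :=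
  beam_B1 b - beam_gamma b * beam_B2 b * beam_B3 b / beam_B4 b.

Definition Ctilde (R : realType) (b : beam R) : R :=
  beam_C b + beam_gamma b * beam_h2 b * beam_h3 b * beam_B2 b ^+ 2 / beam_B4 b.

(* Pop b f is the inverse image of f under varsigma * Ctilde - D_x^2 on
   {psi in H^2 : psi(0) = psi_x(len) = 0}: for f in L^2 and positive constants
   there is exactly one such psi on [0, len]. *)
Definition Pop_graph (R : realType) (b : beam R) (f : R -> R[i]) :
    set (R -> R[i]) :=
  [set psi | [/\ H2 (beam_len b) psi, psi 0 = 0,
    Dx (beam_len b) psi (beam_len b) = 0 &
    ae_equal (beam_len b)
      (fun x => (beam_varsigma b * Ctilde b)%:C * psi x
                - Dxx (beam_len b) psi x) f]].

Definition Pop (R : realType) (b : beam R) (f : R -> R[i]) : R -> R[i] :=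
  xget 0 (Pop_graph b f).

Definition Jop (R : realType) (b : beam R) (f : R -> R[i]) : R -> R[i] :=
  fun x => (beam_varsigma b * Ctilde b)%:C * Pop b f x - f x.

Definition Vspace (R : realType) (b : beam R) : set (R -> R[i]) :=
  [set psi | [/\ H2 (beam_len b) psi, psi 0 = 0 & Dx (beam_len b) psi 0 = 0]].

Definition a_form (R : realType) (b : beam R) (u v : R -> R[i]) : R[i] :=
  cintegral `]0, beam_len b[ (fun x =>
    (Atilde b)%:C * Dxx (beam_len b) u x * (Dxx (beam_len b) v x)^*
    - (beam_gamma b * beam_beta b * beam_varsigma b * beam_h2 b * beam_h3 b
       * Btilde b ^+ 2)%:C
      * Jop b (Dx (beam_len b) u) x * (Dx (beam_len b) v x)^*).

Definition state (R : realType) : lmodType R[i] :=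
  ((R -> R[i]) * (R -> R[i]))%type.

Definition Hspace (R : realType) (b : beam R) : set (state R) :=
  [set u | Vspace b u.1 /\ L2 (beam_len b) u.2].

Definition Hinner (R : realType) (b : beam R) (u v : state R) : R[i] :=
  cintegral `]0, beam_len b[ (fun x => (beam_mass b)%:C * u.2 x * (v.2 x)^*)
  + a_form b u.1 v.1.

Definition Hnorm (R : realType) (b : beam R) (u : state R) : R :=
  Num.sqrt (complex.Re (Hinner b u u)).

Definition ell (R : realType) (b : beam R) (psi : R -> R[i]) : R[i] :=
  (beam_varsigma b * beam_h2 b * beam_h3 b * Btilde b * beam_B2 b)%:C
    * Pop b (Dx (beam_len b) psi) (beam_len b)
  + (beam_B3 b)%:C * Dx (beam_len b) psi (beam_len b).

(* Graph of the closed-loop operator: z is in the domain and y = (y.1, y.2) is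
   the image of z.  As z.2 is an L^2 function, "z.2 in Vspace" means that z.2
   is a.e. equal to an element of Vspace; that element is y.1, the first
   component of the image, and it represents z.2 in the term ell(z.2). *)
Definition closed_loop (R : realType) (b : beam R) (k1 : R)
    (z y : state R) : Prop :=
  [/\ Vspace b z.1, Vspace b y.1, ae_equal (beam_len b) z.2 y.1,
      L2 (beam_len b) y.2 &
   forall psi, Vspace b psi ->
     cintegral `]0, beam_len b[ (fun x => (beam_mass b)%:C * y.2 x * (psi x)^*)
     = - a_form b z.1 psi
       - (k1 * beam_gamma b / beam_B4 b)%:C * ell b y.1 * (ell b psi)^*].

(* C_0-semigroup of linear contractions on the space of elements of X modulo
   the null space of the seminorm nrm: equality of elements of X is
   nrm (u - v) = 0. *)
Record contraction_semigroup (R : realType) (E : lmodType R[i]) (X : set E)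
    (nrm : E -> R) (T : R -> E -> E) : Prop := {
  semigroup_stable : forall t u, 0 <= t -> X u -> X (T t u);
  semigroup_linear : forall t (c : R[i]) u v, 0 <= t -> X u -> X v ->
    nrm (T t (c *: u + v) - (c *: T t u + T t v)) = 0;
  semigroup_contraction : forall t u, 0 <= t -> X u -> nrm (T t u) <= nrm u;
  semigroup_0 : forall u, X u -> nrm (T 0 u - u) = 0;
  semigroup_add : forall s t u, 0 <= s -> 0 <= t -> X u ->
    nrm (T (s + t) u - T s (T t u)) = 0;
  semigroup_continuous : forall u, X u ->
    nrm (T t u - u) @[t --> 0^'+] --> (0 : R) }.

Definition generates (R : realType) (E : lmodType R[i]) (X : set E)
    (nrm : E -> R) (A : E -> E -> Prop) (T : R -> E -> E) : Prop :=
  forall u v, X u -> X v ->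
    (A u v <->
     nrm ((t^-1)%:C *: (T t u - u) - v) @[t --> 0^'+] --> (0 : R)).

(* Main.v *)
Require Import Defs.
From HB Require Import structures.
From mathcomp Require Import all_boot all_order all_algebra.
From mathcomp Require Import all_classical all_reals all_analysis.
From mathcomp Require Import complex.
From mathcomp Require Import measurable_realfun ring lra.
Import Order.TTheory GRing.Theory Num.Theory.
Import numFieldNormedType.Exports.
Local Open Scope classical_set_scope.
Local Open Scope ring_scope.

Set Implicit Arguments.
Unset Strict Implicit.
Unset Printing Implicit Defensive.

(* For a contraction semigroup on a real Hilbert space whose generator has
   relatively compact graph-norm-bounded sets, an orbit that does not tend to 0
   produces a nonzero vector on which the semigroup acts isometrically.
   Minimising |A v| over such unit vectors v in the domain makes v satisfy
   A^2 v = - l v with l >= 0 and Av orthogonal to v, so that it only remains to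
   exclude undamped modes.

   For the beam, v is determined by its second derivative in L^2, and
   a(u, v) becomes a bounded coercive form alpha in u_xx and v_xx.  The
   dissipation identity Re <A z, z> = - k |ell(z_2)|^2 makes ell vanish along an
   undamped mode.  With p = P u_x, such a mode solves a sixth-order linear
   two-point boundary value problem with one boundary condition in excess
   (ell u = 0).  After the reflection s = L - x all unknowns have vanishing first
   derivatives or values at s = 0, and the signs of the remaining data decide:
   either the solution stays in a cone incompatible with the conditions at
   s = L, or the characteristic cubic has roots - t < 0 < l2 < l3 and the
   corresponding modes force t L^2 <= 4/3, while the Poincare inequality for the
   mode gives t L^2 >= 2. *)

(** * Calculus on a closed interval *)

(** Passing to [A^2 v = - l v] keeps the scalars real: the real and imaginary parts of a mode solve
    the same real problem separately, and no spectral theory of a complex operator enters. Since [v]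
    and [A v] are both undamped, [ell] vanishes on the velocity and, for [l <> 0], on the
    displacement. The constants are only assumed positive, so modes have to be excluded by signs and
    sizes. Up to a global sign and vanishing data, the cone argument leaves open only the case where
    [Q(0)], [W(0)] and [mu = M'(0)] are all positive. There the three modal combinations of [M],
    [W], [Q] share the slope [mu] at [s = 0] and the value [nu = M(L)] at [s = L]. The two
    hyperbolic ones force [nu > mu L]; the oscillating one, with value [D] at [s = 0], conserves
    energy, so [t nu^2 <= mu^2 + t D^2]. Comparing [|D|] with the hyperbolic ones, by [nu - mu L] if
    [D < 0] and by [mu L / 2] otherwise, leaves [t L^2 <= 4/3]. The opposing bound [t L^2 >= 2]
    reflects the constant [L^2 / 2] of the Poincare inequality with one vanishing end. *)

Definition deriv_on {R : realType} (a b : R) (f f' : R -> R) : Prop :=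
  {within `[a, b], continuous f} /\
  forall x, a < x < b -> is_derive x 1 f (f' x).

Section DerivOn.
Context {R : realType}.
Implicit Types (a b x y k : R) (f g : R -> R).

Lemma deriv_on_eq a b f g f' g' : deriv_on a b f f' ->
  f =1 g -> (forall x, a < x < b -> f' x = g' x) -> deriv_on a b g g'.
Proof.
move=> [cf df] /funext <- e; split=> // x ab.
by rewrite -e //; exact: df.
Qed.

Lemma deriv_on_cst a b k : deriv_on a b (fun=> k) (fun=> 0).
Proof. by split=> [x|x _]; [exact: cst_continuous | exact: is_derive_cst]. Qed.

Lemma deriv_on_id a b : deriv_on a b id (fun=> 1).
Proof.
split=> [|x _]; last exact: is_derive_id.
by apply: continuous_subspaceT => x; exact: cvg_id.
Qed.

Lemma deriv_onD a b f f' g g' : deriv_on a b f f' -> deriv_on a b g g' ->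
  deriv_on a b (fun x => f x + g x) (fun x => f' x + g' x).
Proof.
move=> [cf df] [cg dg]; split=> [x|x ab].
  by apply: continuousD; [exact: cf|exact: cg].
by apply: is_deriveD; [exact: df|exact: dg].
Qed.

Lemma deriv_onM a b f f' g g' : deriv_on a b f f' -> deriv_on a b g g' ->
  deriv_on a b (fun x => f x * g x) (fun x => f' x * g x + f x * g' x).
Proof.
move=> [cf df] [cg dg]; split=> [x|x ab].
  by apply: continuousM; [exact: cf|exact: cg].
apply: is_derive_eq.
  by apply: is_deriveM; [exact: df|exact: dg].
by rewrite /GRing.scale/=; ring.
Qed.

Lemma deriv_onZ a b k f f' : deriv_on a b f f' ->
  deriv_on a b (fun x => k * f x) (fun x => k * f' x).
Proof.
move=> df; apply: deriv_on_eq (deriv_onM (deriv_on_cst a b k) df) _ _ => // x _.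
by ring.
Qed.

Lemma deriv_onN a b f f' : deriv_on a b f f' ->
  deriv_on a b (fun x => - f x) (fun x => - f' x).
Proof.
move=> df; apply: deriv_on_eq (deriv_onZ (-1) df) _ _ => x /=; first by ring.
by move=> _; ring.
Qed.

Lemma deriv_onB a b f f' g g' : deriv_on a b f f' -> deriv_on a b g g' ->
  deriv_on a b (fun x => f x - g x) (fun x => f' x - g' x).
Proof. by move=> df dg; exact: deriv_onD df (deriv_onN dg). Qed.

Lemma deriv_on_expR a b k :
  deriv_on a b (fun x => expR (k * x)) (fun x => k * expR (k * x)).
Proof.
split=> [|x _].
  apply: continuous_subspaceT => x.
  apply: (@continuous_comp _ _ _ ( *%R k) expR); first exact: mulrl_continuous.
  exact: continuous_expR.
have dk : is_derive x 1 ( *%R k) k.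
  by apply: is_derive_eq (is_deriveZ k (is_derive_id x 1)) _; rewrite /GRing.scale/= mulr1.
by apply: is_derive_eq (is_derive1_comp (is_derive_expR (k * x)) dk) _; rewrite mulrC.
Qed.

Lemma deriv_on_sub a b c d f f' : a <= c -> d <= b ->
  deriv_on a b f f' -> deriv_on c d f f'.
Proof.
move=> ac db [cf df]; split=> [|x /andP[cx xd]].
  apply: continuous_subspaceW cf => x /=; rewrite !in_itv/= => /andP[cx xd].
  by rewrite (le_trans ac) // (le_trans xd).
by apply: df; rewrite (le_lt_trans ac) // (lt_le_trans xd).
Qed.

Lemma deriv_on_MVT a b f f' x y : deriv_on a b f f' -> a <= x -> x < y ->
  y <= b -> exists2 c, x < c < y & f y - f x = f' c * (y - x).
Proof.
move=> df ax xy yb; have [cf {}df] := deriv_on_sub ax yb df.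
have dz z : z \in `]x, y[ -> is_derive z 1 f (f' z) by rewrite in_itv; exact: df.
have [c] := MVT xy dz cf.
by rewrite in_itv/= => cxy e; exists c.
Qed.

Lemma deriv_on_le a b f f' x y : deriv_on a b f f' ->
  (forall z, a < z < b -> 0 <= f' z) -> a <= x -> x <= y -> y <= b ->
  f x <= f y.
Proof.
move=> df f0 ax; rewrite le_eqVlt => /predU1P[->//|xy yb].
have [c /andP[xc cy] e] := deriv_on_MVT df ax xy yb.
rewrite -subr_ge0 e mulr_ge0 ?subr_ge0 ?(ltW xy)// f0//.
by rewrite (le_lt_trans ax) // (lt_le_trans cy).
Qed.

Lemma deriv_on_lt a b f f' x y : deriv_on a b f f' ->
  (forall z, a < z < b -> 0 < f' z) -> a <= x -> x < y -> y <= b ->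
  f x < f y.
Proof.
move=> df f0 ax xy yb.
have [c /andP[xc cy] e] := deriv_on_MVT df ax xy yb.
rewrite -subr_gt0 e mulr_gt0 ?subr_gt0 // f0//.
by rewrite (le_lt_trans ax) // (lt_le_trans cy).
Qed.

Lemma deriv_on_const a b f f' x y : deriv_on a b f f' ->
  (forall z, a < z < b -> f' z = 0) -> a <= x <= b -> a <= y <= b ->
  f x = f y.
Proof.
move=> df f0.
wlog xy : x y / x <= y => [hw xab yab|/andP[ax _] /andP[_ yb]].
  by have [/hw->//|/ltW/hw->//] := leP x y.
apply/eqP; rewrite eq_le (deriv_on_le df _ ax xy yb) ?andTb; last first.
  by move=> z /f0->.
rewrite -lerN2; apply: (deriv_on_le (deriv_onN df) _ ax xy yb).
by move=> z /f0->; rewrite oppr0.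
Qed.

(** Convexity: the slope does not decrease, so the graph lies above its tangent at [a]. *)
Lemma deriv_on_convex_ge a b f f1 f2 x : deriv_on a b f f1 -> deriv_on a b f1 f2 ->
  (forall z, a < z < b -> 0 <= f2 z) -> a <= x <= b ->
  f1 a <= f1 x /\ f a + f1 a * (x - a) <= f x.
Proof.
move=> df df1 f20 /andP[ax xb].
have f1a z : a <= z -> z <= b -> f1 a <= f1 z.
  by move=> az zb; exact: deriv_on_le df1 f20 _ az zb.
split; first exact: f1a.
pose g z := f z - f1 a * z.
have dg : deriv_on a b g (fun z => f1 z - f1 a).
  apply: deriv_on_eq (deriv_onB df (deriv_onZ (f1 a) (deriv_on_id a b))) _ _ => //.
  by move=> z _; rewrite mulr1.
have : g a <= g x.
  apply: deriv_on_le dg _ _ ax xb => // z /andP[az zb].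
  by rewrite subr_ge0 f1a // ltW.
by rewrite /g; lra.
Qed.

(* Multiply by the integrating factors exp(-nu x) and exp(nu x), nu^2 = k. *)
Lemma hyperbolic_ge0 a b k f f1 f2 : 0 <= k ->
  deriv_on a b f f1 -> deriv_on a b f1 f2 ->
  (forall z, a < z < b -> k * f z <= f2 z) -> 0 <= f a -> 0 <= f1 a ->
  forall x, a <= x <= b -> 0 <= f x.
Proof.
move=> k0 df df1 hf fa f1a x /andP[ax xb].
set nu := Num.sqrt k.
have nu0 : 0 <= nu by exact: sqrtr_ge0.
have nu2 : nu * nu = k by rewrite -expr2 sqr_sqrtr.
pose g z := expR (- nu * z) * (f1 z + nu * f z).
have dg := deriv_onM (deriv_on_expR a b (- nu)) (deriv_onD df1 (deriv_onZ nu df)).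
have g0 z : a <= z -> z <= b -> 0 <= f1 z + nu * f z.
  move=> az zb; have : g a <= g z.
    apply: deriv_on_le dg _ _ az zb => // y yab /=.
    have -> : - nu * expR (- nu * y) * (f1 y + nu * f y) +
      expR (- nu * y) * (f2 y + nu * f1 y) =
      expR (- nu * y) * (f2 y - k * f y) by rewrite -nu2; ring.
    by rewrite mulr_ge0 ?expR_ge0 ?subr_ge0 ?hf.
  have : 0 <= g a by rewrite mulr_ge0 ?expR_ge0 // addr_ge0 // mulr_ge0.
  by move=> h1 h2; have := le_trans h1 h2; rewrite /g pmulr_rge0 // expR_gt0.
have dh := deriv_onM (deriv_on_expR a b nu) df.
have : 0 <= expR (nu * x) * f x.
  apply: le_trans (_ : expR (nu * a) * f a <= _).
    by rewrite mulr_ge0 ?expR_ge0.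
  apply: (deriv_on_le dh _ _ ax xb) => // y /andP[ay yb].
  rewrite (_ : _ + _ = expR (nu * y) * (f1 y + nu * f y)); last by ring.
  by rewrite mulr_ge0 ?expR_ge0 ?g0 ?ltW.
by rewrite pmulr_rge0 // expR_gt0.
Qed.

Lemma within_continuous_itvP a b f : {within `[a, b], continuous f} <->
  forall x, a <= x <= b -> forall e : R, 0 < e ->
    exists2 d : R, 0 < d & forall y, a <= y <= b -> `|x - y| < d -> `|f x - f y| < e.
Proof.
split=> [cf x xab e e0|h].
  have /subspace_continuousP/(_ x) := cf; rewrite /= in_itv/= => /(_ xab).
  move=> /cvgrPdist_lt/(_ e e0)/nbhs_ballP[d /= d0 dP].
  by exists d => // y yab xy; apply: dP.
apply/subspace_continuousP => x; rewrite /= in_itv/= => xab.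
apply/cvgrPdist_lt => e e0; have [d d0 dP] := h x xab e e0.
apply/nbhs_ballP; exists d => //= y xy; rewrite in_itv/= => yab.
exact: dP.
Qed.

Lemma deriv_on_reflect b f f' : deriv_on 0 b f f' ->
  deriv_on 0 b (fun x => f (b - x)) (fun x => - f' (b - x)).
Proof.
move=> [/within_continuous_itvP cf df]; split=> [|x /andP[x0 xb]].
  apply/within_continuous_itvP => x /andP[x0 xb] e e0.
  have [|d d0 dP] := cf (b - x) _ e e0; first by rewrite subr_ge0 xb gerBl.
  exists d => // y /andP[y0 yb] xy; apply: dP; first by rewrite subr_ge0 yb gerBl.
  by rewrite (_ : b - x - (b - y) = - (x - y)) ?normrN //; ring.
have d1 : is_derive x 1 (fun y => b - y) (-1).
  by apply: is_derive_eq (is_deriveB (is_derive_cst b x 1) (is_derive_id x 1)) _; rewrite sub0r.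
have d2 : is_derive (b - x) 1 f (f' (b - x)) by apply: df; rewrite subr_gt0 xb gtrBl.
exact: (is_derive_eq (@is_derive1_comp _ f (fun y => b - y) x _ _ d2 d1) (mulrN1 _)).
Qed.

(** The point is the infimum of the set where [f <= 0]. The sign arguments below work on the
    interval before such a first zero, where a sign is known, and then look at the zero itself. *)
Lemma continuous_first_zero a b f : a <= b -> {within `[a, b], continuous f} ->
  0 < f a -> (exists2 x, a <= x <= b & f x <= 0) ->
  exists2 s, a < s <= b & f s = 0 /\ forall x, a <= x < s -> 0 < f x.
Proof.
move=> ab cf fa [x0 /andP[ax0 x0b] fx0].
pose S := [set x | a <= x <= b /\ f x <= 0].
have Sx0 : S x0 by split=> //; rewrite ax0.
have hS : has_inf S by split; [exists x0|exists a => x [/andP[]]].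
set s := inf S.
have as_ : a <= s by apply: lb_le_inf; [exists x0|move=> x [/andP[]]].
have sb : s <= b by rewrite (le_trans _ x0b) // /s; apply: ge_inf => //; case: hS.
have pos x : a <= x < s -> 0 < f x.
  move=> /andP[ax xs]; rewrite ltNge; apply/negP => fx.
  have : s <= x.
    apply: ge_inf; first by case: hS.
    by split=> //; rewrite ax (le_trans (ltW xs)).
  by rewrite leNgt xs.
move/within_continuous_itvP in cf.
have fs0 : f s <= 0.
  rewrite leNgt; apply/negP => fs.
  have [|d d0 dP] := cf s _ (f s) fs; first by rewrite as_.
  have [y [/andP[ay yb] fy] ysd] := inf_adherent d0 hS.
  have sy : s <= y by apply: ge_inf; [case: hS|split=> //; rewrite ay].
  have := dP y; rewrite ay yb => /(_ erefl).
  rewrite ler0_norm ?subr_le0 // opprB ltrBlDl => /(_ ysd).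
  by rewrite ltr_norml; lra.
have as' : a < s.
  by rewrite lt_neqAle as_ andbT; apply: contraTneq fs0 => <-; rewrite -ltNge.
exists s; first by rewrite as'.
split=> //; apply/eqP; rewrite eq_le fs0 /= leNgt; apply/negP => fs.
have [||d d0 dP] := cf s _ (- f s); rewrite ?oppr_gt0 ?as_//.
pose y := Num.max a (s - d / 2).
have ys : y < s by rewrite /y gt_max as' /=; lra.
have ay : a <= y by rewrite /y le_max lexx.
have := pos y; rewrite ay ys => /(_ erefl).
have := dP y; rewrite ay (le_trans (ltW ys) sb) => /(_ erefl).
rewrite ger0_norm ?subr_ge0 ?(ltW ys)//.
have yd : s - d / 2 <= y by rewrite /y le_max lexx orbT.
have h : s - y < d by lra.
by move=> /(_ h); rewrite ltr_norml; lra.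
Qed.

End DerivOn.

(** * Absence of undamped modes: the boundary value problem *)

Section CubicRoots.
Context {R : realType}.

(** The cubic [x^3 - th x^2 - k x + k c] is the characteristic polynomial of the modal system in the
    squared exponents. It is positive at [0], negative at [c] and at [th], and positive at
    [th + k + 1], so it has roots [l2] in [(0, c)] and [l3 > th]; the third root is
    [- t = th - l2 - l3], and the last three identities are Vieta's formulas. The position of the
    roots relative to [c < th] yields [l2 <= t <= l3]. *)
Lemma cubic_roots (c th k : R) : 0 < c -> c < th -> 0 < k ->
  exists l2 l3 t : R, [/\ 0 < l2 < l3, l2 <= t <= l3, th = l2 + l3 - t,
    k = t * (l2 + l3) - l2 * l3 & k * c = t * (l2 * l3)].
Proof.
move=> c0 cth k0.
pose f (x : R) := x * (x * (x - th)) - k * x + k * c.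
have cf (a b : R) : {within `[a, b], continuous f}.
  have d1 := deriv_on_id a b; have dc := deriv_on_cst a b.
  have := deriv_onD (deriv_onB (deriv_onM d1 (deriv_onM d1 (deriv_onB d1 (dc th))))
    (deriv_onZ k d1)) (dc (k * c)).
  by case.
have B0 : 1 <= th + k + 1 by lra.
have f0 : 0 < f 0 by rewrite /f !mul0r; have := mulr_gt0 k0 c0; lra.
have fc : f c < 0.
  have -> : f c = - (c * c * (th - c)) by rewrite /f; ring.
  by rewrite oppr_lt0 !mulr_gt0 ?subr_gt0.
have fth : f th < 0.
  have -> : f th = - (k * (th - c)) by rewrite /f; ring.
  by rewrite oppr_lt0 !mulr_gt0 ?subr_gt0.
have fB : 0 < f (th + k + 1).
  rewrite /f; set B := th + k + 1 in B0 *.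
  have -> : B - th = k + 1 by rewrite /B; ring.
  have : 0 <= (k + 1) * (B * (B - 1)) by rewrite !mulr_ge0 //; lra.
  have := mulr_gt0 k0 c0; nra.
have m1 : Num.min (f 0) (f c) <= 0 <= Num.max (f 0) (f c).
  by rewrite ge_min le_max (ltW fc) (ltW f0) orbT.
have [l2] := IVT (ltW c0) (cf _ _) m1.
rewrite in_itv/= => /andP[l20 l2c] fl2.
have m2 : Num.min (f th) (f (th + k + 1)) <= 0 <= Num.max (f th) (f (th + k + 1)).
  by rewrite ge_min le_max (ltW fth) (ltW fB) orbT.
have thB : th <= th + k + 1 by lra.
have [l3] := IVT thB (cf _ _) m2.
rewrite in_itv/= => /andP[l3t l3B] fl3.
have l20' : 0 < l2 by rewrite lt_neqAle l20 andbT; apply: contra_eq_neq fl2 => <-; rewrite gt_eqF.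
have l2c' : l2 < c by rewrite lt_neqAle l2c andbT; apply: contra_eq_neq fl2 => ->; rewrite lt_eqF.
have l23 : l2 < l3 by lra.
have e1 : k = (l2 + l3 - th) * (l2 + l3) - l2 * l3.
  have h : (l3 - l2) * (l3 * l3 + l3 * l2 + l2 * l2 - th * (l2 + l3) - k) = 0.
    transitivity (f l3 - f l2); last by rewrite fl2 fl3 subrr.
    by rewrite /f; ring.
  move/eqP: h; rewrite mulf_eq0 subr_eq0 (gt_eqF l23)/= => /eqP; lra.
have e2 : k * c = (l2 + l3 - th) * (l2 * l3).
  have := fl2; rewrite /f => h.
  transitivity (k * l2 - l2 * (l2 * (l2 - th))); first by lra.
  by rewrite {1}e1; ring.
exists l2, l3, (l2 + l3 - th); split=> //; [by rewrite l20'| |by ring].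
apply/andP; split; last by lra.
lra.
Qed.
End CubicRoots.

Section EigenOde.
Context {R : realType} (L c th k : R).

(* For an undamped mode u of eigenvalue k Atilde and p = P u_x, in the variable
   s = L - x: Q = - p, W = - p'' and M' = k u. *)
Record eigen_ode (M M1 W W1 Q Q1 : R -> R) : Prop := EigenOde {
  ode_L0 : 0 < L; ode_c0 : 0 < c; ode_cth : c < th; ode_k0 : 0 < k;
  ode_M : deriv_on 0 L M M1;
  ode_M1 : deriv_on 0 L M1 (fun s => k * (c * Q s - W s));
  ode_W : deriv_on 0 L W W1;
  ode_W1 : deriv_on 0 L W1 (fun s => th * W s - M s);
  ode_Q : deriv_on 0 L Q Q1;
  ode_Q1 : deriv_on 0 L Q1 W;
  ode_M0 : M 0 = 0;
  ode_W10 : W1 0 = 0;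
  ode_Q10 : Q1 0 = 0;
  ode_M1L : M1 L = 0;
  ode_WL : W L = 0;
  ode_QL : Q L = 0 }.

Lemma eigen_odeN M M1 W W1 Q Q1 : eigen_ode M M1 W W1 Q Q1 ->
  eigen_ode (fun s => - M s) (fun s => - M1 s) (fun s => - W s)
    (fun s => - W1 s) (fun s => - Q s) (fun s => - Q1 s).
Proof.
move=> [L0 c0 cth k0 dM dM1 dW dW1 dQ dQ1 M0 W10 Q10 M1L WL QL].
split; rewrite ?M0 ?W10 ?Q10 ?M1L ?WL ?QL ?oppr0//; try exact: deriv_onN.
- by apply: deriv_on_eq (deriv_onN dM1) _ _ => // s _; ring.
- by apply: deriv_on_eq (deriv_onN dW1) _ _ => // s _; ring.
Qed.

(** While [M' <= 0], also [M <= 0], so [W'' >= th W] keeps [W >= 0]. Then [W - c Q] has second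
    derivative [(th - c) W - M >= 0] and starts with slope 0. *)
Lemma eigen_ode_cone M M1 W W1 Q Q1 s : eigen_ode M M1 W W1 Q Q1 ->
  0 <= W 0 -> c * Q 0 <= W 0 -> 0 < s <= L ->
  (forall x, 0 < x < s -> M1 x <= 0) ->
  forall x, 0 <= x <= s -> W 0 - c * Q 0 <= W x - c * Q x.
Proof.
move=> [L0 c0 cth k0 dM dM1 dW dW1 dQ dQ1 M0 W10 Q10 M1L WL QL] W00 WQ0 /andP[s0 sL] M10.
have sub f g : deriv_on 0 L f g -> deriv_on 0 s f g by exact: deriv_on_sub.
have Mn x : 0 <= x <= s -> M x <= 0.
  move=> /andP[x0 xs]; rewrite -oppr_ge0 -[leLHS]oppr0 -M0.
  apply: (deriv_on_le (deriv_onN (sub _ _ dM)) _ (lexx _) x0 xs) => z zs.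
  by rewrite oppr_ge0 M10.
have Wp x : 0 <= x <= s -> 0 <= W x.
  have th0 : 0 <= th := le_trans (ltW c0) (ltW cth).
  apply: (hyperbolic_ge0 th0 (sub _ _ dW) (sub _ _ dW1)) => //; last by rewrite W10.
  by move=> z /andP[z0 zs]; rewrite lerDl oppr_ge0 Mn // !ltW.
move=> x xs.
have d1 := sub _ _ (deriv_onB dW (deriv_onZ c dQ)).
have d2 := sub _ _ (deriv_onB dW1 (deriv_onZ c dQ1)).
have [|_] := deriv_on_convex_ge d1 d2 _ xs.
  move=> z /andP[z0 zs] /=.
  have zs' : 0 <= z <= s by rewrite !ltW.
  have := Mn _ zs'; have := Wp _ zs'; have : 0 < th - c by lra.
  by move=> h1 h2 h3; have := mulr_ge0 (ltW h1) h2; lra.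
by rewrite W10 Q10; lra.
Qed.

(** Inside the cone [M'' = - k (W - c Q) <= 0], so [M'] moves further away from 0 and [W - c Q] does
    not decrease. If [M'(0) < 0] this contradicts the first zero of [M']; if [M'(0) = 0] it
    contradicts the first zero of [W - c Q]. Both zeros exist because of the conditions at
    [s = L]. *)
Lemma eigen_ode_cone_contra M M1 W W1 Q Q1 : eigen_ode M M1 W W1 Q Q1 ->
  0 <= W 0 -> c * Q 0 <= W 0 -> M1 0 <= 0 -> M1 0 < 0 \/ c * Q 0 < W 0 -> False.
Proof.
move=> sol W00 WQ0 M10 h.
have [L0 c0 cth k0 dM dM1 dW dW1 dQ dQ1 M0 W10 Q10 M1L WL QL] := sol.
have mono s : 0 < s <= L ->
    (forall x, 0 <= x < s -> 0 < - M1 x) \/ (forall x, 0 <= x < s -> 0 < W x - c * Q x) ->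
    (forall x, 0 < x < s -> 0 <= W x - c * Q x) -> - M1 0 <= - M1 s.
  move=> /andP[s0 sL] _ H.
  apply: (deriv_on_le (deriv_on_sub (lexx _) sL (deriv_onN dM1)) _ (lexx _) (ltW s0) (lexx _)).
  move=> z /H zs /=; have := mulr_ge0 (ltW k0) zs; lra.
have [M1n|M1n] := ltP (M1 0) 0.
  have [||s /andP[s0 sL] [fs fpos]] :=
      @continuous_first_zero _ 0 L (fun x => - M1 x) (ltW L0) (proj1 (deriv_onN dM1)).
  - by rewrite oppr_gt0.
  - by exists L; rewrite ?M1L ?oppr0// lexx ltW.
  have sL' : 0 < s <= L by rewrite s0.
  have : - M1 0 <= - M1 s.
    apply: mono => //; first by left.
    move=> x /andP[x0 xs].
    have : W 0 - c * Q 0 <= W x - c * Q x.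
      apply: (eigen_ode_cone sol W00 WQ0 sL') => [z /andP[z0 zs]|]; last by rewrite !ltW.
      by have := fpos z; rewrite (ltW z0) zs => /(_ erefl); lra.
    by lra.
  by rewrite fs; lra.
have {}M10 : M1 0 = 0 by apply/eqP; rewrite eq_le M10.
have {h} WQ : c * Q 0 < W 0 by case: h => //; rewrite M10 ltxx.
have d1 := deriv_onB dW (deriv_onZ c dQ).
have [||s /andP[s0 sL] [fs fpos]] :=
    @continuous_first_zero _ 0 L (fun x => W x - c * Q x) (ltW L0) (proj1 d1).
- by rewrite subr_gt0.
- by exists L; rewrite ?WL ?QL ?mulr0 ?subr0// lexx ltW.
have sL' : 0 < s <= L by rewrite s0.
have : W 0 - c * Q 0 <= W s - c * Q s.
  apply: (eigen_ode_cone sol W00 WQ0 sL') => [z /andP[z0 zs]|]; last by rewrite lexx ltW.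
  have : - M1 0 <= - M1 z; last by rewrite M10; lra.
  apply: mono; first by rewrite z0 (le_trans (ltW zs)).
    by right=> x /andP[x0 xz]; rewrite fpos // x0 (lt_trans xz).
  by move=> x /andP[x0 xz]; rewrite ltW// fpos // ltW //= (lt_trans xz).
by rewrite fs; lra.
Qed.

(** All six initial data vanish, so this is uniqueness for the Cauchy problem, proved by a Gronwall
    estimate: [exp(- K x) E x] does not increase for the sum of squares [E]. *)
Lemma eigen_ode_zero M M1 W W1 Q Q1 : eigen_ode M M1 W W1 Q Q1 ->
  M1 0 = 0 -> W 0 = 0 -> Q 0 = 0 -> forall s, 0 <= s <= L -> M1 s = 0.
Proof.
move=> [L0 c0 cth k0 dM dM1 dW dW1 dQ dQ1 M0 W10 Q10 M1L WL QL] M10 W0 Q0 s /andP[s0 sL].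
pose E x := M x * M x + M1 x * M1 x + W x * W x + W1 x * W1 x + Q x * Q x + Q1 x * Q1 x.
(* Large enough that [E' <= K E] once every product in [E'] is split by [2 |x y| <= x^2 + y^2]. *)
pose K := 4 + k * c + k + th.
have dE := deriv_onN (deriv_onM (deriv_on_expR 0 L (- K)) (deriv_onD (deriv_onD (deriv_onD
  (deriv_onD (deriv_onD (deriv_onM dM dM) (deriv_onM dM1 dM1)) (deriv_onM dW dW))
  (deriv_onM dW1 dW1)) (deriv_onM dQ dQ)) (deriv_onM dQ1 dQ1))).
have : - (expR (- K * 0) * E 0) <= - (expR (- K * s) * E s).
  apply: (deriv_on_le dE _ (lexx _) s0 sL) => z _ /=.
  set e := expR _; have e0 : 0 <= e by exact: expR_ge0.
  set m := M z; set m1 := M1 z; set w := W z; set w1 := W1 z; set q := Q z; set q1 := Q1 z.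
  have kc0 := mulr_gt0 k0 c0.
  suff : 0 <= K * (m * m + m1 * m1 + w * w + w1 * w1 + q * q + q1 * q1) -
     2 * (m * m1 + m1 * (k * (c * q - w)) + w * w1 + w1 * (th * w - m) + q * q1 + q1 * w).
    by move=> /(mulr_ge0 e0); lra.
  have th0 : 0 < th by lra.
  have sq (x y : R) : 0 <= x * x + y * y - 2 * (x * y) by have := sqr_ge0 (x - y); nra.
  have sq' (x y : R) : 0 <= x * x + y * y + 2 * (x * y) by have := sqr_ge0 (x + y); nra.
  have xx (x : R) : 0 <= x * x by rewrite -expr2 sqr_ge0.
  have := xx m; have := xx m1; have := xx w; have := xx w1; have := xx q; have := xx q1.
  have p1 := mulr_ge0 (ltW kc0) (sq m1 q).
  have p2 := mulr_ge0 (ltW k0) (sq' m1 w).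
  have p3 := mulr_ge0 (ltW th0) (sq w w1).
  have := sq m m1; have := sq w w1; have := sq' w1 m; have := sq q q1; have := sq q1 w.
  have kc (x : R) : 0 <= k * c * (x * x) := mulr_ge0 (ltW kc0) (xx x).
  have kk (x : R) : 0 <= k * (x * x) := mulr_ge0 (ltW k0) (xx x).
  have tt (x : R) : 0 <= th * (x * x) := mulr_ge0 (ltW th0) (xx x).
  have := kc m; have := kc w; have := kc w1; have := kc q1.
  have := kk m; have := kk w1; have := kk q; have := kk q1.
  have := tt m; have := tt m1; have := tt q; have := tt q1.
  rewrite /K; move: p1 p2 p3; clear; lra.
have E0 : E 0 = 0 by rewrite /E M0 M10 W0 W10 Q0 Q10; ring.
rewrite E0 mulr0 oppr0 oppr_ge0 pmulr_rle0 ?expR_gt0// => Es.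
have xx (x : R) : 0 <= x * x by rewrite -expr2 sqr_ge0.
have : M1 s * M1 s = 0.
  apply/eqP; rewrite eq_le xx andbT; apply: le_trans Es; rewrite /E.
  by have := xx (M s); have := xx (W s); have := xx (W1 s); have := xx (Q s); have := xx (Q1 s); lra.
by move/eqP; rewrite mulf_eq0 orbb => /eqP.
Qed.

End EigenOde.

(** * Comparison of solutions of [X'' = l X] *)

Section Comparison.
Context {R : realType}.

Lemma deriv_on_zero_le0 (a b : R) f f' f2 : a < b -> deriv_on a b f f' -> deriv_on a b f' f2 ->
  f b = 0 -> (forall x, a <= x < b -> 0 < f x) -> f' b <= 0.
Proof.
move=> ab df [/within_continuous_itvP cf' _] fb fpos.
rewrite leNgt; apply/negP => f'b.
have [|d d0 dP] := cf' b _ _ f'b; first by rewrite lexx ltW.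
pose y := Num.max a (b - d / 2).
have yb : y < b by rewrite /y gt_max ab /=; lra.
have ay : a <= y by rewrite /y le_max lexx.
have yd : b - d / 2 <= y by rewrite /y le_max lexx orbT.
have : f y <= f b.
  apply: (deriv_on_le (deriv_on_sub ay (lexx b) df) _ (lexx y) (ltW yb) (lexx b)).
  move=> z /andP[yz zb]; have := dP z.
  rewrite (ltW zb) (le_trans ay (ltW yz)) => /(_ erefl).
  have h : `|b - z| < d by rewrite ger0_norm ?subr_ge0 ?(ltW zb)//; lra.
  by move=> /(_ h); rewrite ltr_norml; lra.
by rewrite fb leNgt fpos // ay.
Qed.

(** As long as [X] is negative it is concave, hence lies below its tangent at 0. A first zero before
    [s] would therefore need the tangent to have become nonnegative already. *)
Lemma hyperbolic_neg (a l D s : R) X X1 : 0 <= l -> deriv_on 0 a X X1 ->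
  deriv_on 0 a X1 (fun z => l * X z) -> X 0 < 0 -> 0 <= X1 0 -> 
  0 <= s <= a -> X 0 + X1 0 * s < 0 -> X s < 0.
Proof.
move=> l0 dX dX1 X0 X10 /andP[s0 sa] h; rewrite ltNge; apply/negP => Xs.
have dN := deriv_onN dX.
have [||z /andP[z0 zs] [fz fpos]] :=
  @continuous_first_zero _ 0 s (fun x => - X x) s0 (proj1 (deriv_on_sub (lexx _) sa dN)).
- by rewrite oppr_gt0.
- by exists s; rewrite ?oppr_le0// s0 lexx.
have za : z <= a := le_trans zs sa.
have [||_] := deriv_on_convex_ge (x := z) (deriv_on_sub (lexx _) za dN)
  (deriv_on_sub (lexx _) za (deriv_onN dX1)).
- move=> y /andP[y0 yz]; rewrite -mulrN mulr_ge0 // ltW// fpos// yz ltW//.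
- by rewrite lexx ltW.
rewrite fz => hz; have : X1 0 * z <= X1 0 * s by rewrite ler_wpM2l.
by lra.
Qed.

(* Reflect about the midpoint: X + X(L - .) is even there, so it keeps the sign of X (L / 2). *)
Lemma hyperbolic_start_bound (L l : R) X X1 : 0 < L -> 0 <= l -> deriv_on 0 L X X1 ->
  deriv_on 0 L X1 (fun z => l * X z) -> 0 < X1 0 -> X1 0 * L < X L ->
  - X 0 <= X1 0 * L / 2.
Proof.
move=> L0 l0 dX dX1 X10 hL; rewrite leNgt; apply/negP => hD.
have mL := mulr_gt0 X10 L0.
have X0 : X 0 < 0 by lra.
have neg s : 0 <= s <= L -> X 0 + X1 0 * s < 0 -> X s < 0.
  by move=> sL; apply: (hyperbolic_neg 0 l0 dX dX1 X0 (ltW X10)).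
have Xh : X (L / 2) < 0 by apply: neg; [apply/andP; split; lra|lra].
have L2 : 0 <= L / 2 by lra.
have L2L : L / 2 <= L by lra.
have dY := deriv_onN (deriv_onD dX (deriv_on_reflect dX)).
have dY1 := deriv_onN (deriv_onD dX1 (deriv_onN (deriv_on_reflect dX1))).
have half : L - L / 2 = L / 2 by field.
have : 0 <= - (X L + X (L - L)).
  apply: (@hyperbolic_ge0 _ (L / 2) L l _ _ _ l0 (deriv_on_sub L2 (lexx _) dY)
    (deriv_on_sub L2 (lexx _) dY1)).
  - by move=> z _ /=; rewrite -subr_ge0 le_eqVlt; apply/orP; left; apply/eqP; ring.
  - by rewrite half; lra.
  - by rewrite half; lra.
  - by rewrite L2L lexx.
rewrite subrr => XL.
suff : X L < 0 by lra.
by apply: neg; [rewrite lexx ltW|lra].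
Qed.

(** The combination [Z = l3 X - l2 Y] is convex up to the first meeting point [s] of [X] and [Y],
    because [Z'' = l2 l3 (X - Y)]. At [s] it equals [(l3 - l2) X(s)], and its tangent at 0 has
    positive value and slope [(l3 - l2) X'(0)]; this gives [X'(0) s < X(s)]. It remains to see that
    the meeting point is [L] itself. *)
Lemma hyperbolic_pair (L l2 l3 : R) X Y X1 Y1 : 0 < L -> 0 < l2 < l3 ->
  deriv_on 0 L X X1 -> deriv_on 0 L X1 (fun z => l2 * X z) ->
  deriv_on 0 L Y Y1 -> deriv_on 0 L Y1 (fun z => l3 * Y z) ->
  0 < X1 0 -> Y1 0 = X1 0 -> X L = Y L -> Y 0 < X 0 -> l2 * Y 0 < l3 * X 0 ->
  X1 0 * L < X L.
Proof.
move=> L0 /andP[l20 l23] dX dX1 dY dY1 mu0 Y10 XYL XY0 Z0.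
have dU := deriv_onB dX dY; have dU1 := deriv_onB dX1 dY1.
have dZ := deriv_onB (deriv_onZ l3 dX) (deriv_onZ l2 dY).
have dZ1 := deriv_onB (deriv_onZ l3 dX1) (deriv_onZ l2 dY1).
have l30 : 0 < l3 by lra.
have [||s /andP[s0 sL] [Us Upos]] :=
    @continuous_first_zero _ 0 L (fun x => X x - Y x) (ltW L0) (proj1 dU).
- by rewrite subr_gt0.
- by exists L; rewrite ?XYL ?subrr// lexx ltW.
have sub f g : deriv_on 0 L f g -> deriv_on 0 s f g by exact: deriv_on_sub.
have [||Z1s Zs] := deriv_on_convex_ge (x := s) (sub _ _ dZ) (sub _ _ dZ1).
- move=> z /andP[z0 zs]; rewrite (_ : _ - _ = l2 * l3 * (X z - Y z)); last by ring.
  by rewrite !mulr_ge0 ?ltW // Upos // zs ltW.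
- by rewrite lexx ltW.
have l32 : 0 < l3 - l2 by lra.
have XYs : Y s = X s by lra.
have Zs' : (l3 - l2) * (X1 0 * s) < (l3 - l2) * X s by move: Zs; rewrite XYs Y10; lra.
have {Zs'} Xs : X1 0 * s < X s by rewrite ltr_pM2l in Zs'.
have [->//|sneL] := eqVneq L s.
(* Suppose the meeting occurs before [L]. Then [X] is positive with positive slope at [s] and stays
   positive, and [V = Y - X] satisfies [V'' = l3 V + (l3 - l2) X > 0] with [V(s) = 0] and
   [V'(s) >= 0]. So [Y] separates strictly from [X], against [X L = Y L]. *)
have {sneL} sL' : s < L by rewrite lt_neqAle eq_sym sneL.
have Xs0 : 0 < X s by apply: le_lt_trans Xs; rewrite mulr_ge0 // ltW.
have U1s : X1 s - Y1 s <= 0.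
  by apply: (deriv_on_zero_le0 s0 (sub _ _ dU) (sub _ _ dU1)) => //.
have X1s : 0 < X1 s.
  move: Z1s; rewrite Y10 => Z1s.
  have : 0 < (l3 - l2) * X1 s.
    apply: lt_le_trans (_ : l3 * X1 s - l2 * Y1 s <= _).
      by apply: lt_le_trans Z1s; rewrite -mulrBl mulr_gt0.
    by have := ler_wpM2l (ltW l20) U1s; lra.
  by rewrite pmulr_rgt0.
have sub' f g : deriv_on 0 L f g -> deriv_on s L f g by apply: deriv_on_sub => //; exact: ltW.
have Xp z : s <= z <= L -> 0 < X z.
  move=> /andP[sz zL].
  have Xge0 x : s <= x <= L -> 0 <= X x.
    by apply: (hyperbolic_ge0 (ltW l20) (sub' _ _ dX) (sub' _ _ dX1)) => //; exact: ltW.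
  have [||_] := deriv_on_convex_ge (x := z) (sub' _ _ dX) (sub' _ _ dX1).
  - by move=> y /andP[sy yL]; rewrite mulr_ge0 ?(ltW l20)// Xge0 // !ltW.
  - by rewrite sz.
  by apply: lt_le_trans; rewrite ltr_wpDr // mulr_ge0 ?(ltW X1s) // subr_ge0.
have dV := sub' _ _ (deriv_onB dY dX); have dV1 := sub' _ _ (deriv_onB dY1 dX1).
have V0 z : s <= z <= L -> 0 <= Y z - X z.
  apply: (hyperbolic_ge0 (ltW l30) dV dV1).
  - move=> y /andP[sy yL]; have Xy : 0 < X y by rewrite Xp // (ltW sy) (ltW yL).
    by have := mulr_gt0 l32 Xy; lra.
  - by rewrite XYs subrr.
  - by lra.
have V1 z : s < z < L -> 0 < Y1 z - X1 z.
  move=> /andP[sz zL]; apply: le_lt_trans (_ : Y1 s - X1 s < _); first by lra.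
  apply: (deriv_on_lt dV1 _ (lexx _) sz (ltW zL)) => y /andP[sy yL].
  have ysL : s <= y <= L by rewrite (ltW sy) (ltW yL).
  have := mulr_gt0 l32 (Xp _ ysL); have := mulr_ge0 (ltW l30) (V0 _ ysL); lra.
have := deriv_on_lt dV V1 (lexx _) sL' (lexx _).
by rewrite XYs XYL !subrr ltxx.
Qed.

End Comparison.

(** * The case of positive initial data and the uniqueness theorem *)

Section Spectral.
Context {R : realType}.

(** The modal combinations [M - l W + K Q] decouple the system. With [- t], [l2], [l3] the roots of
    the cubic, two of them are hyperbolic and one oscillates, and [W(L) = Q(L) = 0] makes all three
    equal [M L] at the end. *)
Lemma eigen_ode_spectral (L c th k : R) M M1 W W1 Q Q1 :
  eigen_ode L c th k M M1 W W1 Q Q1 -> 0 < Q 0 -> 0 < W 0 -> 0 < M1 0 ->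
  (2 / L ^+ 2) ^+ 2 * (2 / L ^+ 2 + th) <= k * (c + 2 / L ^+ 2) -> False.
Proof.
move=> [L0 c0 cth k0 dM dM1 dW dW1 dQ dQ1 M0 W10 Q10 M1L WL QL] Q0 W0 mu0.
have [l2 [l3 [t [/andP[l20 l23] /andP[l2t tl3] the ke kce]]]] := cubic_roots c0 cth k0.
have L20 : 0 < L ^+ 2 by exact: exprn_gt0.
set x := 2 / L ^+ 2; have x0 : 0 < x by rewrite divr_gt0.
have l30 : 0 < l3 by lra.
have t0 : 0 < t by lra.
(* The difference of the two sides of the Poincare hypothesis is the characteristic polynomial at
   [- x], which factors through its roots; so the hypothesis says exactly [x <= t]. *)
rewrite -subr_ge0 (_ : _ - _ = (x + l2) * (x + l3) * (t - x)); last first.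
  rewrite mulrDr kce the {1}ke; ring.
rewrite pmulr_rge0 ?mulr_gt0 ?addr_gt0// subr_ge0 => xt.
have tL : 2 <= t * L ^+ 2 by rewrite -ler_pdivrMr.

(* Eliminating [K] from the two side conditions leaves the cubic equation for [l]; [K] is the
   product of the other two roots with the sign changed. *)
have comb l K : l * l = l * th + k - K -> l * K = k * c ->
    deriv_on 0 L (fun s => M s - l * W s + K * Q s) (fun s => M1 s - l * W1 s + K * Q1 s) /\
    deriv_on 0 L (fun s => M1 s - l * W1 s + K * Q1 s)
      (fun s => l * (M s - l * W s + K * Q s)).
  move=> h1 h2; split; first exact: deriv_onD (deriv_onB dM (deriv_onZ l dW)) (deriv_onZ K dQ).
  apply: deriv_on_eq (deriv_onD (deriv_onB dM1 (deriv_onZ l dW1)) (deriv_onZ K dQ1)) _ _ => // s _.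
  transitivity (l * M s + (K - k - l * th) * W s + k * c * Q s); first by ring.
  have -> : K - k - l * th = - (l * l) by lra.
  by rewrite -h2; ring.
have [||dX dX1] := comb l2 (t * l3); [rewrite ke the; ring|rewrite kce; ring|].
have [||dY dY1] := comb l3 (t * l2); [rewrite ke the; ring|rewrite kce; ring|].
have [||dT dT1] := comb (- t) (- (l2 * l3)); [rewrite ke the; ring|rewrite kce; ring|].
set mu := M1 0 in mu0; set nu := M L.
have tl3' : 0 <= l3 - t by lra.
have l2t' : 0 <= t - l2 by lra.
have ltW2 := mulr_gt0 l20 W0; have lQ2 := mulr_gt0 l20 Q0; have lQ3 := mulr_gt0 l30 Q0.
have nuL : mu * L < nu.
  have := hyperbolic_pair L0 _ dX dX1 dY dY1; rewrite l20 l23 /=.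
  rewrite W10 Q10 WL QL M0 !mulr0 !subr0 !addr0 !sub0r => /(_ erefl mu0 erefl erefl).
  apply.
  - rewrite -subr_gt0 (_ : _ - _ = (l3 - l2) * (W 0 + t * Q 0)); last by ring.
    by rewrite mulr_gt0 ?subr_gt0 // addr_gt0 // mulr_gt0.
  - rewrite -subr_gt0 (_ : _ - _ = (l3 - l2) * (l2 + l3) * (t * Q 0)); last by ring.
    by rewrite !mulr_gt0 ?subr_gt0 // addr_gt0.
set D := t * W 0 - l2 * l3 * Q 0.
(* [T'^2 + t T^2] is constant for the oscillating combination [T'' = - t T]; at [s = L] the square
   of the slope is dropped. *)
have energy : t * (nu * nu) <= mu * mu + t * (D * D).
  have dE := deriv_onD (deriv_onM dT1 dT1) (deriv_onZ t (deriv_onM dT dT)).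
  have b0 : 0 <= (0 : R) <= L by rewrite lexx ltW.
  have bL : 0 <= L <= L by rewrite lexx ltW.
  have := deriv_on_const dE (ltac:(move=> z _ /=; ring)) b0 bL.
  rewrite W10 Q10 WL QL M0 M1L !mulr0 !subr0 !addr0 !sub0r -/nu -/mu => e.
  have := sqr_ge0 (- (- t * W1 L) + - (l2 * l3) * Q1 L); rewrite expr2.
  rewrite /D; move: e; set z := - (- t * W1 L) + _ => e zz.
  have -> : mu * mu + t * ((t * W 0 - l2 * l3 * Q 0) * (t * W 0 - l2 * l3 * Q 0)) =
    mu * mu + t * ((- (- t * W 0) + - (l2 * l3) * Q 0) * (- (- t * W 0) + - (l2 * l3) * Q 0)).
    by ring.
  by rewrite e; lra.
have mL : 0 < mu * L by rewrite mulr_gt0.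
have tLL : t * (mu * L * (mu * L)) = t * L ^+ 2 * (mu * mu) by ring.
have mm : 0 < mu * mu by rewrite mulr_gt0.
have tLmm : 2 * (mu * mu) <= t * (mu * L * (mu * L)) by rewrite tLL ler_pM2r.
have [D0|D0] := ltP D 0.
  (* For [D < 0] the hyperbolic combination with root [l2] starts above [- D], hence is nonnegative
     and convex, and ends at [nu >= - D + mu L]. The energy bound then gives [t L^2 < 1]. *)
  have X0 : - D <= l3 * t * Q 0 - l2 * W 0.
    rewrite -subr_ge0 (_ : _ - _ = (t - l2) * (W 0 + l3 * Q 0)); last by rewrite /D; ring.
    by rewrite mulr_ge0 // addr_ge0 // ltW.
  have Xge z : 0 <= z <= L -> 0 <= M z - l2 * W z + t * l3 * Q z.
    apply: (hyperbolic_ge0 (ltW l20) dX dX1) => //.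
      by rewrite M0 sub0r; lra.
    by rewrite W10 Q10 !mulr0 subr0 addr0 ltW.
  have [z /andP[z0 zL]||_] := deriv_on_convex_ge (x := L) dX dX1.
  - by rewrite mulr_ge0 ?(ltW l20)// Xge // !ltW.
  - by rewrite lexx ltW.
  rewrite W10 Q10 WL QL M0 !mulr0 !subr0 !addr0 !sub0r -/nu -/mu => h.
  have Dnu : - D <= nu - mu * L by lra.
  have : D * D <= (nu - mu * L) * (nu - mu * L).
    by rewrite -mulrNN ler_pM // oppr_ge0 ltW.
  move=> /(ler_wpM2l (ltW t0)).
  have := mulr_gt0 t0 (mulr_gt0 mL mL).
  have : 0 < t * (mu * L * (nu - mu * L)) by rewrite !mulr_gt0 // subr_gt0.
  by lra.
(* For [D >= 0] the combination with root [l3] starts below [- D]; the bound on its starting value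
   gives [D <= mu L / 2]. With [nu > mu L] the energy bound becomes [3/4 t L^2 < 1]. *)
have DY : D <= l3 * W 0 - t * l2 * Q 0.
  rewrite -subr_ge0 (_ : _ - _ = (l3 - t) * (W 0 + l2 * Q 0)); last by rewrite /D; ring.
  by rewrite mulr_ge0 // addr_ge0 // ltW.
have := hyperbolic_start_bound L0 (ltW l30) dY dY1.
rewrite W10 Q10 WL QL M0 !mulr0 !subr0 !addr0 !sub0r -/nu -/mu => /(_ mu0 nuL) h.
have {}DY : D <= mu * L / 2 by lra.
have : D * D <= (mu * L / 2) * (mu * L / 2) by rewrite ler_pM.
move=> /(ler_wpM2l (ltW t0)).
have : mu * L * (mu * L) < nu * nu by rewrite ltr_pM // ltW.
rewrite -(ltr_pM2l t0).
by lra.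
Qed.

(* The end condition W(0) = K Q(0) with K >= c is the vanishing of the feedback functional. *)
Theorem eigen_ode_unique (L c th k K : R) M M1 W W1 Q Q1 :
  eigen_ode L c th k M M1 W W1 Q Q1 -> c < K -> W 0 = K * Q 0 ->
  (2 / L ^+ 2) ^+ 2 * (2 / L ^+ 2 + th) <= k * (c + 2 / L ^+ 2) ->
  forall s, 0 <= s <= L -> M1 s = 0.
Proof.
move=> sol cK WK hP.
have c0 := ode_c0 sol.
wlog Q0 : M M1 W W1 Q Q1 sol WK / 0 <= Q 0.
  move=> hw; have [|Q0 s sL] := leP 0 (Q 0); first exact: hw sol WK.
  apply/eqP; rewrite -oppr_eq0; apply/eqP.
  by apply: (hw _ _ _ _ _ _ (eigen_odeN sol)) => //; [rewrite WK; ring|rewrite oppr_ge0 ltW].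
have KQ : 0 <= W 0 by rewrite WK mulr_ge0 //; lra.
have cKQ : c * Q 0 <= W 0 by rewrite WK ler_wpM2r // ltW.
have [M1n|M1p|M1z] := ltgtP (M1 0) 0.
- by have [] := eigen_ode_cone_contra sol KQ cKQ (ltW M1n) (or_introl M1n).
(* A positive [M'(0)] is outside the cone, unless [Q(0) = W(0) = 0]: then the negated solution lies
   in it. *)
- have [Q00|Q00] := eqVneq (Q 0) 0.
    have [] := eigen_ode_cone_contra (eigen_odeN sol).
    + by rewrite WK Q00 mulr0 oppr0.
    + by rewrite WK Q00 !oppr0 !mulr0 oppr0.
    + by rewrite oppr_le0 ltW.
    + by left; rewrite oppr_lt0.
  have Qp : 0 < Q 0 by rewrite lt_neqAle eq_sym Q00.
  have Wp : 0 < W 0 by rewrite WK mulr_gt0 //; lra.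
  by have [] := eigen_ode_spectral sol Qp Wp M1p hP.
- have [Q00|Q00] := eqVneq (Q 0) 0.
    by apply: (eigen_ode_zero sol M1z) => //; rewrite WK Q00 mulr0.
  have Qp : 0 < Q 0 by rewrite lt_neqAle eq_sym Q00.
  have [] := eigen_ode_cone_contra sol KQ cKQ; first by rewrite M1z.
  by right; rewrite WK ltr_pM2r.
Qed.
End Spectral.

(** * Primitives *)

Notation leb R := (@lebesgue_measure R).
Notation ae_filterS := (@filterS _ _ (ae_filter_ringOfSetsType (leb _))).
Notation ae_filterI := (@filterI _ _ (ae_filter_ringOfSetsType (leb _)) _ _).

Definition prim {R : realType} (f : R -> R) (x : R) : R :=
  \int[leb R]_(t in `]0, x[) f t.

Definition intble {R : realType} (L : R) (f : R -> R) : Prop :=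
  (leb R).-integrable `]0, L[ (EFin \o f).

Section Primitive.
Context {R : realType}.
Implicit Types (L x y k : R) (f g : R -> R).

Lemma intble_sub L x f : x <= L -> intble L f -> intble x f.
Proof. by move=> xL; apply: integrableS => //; apply: subset_itvl; rewrite bnd_simp. Qed.

Lemma within_continuous_intble L f : {within `[0, L], continuous f} -> intble L f.
Proof.
move=> cf; apply: (@integrableS _ _ _ (leb R) `[0, L]) => //.
  exact: subset_itv_oo_cc.
by apply: continuous_compact_integrable => //; exact: segment_compact.
Qed.

Lemma intbleD L f g : intble L f -> intble L g -> intble L (fun x => f x + g x).
Proof. by move=> fi gi; exact: (@integrableD _ _ _ _ _ _ _ _ fi gi). Qed.

Lemma intbleZ L k f : intble L f -> intble L (fun x => k * f x).
Proof. by move=> fi; exact: (@integrableZl _ _ _ _ _ _ k _ fi). Qed.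

Lemma primD L f g : intble L f -> intble L g ->
  prim (fun x => f x + g x) L = prim f L + prim g L.
Proof. by move=> fi gi; rewrite /prim RintegralD. Qed.

Lemma primZ L k f : intble L f -> prim (fun x => k * f x) L = k * prim f L.
Proof. by move=> fi; rewrite /prim RintegralZl. Qed.

Lemma prim0 f : prim f 0 = 0.
Proof. by rewrite /prim set_itv_ge ?bnd_simp// Rintegral_set0. Qed.

Lemma prim_ge0 L f : (forall x, 0 < x < L -> 0 <= f x) -> 0 <= prim f L.
Proof. by move=> f0; apply: Rintegral_ge0 => x /=; rewrite in_itv; exact: f0. Qed.

Lemma prim_le L f g : intble L f -> intble L g ->
  (forall x, 0 < x < L -> f x <= g x) -> prim f L <= prim g L.
Proof. by move=> fi gi fg; apply: le_Rintegral => //= x; rewrite in_itv; exact: fg. Qed.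

Lemma eq_prim L f g : (forall x, 0 < x < L -> f x = g x) -> prim f L = prim g L.
Proof. by move=> fg; apply: eq_Rintegral => x; rewrite inE /= in_itv; exact: fg. Qed.

Lemma prim_cst L k : 0 <= L -> prim (fun=> k) L = k * L.
Proof.
move=> L0; rewrite /prim Rintegral_cst //= lebesgue_measure_itv/= lte_fin.
by case: ltgtP L0 => // [L0 _|<-]; rewrite ?oppr0 ?addr0 /= ?subr0.
Qed.

Lemma prim_continuous L f : intble L f -> {within `[0, L], continuous (prim f)}.
Proof.
move=> fi; have [L0|L0] := ltP L 0.
  by rewrite set_itv_ge ?bnd_simp -?ltNge//; exact: continuous_subspace0.
pose g := f \_ `]0, L[.
have gi : (leb R).-integrable `[0, L] (EFin \o g).
  have : (leb R).-integrable setT (EFin \o g).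
    by rewrite -restrict_EFin; apply/integrable_restrict => //; rewrite setTI.
  by apply: integrableS.
have e x : x \in `[0, L] -> \int[leb R]_(t in `[0, x]) g t = prim f x.
  rewrite in_itv/= => /andP[x0 xL].
  rewrite -Rintegral_itv_bndo_bndc; last first.
    by apply: integrableS gi => //; apply: subset_itvl; rewrite bnd_simp.
  rewrite -Rintegral_itv_obnd_cbnd; last first.
    apply: integrableS gi => // t /=; rewrite !in_itv/= => /andP[t0 tx].
    by rewrite !ltW// (lt_le_trans tx).
  apply: eq_Rintegral => t; rewrite inE/= in_itv/= => /andP[t0 tx].
  by rewrite /g patchE mem_set//= in_itv/= t0 (lt_le_trans tx).
have := parameterized_integral_continuous L0 gi.
apply: subspace_eq_continuous => x; rewrite inE => xL.
exact: e.
Qed.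

Lemma prim_deriv_on L f : {within `[0, L], continuous f} -> deriv_on 0 L (prim f) f.
Proof.
move=> cf; have fi := within_continuous_intble cf.
split; first exact: prim_continuous.
move=> x /andP[x0 xL].
pose y := (x + L) / 2.
have xy : x < y by rewrite /y; lra.
have yL : y < L by rewrite /y; lra.
have fx : {for x, continuous f}.
  have [L0|L0] := ltP L 0; first by lra.
  move: cf; rewrite le_eqVlt in L0; case/predU1P : L0 => [L0|L0]; first by lra.
  move=> /(continuous_within_itvP _ L0)[cf _ _]; apply: cf.
  by rewrite in_itv/= x0.
have fi' : (leb R).-integrable `]0, y] (EFin \o f).
  apply: integrableS fi => // t /=; rewrite !in_itv/= => /andP[-> /= ty].
  exact: le_lt_trans yL.
have x0' : (BRight (0 : R)%R < BRight x)%O by rewrite bnd_simp.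
have [d1 d2] := continuous_FTC1 xy fi' x0' fx.
have {}d1 : is_derive x 1 (fun z => \int[leb R]_(t in `]0, z]) f t) (f x).
  by rewrite -d2; rewrite derive1E; exact: derivableP.
apply: near_eq_is_derive d1.
near=> z.
rewrite /prim Rintegral_itv_bndo_bndc//.
apply: integrableS fi => //; apply: subset_itvl; rewrite bnd_simp ltW//.
by near: z; exact: lt_nbhsl.
Unshelve. all: by end_near. Qed.

End Primitive.

(** * Strong stability of contraction semigroups *)

Lemma inv_succ_small {R : realType} (e : R) : 0 < e ->
  exists N : nat, forall n, (N <= n)%N -> (n.+1%:R)^-1 < e.
Proof.
move=> e0; exists (Num.truncn e^-1) => n Nn.
rewrite -[e]invrK ltf_pV2 ?posrE ?invr_gt0 // (lt_le_trans (truncnS_gt _)) //.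
by rewrite ler_nat.
Qed.

(** Semidefinite only: states are functions, and functions that agree almost everywhere are at
    distance 0. Equality of vectors therefore appears as [nrm (u - v) = 0] and is exploited by
    pairing with a test vector. *)
Record semiInner (R : realType) (H : lmodType R) := SemiInner {
  ip :> H -> H -> R;
  ipC : forall u v, ip u v = ip v u;
  ipDl : forall u v w, ip (u + v) w = ip u w + ip v w;
  ipZl : forall (r : R) u w, ip (r *: u) w = r * ip u w;
  ip_ge0 : forall u, 0 <= ip u u }.

Section SemiInnerTheory.
Context {R : realType} {H : lmodType R} (B : semiInner H).
Implicit Types (u v w x y : H) (r e : R).

Definition nrm u : R := Num.sqrt (B u u).

Lemma ipDr u v w : B u (v + w) = B u v + B u w.
Proof. by rewrite ipC ipDl !(ipC _ _ u). Qed.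

Lemma ipZr r u w : B u (r *: w) = r * B u w.
Proof. by rewrite ipC ipZl ipC. Qed.

Lemma ipNl u w : B (- u) w = - B u w.
Proof. by rewrite -scaleN1r ipZl mulN1r. Qed.

Lemma ipNr u w : B u (- w) = - B u w.
Proof. by rewrite -scaleN1r ipZr mulN1r. Qed.

Definition ipE := (ipDl, ipDr, ipNl, ipNr, ipZl, ipZr).

Lemma nrm_ge0 u : 0 <= nrm u.
Proof. exact: sqrtr_ge0. Qed.

Lemma nrm2 u : nrm u ^+ 2 = B u u.
Proof. by rewrite sqr_sqrtr // ip_ge0. Qed.

Lemma nrmM u : nrm u * nrm u = B u u.
Proof. by rewrite -expr2 nrm2. Qed.

(** Evaluate at the minimiser [- b / c]; if [c = 0] and [b <> 0], at the point where the affine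
    expression equals [- 1]. It serves wherever a nonnegative quadratic form has to control its
    polar form. *)
Lemma quadratic_discriminant (a b c : R) : 0 <= a -> 0 <= c ->
  (forall e, 0 <= a + 2 * e * b + e ^+ 2 * c) -> b ^+ 2 <= a * c.
Proof.
move=> a0; rewrite le_eqVlt => /predU1P[<- h|c0 h].
  have [->|b0] := eqVneq b 0; first by rewrite mulr0 expr0n.
  have := h (- (a + 1) / (2 * b)); rewrite mulr0 addr0.
  suff -> : a + 2 * (- (a + 1) / (2 * b)) * b = - 1 by rewrite oppr_ge0 ler10.
  by field.
have := h (- b / c).
have -> : a + 2 * (- b / c) * b + (- b / c) ^+ 2 * c = (a * c - b ^+ 2) / c.
  by field; rewrite gt_eqF.
by rewrite pmulr_lge0 ?invr_gt0 // subr_ge0.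
Qed.

Lemma cauchy_schwarz u v : `|B u v| <= nrm u * nrm v.
Proof.
rewrite -(@ler_pXn2r _ 2) ?nnegrE ?mulr_ge0 ?nrm_ge0//.
rewrite exprMn !nrm2 real_normK ?num_real//.
apply: quadratic_discriminant; rewrite ?ip_ge0// => e.
by have := ip_ge0 B (u + e *: v); rewrite !ipE (ipC _ v u); lra.
Qed.

Lemma ip_le u v : B u v <= nrm u * nrm v.
Proof. exact: le_trans (ler_norm _) (cauchy_schwarz u v). Qed.

Lemma nrmD u v : nrm (u + v) <= nrm u + nrm v.
Proof.
rewrite -(@ler_pXn2r _ 2) ?nnegrE ?addr_ge0 ?nrm_ge0//.
rewrite sqrrD !nrm2 !ipE (ipC _ v u).
by have := ip_le u v; lra.
Qed.

Lemma nrmN u : nrm (- u) = nrm u.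
Proof. by rewrite /nrm !ipE opprK. Qed.

Lemma nrmBC u v : nrm (u - v) = nrm (v - u).
Proof. by rewrite -nrmN opprB. Qed.

Lemma nrmZ r u : nrm (r *: u) = `|r| * nrm u.
Proof. by rewrite /nrm !ipE mulrA -expr2 sqrtrM ?sqr_ge0// sqrtr_sqr. Qed.

Lemma nrm_dist u v w : nrm (u - w) <= nrm (u - v) + nrm (v - w).
Proof. by apply: le_trans (nrmD _ _); rewrite addrA subrK. Qed.

Lemma nrm_distn u v : `|nrm u - nrm v| <= nrm (u - v).
Proof.
have h x y : nrm x - nrm y <= nrm (x - y).
  by rewrite lerBlDr; apply: le_trans (nrmD _ _); rewrite subrK.
by rewrite ler_norml h andbT lerNl opprB nrmBC h.
Qed.

Lemma nrm_null u v : nrm (u - v) = 0 -> nrm u = nrm v.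
Proof.
by have := nrm_distn u v => /[swap] ->; rewrite normr_le0 subr_eq0 => /eqP.
Qed.

Lemma ip_null u v w : nrm (u - v) = 0 -> B u w = B v w.
Proof.
have := cauchy_schwarz (u - v) w => /[swap] ->.
by rewrite mul0r normr_le0 !ipE subr_eq0 => /eqP.
Qed.

Definition hcauchy (u : nat -> H) := forall e, 0 < e ->
  exists N : nat, forall m n, (N <= m)%N -> (N <= n)%N -> nrm (u m - u n) < e.

Definition hcvg (u : nat -> H) l := forall e, 0 < e ->
  exists N : nat, forall n, (N <= n)%N -> nrm (u n - l) < e.

Definition hcomplete := forall u : nat -> H, hcauchy u -> exists l, hcvg u l.

Lemma hcvg_ip (u : nat -> H) l x : hcvg u l -> forall e, 0 < e ->
  exists N : nat, forall n, (N <= n)%N -> `|B (u n) x - B l x| < e.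
Proof.
move=> ul e e0; have x0 : 0 < nrm x + 1 by rewrite ltr_wpDl ?nrm_ge0.
have [N hN] := ul (e / (nrm x + 1)) (divr_gt0 e0 x0).
exists N => n /hN h; rewrite -ipNl -ipDl.
apply: le_lt_trans (cauchy_schwarz _ _) _.
apply: le_lt_trans (_ : nrm (u n - l) * (nrm x + 1) < _).
  by rewrite ler_wpM2l ?nrm_ge0 // lerDl.
by rewrite -ltr_pdivlMr.
Qed.

Lemma hcvg_nrm (u : nat -> H) l : hcvg u l -> forall e, 0 < e ->
  exists N : nat, forall n, (N <= n)%N -> `|nrm (u n) - nrm l| < e.
Proof.
move=> ul e /ul[N hN]; exists N => n /hN; apply: le_lt_trans.
exact: nrm_distn.
Qed.

(* Minimise [B v v - 2 F v] along a minimising sequence. *)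
Lemma riesz (F : H -> R) (C : R) : hcomplete -> 
  (forall u v, F (u + v) = F u + F v) -> (forall r u, F (r *: u) = r * F u) ->
  (forall u, F u <= C * nrm u) -> exists w, forall u, F u = B w u.
Proof.
move=> cpl FD FZ FC.
pose J u := B u u - 2 * F u.
pose S := range J.
have Jlb u : - C ^+ 2 <= J u.
  rewrite /J -nrm2; have := FC u; have := sqr_ge0 (nrm u - C); rewrite sqrrB.
  by lra.
have hS : has_inf S by split; [exists (J 0), 0|exists (- C ^+ 2) => _ [u _ <-]].
set m := inf S.
have Jm u : m <= J u by apply: ge_inf; [case: hS|exists u].
have /choice[v hv] n : exists v, J v < m + (n.+1%:R)^-1.
  have n0 : 0 < (n.+1%:R)^-1 :> R by rewrite invr_gt0.
  by have [_ [v _ <-] h] := inf_adherent n0 hS; exists v.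
clearbody m.
have cv : hcauchy v.
  move=> e e0; have e4 : 0 < e ^+ 2 / 4 by rewrite divr_gt0 ?exprn_gt0.
  have [N hN] := inv_succ_small e4; exists N => i j /hN hi /hN hj.
  rewrite -(@ltr_pXn2r _ 2) ?nnegrE ?nrm_ge0 ?(ltW e0)// nrm2.
  (* Parallelogram law: the value of [J] at the midpoint is the mean of the two values minus a
     quarter of the squared distance, and it is at least [m]. *)
  have := Jm ((2^-1 : R) *: (v i + v j)); have := hv i; have := hv j.
  rewrite /J !FZ !FD !ipE (ipC _ (v j) (v i)) => h1 h2 h3.
  move: h1 h2 h3 hi hj; move: (F (v i)) (F (v j)) (B (v i) (v i)) (B (v i) (v j)) (B (v j) (v j)).
  by move: (_.+1%:R^-1) (_.+1%:R^-1) (e ^+ 2) => a b e' *; lra.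
have [w vw] := cpl _ cv.
exists w => u; apply/eqP; rewrite -subr_eq0 -normr_eq0 eq_le normr_ge0 andbT.
apply/ler_addgt0Pl => e; rewrite addr0 => e0.
have e2 : 0 < e / 2 by lra.
have [N1 hN1] := hcvg_ip u vw e2.
have u0 : 0 < B u u + 1 by rewrite ltr_wpDl ?ip_ge0.
have [N2 hN2] := inv_succ_small (divr_gt0 (exprn_gt0 2 e2) u0).
pose n := maxn N1 N2.
have h1 := hN1 n (leq_maxl _ _); have h2 := hN2 n (leq_maxr _ _).
(* First variation with quantified error: [v n] is only almost minimal, so the derivative of [J] in
   the direction [u] is small instead of zero. *)
have h3 : (B (v n) u - F u) ^+ 2 <= (n.+1%:R)^-1 * B u u.
  apply: quadratic_discriminant; rewrite ?ip_ge0 ?invr_ge0// => r.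
  have := Jm (v n + r *: u); have := hv n.
  rewrite /J FD FZ !ipE (ipC _ u (v n)).
  by move: (B _ _) (B _ _) (B _ _) (F _) (F _) (_^-1) => *; lra.
have h4 : `|B (v n) u - F u| <= e / 2.
  rewrite -(@ler_pXn2r _ 2) ?nnegrE ?normr_ge0 ?(ltW e2)// real_normK ?num_real//.
  apply: le_trans h3 _; move: h2; rewrite ltr_pdivlMr // mulrDr mulr1 => h2.
  by apply/ltW; apply: le_lt_trans h2; rewrite lerDl.
move: h1 h4; rewrite ltr_norml !ler_norml => /andP[a1 a2] /andP[b1 b2].
by apply/andP; split; lra.
Qed.

End SemiInnerTheory.

Lemma is_derive_quotient (R : realType) (f : R -> R) (x l : R) :
  (forall e : R, 0 < e -> exists2 d : R, 0 < d & forall h : R, h != 0 -> `|h| < d ->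
     `|h^-1 * (f (x + h) - f x) - l| < e) -> is_derive x 1 f l.
Proof.
move=> hf.
have cv : h^-1 *: (f (h *: (1 : R) + x) - f x) @[h --> 0^'] --> l.
  apply/cvgrPdist_lt => e /hf[d d0 hd].
  apply/nbhs_ballP; exists d => //= h bh h0; move: bh; rewrite -ball_normE /= sub0r normrN => hd1.
  rewrite distrC (_ : h *: 1 + x = x + h); first exact: hd.
  by rewrite addrC /GRing.scale /= mulr1.
apply: DeriveDef; first by apply/cvg_ex; exists l.
exact: cvg_lim.
Qed.

Lemma deriv_on_shift (R : realType) (h r : R) (f f' : R -> R) : 0 <= r ->
  deriv_on 0 (h + r) f f' -> deriv_on 0 h (fun x => f (x + r)) (fun x => f' (x + r)).
Proof.
move=> r0 [/within_continuous_itvP cf df]; split=> [|x /andP[x0 xh]].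
  apply/within_continuous_itvP => x /andP[x0 xh] e e0.
  have [|d d0 dP] := cf (x + r) _ e e0; first by rewrite addr_ge0 // lerD2r.
  exists d => // y /andP[y0 yh] xy; apply: dP; first by rewrite addr_ge0 // lerD2r.
  by rewrite (_ : x + r - (y + r) = x - y) //; ring.
have d1 : is_derive x 1 (fun y => y + r) 1.
  by apply: is_derive_eq (is_deriveD (is_derive_id x 1) (is_derive_cst r x 1)) _; rewrite addr0.
have d2 : is_derive (x + r) 1 f (f' (x + r)) by apply: df; rewrite ltrD2r xh ltr_wpDr.
exact: (is_derive_eq (@is_derive1_comp _ f (fun y => y + r) x _ _ d2 d1) (mulr1 _)).
Qed.

(** * Generators and isometric vectors of a contraction semigroup *)

Section Semigroup.
Context {R : realType} {H : lmodType R} (B : semiInner H) (T : R -> H -> H).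
Implicit Types (u v w x p q : H) (s t e h r a b : R).
Local Notation nrm := (nrm B).

(** The semigroup laws hold up to null vectors, so [T t] is linear and multiplicative only after
    pairing with a test vector. *)
Record contractive := Contractive {
  csgD : forall t u v, 0 <= t -> nrm (T t (u + v) - (T t u + T t v)) = 0;
  csgZ : forall t r u, 0 <= t -> nrm (T t (r *: u) - r *: T t u) = 0;
  csg_le : forall t u, 0 <= t -> nrm (T t u) <= nrm u;
  csg0 : forall u, nrm (T 0 u - u) = 0;
  csgA : forall s t u, 0 <= s -> 0 <= t -> nrm (T (s + t) u - T s (T t u)) = 0;
  csg_cont : forall u e, 0 < e ->
    exists2 d : R, 0 < d & forall t, 0 <= t < d -> nrm (T t u - u) < e }.

Hypothesis hT : contractive.

Definition gen u v := forall e, 0 < e ->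
  exists2 d : R, 0 < d & forall t, 0 < t < d -> nrm (t^-1 *: (T t u - u) - v) < e.

Lemma ipTD t u v x : 0 <= t -> B (T t (u + v)) x = B (T t u) x + B (T t v) x.
Proof. by move=> t0; rewrite (ip_null x (csgD hT u v t0)) ipDl. Qed.

Lemma ipTZ t r u x : 0 <= t -> B (T t (r *: u)) x = r * B (T t u) x.
Proof. by move=> t0; rewrite (ip_null x (csgZ hT r u t0)) ipZl. Qed.

Lemma ipTN t u x : 0 <= t -> B (T t (- u)) x = - B (T t u) x.
Proof. by move=> t0; rewrite -scaleN1r ipTZ // mulN1r. Qed.

Lemma ipTA s t u x : 0 <= s -> 0 <= t -> B (T (s + t) u) x = B (T s (T t u)) x.
Proof. by move=> s0 t0; rewrite (ip_null x (csgA hT u s0 t0)). Qed.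

Lemma ipT0 u x : B (T 0 u) x = B u x.
Proof. exact: (ip_null x (csg0 hT u)). Qed.

Lemma nrm_ipP u v : (forall x, B u x = B v x) -> nrm (u - v) = 0.
Proof.
by move=> uv; rewrite /nrm ipDl ipNl uv subrr sqrtr0.
Qed.

Lemma nrmT_sub t u v : 0 <= t -> nrm (T t u - T t v) <= nrm (u - v).
Proof.
move=> t0; apply: le_trans (csg_le hT (u - v) t0).
rewrite (@nrm_null _ _ B _ (T t (u - v))) //; apply: nrm_ipP => x.
by rewrite ipTD // ipTN // ipDl ipNl.
Qed.

Lemma nrmT_uniform s t u : 0 <= s -> 0 <= t -> nrm (T (s + t) u - T s u) <= nrm (T t u - u).
Proof.
move=> s0 t0; apply: le_trans (nrmT_sub _ _ s0).
rewrite (@nrm_null _ _ B _ (T s (T t u) - T s u)) //; apply: nrm_ipP => x.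
by rewrite !ipDl ipTA.
Qed.

Lemma nrmT_antitone s t u : 0 <= s -> s <= t -> nrm (T t u) <= nrm (T s u).
Proof.
move=> s0 st; have ts : 0 <= t - s by rewrite subr_ge0.
rewrite -{1}(subrK s t) (nrm_null (csgA hT u ts s0)).
exact: csg_le.
Qed.

Lemma nrmT_modulus u e : 0 < e -> exists2 d : R, 0 < d &
  forall s t, 0 <= s -> 0 <= t -> `|s - t| < d -> nrm (T s u - T t u) < e.
Proof.
move=> /(csg_cont hT u)[d d0 hd]; exists d => // s t s0 t0.
wlog st : s t s0 t0 / t <= s => [hw|].
  have [/hw|/ltW/hw] := leP t s; first exact.
  by rewrite distrC nrmBC; apply.
rewrite ger0_norm ?subr_ge0 // => std.
have st0 : 0 <= s - t by rewrite subr_ge0.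
have := le_lt_trans (nrmT_uniform u t0 st0) (hd (s - t) _).
by rewrite (addrC t) subrK; apply; rewrite st0.
Qed.

Lemma ipT_continuous u x b : {within `[0, b], continuous (fun s => B (T s u) x)}.
Proof.
apply/within_continuous_itvP => s /andP[s0 sb] e e0.
have x0 : 0 < nrm x + 1 by rewrite ltr_wpDl ?nrm_ge0.
have [d d0 hd] := nrmT_modulus u (divr_gt0 e0 x0).
exists d => // t /andP[t0 tb] /(hd _ _ s0 t0) h.
rewrite -ipNl -ipDl; apply: le_lt_trans (cauchy_schwarz _ _ _) _.
apply: le_lt_trans (_ : nrm (T s u - T t u) * (nrm x + 1) < _).
  by rewrite ler_wpM2l ?nrm_ge0 // lerDl.
by rewrite -ltr_pdivlMr.
Qed.

Hypothesis cpl : hcomplete B.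

(** The adjoint moves [T t] across an integral that is known only through its pairings. *)
Lemma semigroup_adjoint t v : 0 <= t -> exists w, forall x, B (T t x) v = B w x.
Proof.
move=> t0; apply: (@riesz _ _ B (fun x => B (T t x) v) (nrm v) cpl).
- by move=> x y; rewrite ipTD.
- by move=> r x; rewrite ipTZ.
- move=> x; apply: le_trans (ip_le _ _ _) _.
  by rewrite mulrC ler_wpM2l ?nrm_ge0// csg_le.
Qed.

(* [w] is the integral of [T s u] over [0, h], defined weakly. *)
Lemma semigroup_integral u h : 0 <= h ->
  exists w, forall x, B w x = prim (fun s => B (T s u) x) h.
Proof.
move=> h0.
have itb x : intble h (fun s => B (T s u) x).
  exact/within_continuous_intble/ipT_continuous.
have [|||w hw] := @riesz _ _ B (fun x => prim (fun s => B (T s u) x) h) (nrm u * h) cpl.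
- move=> x y; rewrite -primD //; apply: eq_prim => s _; exact: ipDr.
- move=> r x; rewrite -primZ //; apply: eq_prim => s _; exact: ipZr.
- move=> x; rewrite mulrAC -prim_cst //; apply: prim_le => //.
    by apply: within_continuous_intble; apply: cst_continuous.
  move=> s /andP[s0 _]; apply: le_trans (ip_le _ _ _) _.
  by rewrite ler_wpM2r ?nrm_ge0 // csg_le // ltW.
by exists w => x; rewrite hw.
Qed.

Local Notation orbit u x := (prim (fun s => B (T s u) x)).

Lemma orbit_deriv_on u x b : deriv_on 0 b (orbit u x) (fun s => B (T s u) x).
Proof. exact/prim_deriv_on/ipT_continuous. Qed.

Lemma orbit_shift u x r h : 0 <= r -> 0 <= h ->
  orbit (T r u) x h = orbit u x (h + r) - orbit u x r.
Proof.
move=> r0 h0.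
have d := deriv_onB (orbit_deriv_on (T r u) x h) (deriv_on_shift r0 (orbit_deriv_on u x (h + r))).
have z0 z : 0 < z < h -> B (T z (T r u)) x - B (T (z + r) u) x = 0.
  by move=> /andP[z0 _]; rewrite ipTA ?subrr // ltW.
have b0 : 0 <= (0 : R) <= h by rewrite lexx.
have bh : 0 <= h <= h by rewrite lexx h0.
have := deriv_on_const d z0 b0 bh; rewrite prim0 !add0r => e.
by lra.
Qed.

Lemma orbit_mean u x a t : 0 <= a -> 0 < t ->
  exists2 c, a < c < a + t & orbit u x (a + t) - orbit u x a = B (T c u) x * t.
Proof.
move=> a0 t0; have at' : a < a + t by rewrite ltrDl.
have [c ac e] := deriv_on_MVT (orbit_deriv_on u x (a + t)) a0 at' (lexx _).
by exists c => //; rewrite e addrC addKr.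
Qed.

Lemma nrm_le_ip y C : 0 <= C -> (forall x, B y x <= C * nrm x) -> nrm y <= C.
Proof.
move=> C0 /(_ y); rewrite -(nrmM B); have := nrm_ge0 B y.
by rewrite le_eqVlt => /predU1P[<-//|y0]; rewrite ler_pM2r.
Qed.

(** The difference quotient of the integral over [[0, h]] is the mean of the orbit over [[h, h + t]]
    minus its mean over [[0, t]]. The mean value theorem treats each test vector separately, but the
    error is uniform in [nrm x], so weak estimates give norm convergence. *)
Lemma gen_integral u h w : 0 < h -> (forall x, B w x = orbit u x h) -> gen w (T h u - u).
Proof.
move=> h0 hw e e0; have e4 : 0 < e / 4 by lra.
have [d d0 hd] := nrmT_modulus u e4.
exists d => // t /andP[t0 td].
apply: le_lt_trans (_ : e / 2 < _); last by lra.
apply: nrm_le_ip; first by lra.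
move=> x; have [x' hx'] := semigroup_adjoint x (ltW t0).
have -> : B (t^-1 *: (T t w - w) - (T h u - u)) x =
    t^-1 * (orbit u x (h + t) - orbit u x t - orbit u x h) - (B (T h u) x - B u x).
  rewrite !ipE hx' ipC hw (_ : orbit u x' h = orbit (T t u) x h); last first.
    apply: eq_prim => s /andP[s0 _]; rewrite -ipTA ?ltW // addrC ipTA ?ltW //.
    by rewrite hx' ipC.
  by rewrite (orbit_shift _ _ (ltW t0) (ltW h0)) hw; ring.
have [c1 /andP[hc1 c1t] e1] := orbit_mean u x (ltW h0) t0.
have [c2 /andP[c20 c2t] e2] := orbit_mean u x (lexx 0) t0.
rewrite prim0 add0r subr0 in e2; rewrite add0r in c2t.
have -> : t^-1 * (orbit u x (h + t) - orbit u x t - orbit u x h) - (B (T h u) x - B u x) =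
    B (T c1 u - T h u) x - B (T c2 u - T 0 u) x.
  rewrite !ipE ipT0 e2; have -> : orbit u x (h + t) = B (T c1 u) x * t + orbit u x h by lra.
  by field; rewrite gt_eqF.
have n1 : `|c1 - h| < d by rewrite gtr0_norm ?subr_gt0//; lra.
have n2 : `|c2 - 0| < d by rewrite subr0 gtr0_norm//; lra.
have := hd _ _ (ltW (lt_trans h0 hc1)) (ltW h0) n1.
have := hd _ _ (ltW c20) (lexx 0) n2.
move=> /ltW/(ler_wpM2r (nrm_ge0 B x)) m1 /ltW/(ler_wpM2r (nrm_ge0 B x)) m2.
have := cauchy_schwarz B (T c1 u - T h u) x; have := cauchy_schwarz B (T c2 u - T 0 u) x.
rewrite !ler_norml => /andP[k1 _] /andP[_ k2].
by lra.
Qed.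

Lemma gen_integral_dist u h w e : 0 < h -> 0 <= e -> (forall x, B w x = orbit u x h) ->
  (forall t, 0 <= t <= h -> nrm (T t u - u) <= e) -> nrm (h^-1 *: w - u) <= e.
Proof.
move=> h0 e0 hw he; apply: nrm_le_ip => // x.
have [c /andP[c0 ch]] := orbit_mean u x (lexx 0) h0.
rewrite add0r prim0 subr0 in ch * => e1.
have -> : B (h^-1 *: w - u) x = B (T c u - u) x.
  by rewrite !ipE hw e1; field; rewrite gt_eqF.
apply: le_trans (ip_le _ _ _) _; rewrite ler_wpM2r ?nrm_ge0 // he //.
by rewrite !ltW.
Qed.

Lemma genD u v p q : gen u p -> gen v q -> gen (u + v) (p + q).
Proof.
move=> hu hv e e0; have e2 : 0 < e / 2 by lra.
have [d1 d10 h1] := hu _ e2; have [d2 d20 h2] := hv _ e2.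
exists (Num.min d1 d2); first by rewrite lt_min d10.
move=> t /andP[t0]; rewrite lt_min => /andP[td1 td2].
have k1 := h1 t; rewrite t0 td1 in k1; have k2 := h2 t; rewrite t0 td2 in k2.
have := nrmD B (t^-1 *: (T t u - u) - p) (t^-1 *: (T t v - v) - q).
rewrite (@nrm_null _ _ B (t^-1 *: (T t (u + v) - (u + v)) - (p + q))
  (t^-1 *: (T t u - u) - p + (t^-1 *: (T t v - v) - q))); last first.
  by apply: nrm_ipP => x; rewrite !ipE ipTD ?ltW //; ring.
by have := k1 erefl; have := k2 erefl; lra.
Qed.

Lemma genZ r u p : gen u p -> gen (r *: u) (r *: p).
Proof.
move=> hu e e0; have r0 : 0 < `|r| + 1 by rewrite ltr_wpDl.
have [d d0 hd] := hu _ (divr_gt0 e0 r0).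
exists d => // t tdt; have /andP[t0 _] := tdt.
rewrite (@nrm_null _ _ B _ (r *: (t^-1 *: (T t u - u) - p))); last first.
  by apply: nrm_ipP => x; rewrite !ipE ipTZ ?ltW //; ring.
rewrite nrmZ; have := hd t tdt; rewrite ltr_pdivlMr // mulrDr mulr1.
by have := nrm_ge0 B (t^-1 *: (T t u - u) - p); lra.
Qed.

Lemma genT s u p : 0 <= s -> gen u p -> gen (T s u) (T s p).
Proof.
move=> s0 hu e /hu[d d0 hd]; exists d => // t tdt; have /andP[/ltW t0 _] := tdt.
apply: le_lt_trans (hd t tdt); apply: le_trans (csg_le hT _ s0).
rewrite le_eqVlt; apply/orP; left; apply/eqP; apply: nrm_null; apply: nrm_ipP => x.
by rewrite !(ipE, ipTD, ipTZ, ipTN) // -!ipTA // [s + t]addrC; ring.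
Qed.

(** The generator only provides the right difference quotient at time 0. For a negative increment
    [h], the quotient is transported by [T (s + h)] from a quotient with step [- h], and
    [T (s + h) p] is compared with [T s p]. *)
Lemma gen_is_derive u p x s : gen u p -> 0 < s ->
  is_derive s 1 (fun s => B (T s u) x) (B (T s p) x).
Proof.
move=> hu s0; apply: is_derive_quotient => e e0.
have x0 : 0 < nrm x + 1 by rewrite ltr_wpDl ?nrm_ge0.
have e2 : 0 < e / (nrm x + 1) / 2 by rewrite !divr_gt0.
have [d1 d10 h1] := hu _ e2.
have [d2 d20 h2] := nrmT_modulus p e2.
exists (Num.min s (Num.min d1 d2)); first by rewrite !lt_min s0 d10.
move=> h h0; rewrite !lt_min => /andP[hs /andP[hd1 hd2]].
suff [y ynrm ->] : exists2 y, nrm y < e / (nrm x + 1) &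
    h^-1 * (B (T (s + h) u) x - B (T s u) x) - B (T s p) x = B y x.
  apply: le_lt_trans (cauchy_schwarz _ _ _) _.
  apply: le_lt_trans (_ : nrm y * (nrm x + 1) < _).
    by rewrite ler_wpM2l ?nrm_ge0 // lerDl.
  by rewrite -ltr_pdivlMr.
have [hp|hn] := ltP 0 h.
  have hn : `|h| = h by rewrite gtr0_norm.
  exists (T s (h^-1 *: (T h u - u) - p)); last first.
    by rewrite !(ipE, ipTD, ipTZ, ipTN) ?ltW // -!ipTA ?ltW //; ring.
  apply: le_lt_trans (csg_le hT _ (ltW s0)) _.
  by apply: lt_trans (h1 h _) _; [rewrite hp -hn|move: e2; lra].
have {}hn : h < 0 by rewrite lt_neqAle h0.
have hN : `|h| = - h by rewrite ltr0_norm.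
have nh : 0 < - h by rewrite oppr_gt0.
have sh : 0 <= s + h by lra.
exists (T (s + h) ((- h)^-1 *: (T (- h) u - u) - p) + (T (s + h) p - T s p)); last first.
  rewrite !(ipE, ipTD, ipTZ, ipTN) // -(ipTA u x sh (ltW nh)) addrK invrN; ring.
apply: le_lt_trans (nrmD _ _ _) _.
have k1 : nrm (T (s + h) ((- h)^-1 *: (T (- h) u - u) - p)) < e / (nrm x + 1) / 2.
  by apply: le_lt_trans (csg_le hT _ sh) _; apply: h1; rewrite nh -hN.
have k2 : nrm (T (s + h) p - T s p) < e / (nrm x + 1) / 2.
  by apply: h2; rewrite ?(ltW s0)// addrAC subrr add0r.
by lra.
Qed.

Lemma gen_deriv_on u p x b : gen u p ->
  deriv_on 0 b (fun s => B (T s u) x) (fun s => B (T s p) x).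
Proof.
move=> hu; split; first exact: ipT_continuous.
by move=> s /andP[s0 _]; exact: gen_is_derive.
Qed.

(** Closedness of the generator: by the mean value theorem [T h (u n) - u n] is [h] times a value of
    the orbit of [p n], tested against [x], and this survives the limit in [n]. *)
Lemma gen_closed (u p : nat -> H) (l q : H) : (forall n, gen (u n) (p n)) ->
  hcvg B u l -> hcvg B p q -> gen l q.
Proof.
move=> hu ul pq e e0; have e2 : 0 < e / 2 by lra.
have [d d0 hd] := csg_cont hT q e2.
exists d => // h /andP[h0 hdd].
apply: le_lt_trans (_ : e / 2 < _); last by lra.
apply: nrm_le_ip; first by lra.
move=> x; apply/ler_addgt0Pr => z z0.
pose C := (1 + 2 / h) * (nrm x + 1); have nx := nrm_ge0 B x.
have h2 : 0 < 2 / h by rewrite divr_gt0.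
have C0 : 0 < C by rewrite /C mulr_gt0 //; lra.
(* The step [h] is fixed before [n], so the error [2 a / h] of replacing [u n] by [l] can be
   absorbed in [z]. *)
pose a := z / C; have a0 : 0 < a by rewrite divr_gt0.
have [N1 hN1] := ul _ a0; have [N2 hN2] := pq _ a0.
pose n := maxn N1 N2.
have un := ltW (hN1 n (leq_maxl _ _)); have pn := ltW (hN2 n (leq_maxr _ _)).
have [c /andP[c0 ch]] := deriv_on_MVT (deriv_onB (gen_deriv_on x h (hu n))
  (deriv_onZ (B q x) (deriv_on_id 0 h))) (lexx 0) h0 (lexx _).
rewrite mulr1 mulr0 !subr0 ipT0 => mvt.
have -> : B (h^-1 *: (T h l - l) - q) x =
    (B (T c (p n)) x - B q x) + h^-1 * (B (u n - l) x - B (T h (u n - l)) x).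
  have -> : B (T c (p n)) x - B q x = h^-1 * (B (T h (u n)) x - B q x * h - B (u n) x).
    by rewrite mvt; field; rewrite gt_eqF.
  by rewrite !(ipE, ipTD, ipTN) ?(ltW h0) //; field; rewrite gt_eqF.
have q1 : B (T c (p n)) x - B q x <= a * nrm x + e / 2 * nrm x.
  rewrite -ipNl -ipDl -mulrDl; apply: le_trans (ip_le _ _ _) _; rewrite ler_wpM2r //.
  apply: le_trans (nrm_dist _ _ (T c q) _) _; apply: lerD.
    exact: le_trans (nrmT_sub _ _ (ltW c0)) pn.
  by apply/ltW/hd; rewrite (ltW c0) (lt_trans ch).
have q2 : B (u n - l) x - B (T h (u n - l)) x <= 2 * (a * nrm x).
  have b1 : B (u n - l) x <= a * nrm x.
    by apply: le_trans (ip_le _ _ _) _; rewrite ler_wpM2r.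
  have b2 : - B (T h (u n - l)) x <= a * nrm x.
    rewrite -ipNl; apply: le_trans (ip_le _ _ _) _; rewrite ler_wpM2r // nrmN.
    exact: le_trans (csg_le hT _ (ltW h0)) un.
  by lra.
have {}q2 : h^-1 * (B (u n - l) x - B (T h (u n - l)) x) <= 2 / h * (a * nrm x).
  by rewrite [2 / h]mulrC -mulrA ler_wpM2l // invr_ge0 ltW.
apply: le_trans (lerD q1 q2) _.
have -> : a * nrm x + e / 2 * nrm x + 2 / h * (a * nrm x) =
  e / 2 * nrm x + a * ((1 + 2 / h) * nrm x) by ring.
rewrite lerD2l; have -> : z = a * C by rewrite /a divfK // gt_eqF.
by rewrite ler_wpM2l ?(ltW a0) // /C ler_wpM2l //; lra.
Qed.

Definition isometric u := forall s, 0 <= s -> nrm (T s u) = nrm u.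

(** The form [B x x - B (T s x) (T s x)] is nonnegative by contractivity and vanishes at [u], so its
    polar form with [u] vanishes as well. This turns isometry into a linear condition on [u], so
    that isometric vectors form a subspace. *)
Lemma isometric_ip u s x : isometric u -> 0 <= s -> B (T s u) (T s x) = B u x.
Proof.
move=> hu s0.
have h (y : H) : B (T s y) (T s y) <= B y y.
  by rewrite -!(nrm2 B) ler_pXn2r ?nnegrE ?nrm_ge0 // csg_le.
have e0 : B (T s u) (T s u) = B u u by rewrite -!(nrm2 B) hu.
apply/eqP; rewrite -subr_eq0 -sqrf_eq0; apply/eqP/le_anti; rewrite sqr_ge0 andbT.
rewrite -[leRHS](mul0r (B x x - B (T s x) (T s x))).
apply: quadratic_discriminant; rewrite ?subr_ge0 // => e.
have := h (u + (- e) *: x); rewrite !(ipE, ipTD, ipTZ) // ![B _ (T s (_ + _))]ipC.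
rewrite !(ipTD, ipTZ, ipE) // (ipC _ (T s x) (T s u)) (ipC _ x u) e0.
by lra.
Qed.

Lemma isometricP u : (forall s x, 0 <= s -> B (T s u) (T s x) = B u x) -> isometric u.
Proof. by move=> hu s s0; rewrite /nrm hu. Qed.

Lemma isometricD u v : isometric u -> isometric v -> isometric (u + v).
Proof.
move=> hu hv; apply: isometricP => s x s0.
by rewrite ipTD // !isometric_ip // ipDl.
Qed.

Lemma isometricZ r u : isometric u -> isometric (r *: u).
Proof.
move=> hu; apply: isometricP => s x s0.
by rewrite ipTZ // isometric_ip // ipZl.
Qed.

Lemma isometricT s u : 0 <= s -> isometric u -> isometric (T s u).
Proof.
move=> s0 hu r r0; rewrite -(nrm_null (csgA hT u r0 s0)).
by rewrite !hu // addr_ge0.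
Qed.

Lemma isometric_closed (u : nat -> H) l : (forall n, isometric (u n)) -> hcvg B u l ->
  isometric l.
Proof.
move=> hu ul s s0; apply/eqP; rewrite -subr_eq0 -normr_eq0 eq_le normr_ge0 andbT.
apply/ler_addgt0Pr => e e0; rewrite add0r.
have [|n /(_ n (leqnn n)) hn] := ul (e / 2); first by rewrite divr_gt0.
have h1 := nrm_distn B (T s (u n)) (T s l); have h2 := nrm_distn B (u n) l.
have h3 := nrmT_sub (u n) l s0.
rewrite (hu n s s0) in h1.
move: h1 h2; rewrite !ler_norml => /andP[a1 a2] /andP[b1 b2].
by apply/andP; split; lra.
Qed.

Lemma isometric_integral u h w : isometric u -> 0 <= h ->
  (forall x, B w x = orbit u x h) -> isometric w.
Proof.
move=> hu h0 hw; apply: isometricP => s x s0.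
have [y hy] := semigroup_adjoint (T s x) s0.
rewrite hy ipC hw hw; apply: eq_prim => r /andP[r0 _].
by rewrite ipC -hy isometric_ip //; apply: isometricT => //; exact: ltW.
Qed.

Lemma isometric_gen u p : gen u p -> isometric u -> isometric p.
Proof.
move=> hu iu; pose t (n : nat) : R := (n.+1%:R)^-1.
have t0 n : 0 < t n by rewrite invr_gt0.
apply: (@isometric_closed (fun n => (t n)^-1 *: (T (t n) u - u))) => [n|e /hu[d d0 hd]].
  apply: isometricZ; rewrite -scaleN1r; apply: isometricD; last exact: isometricZ.
  by apply: isometricT => //; exact: ltW.
have [N hN] := inv_succ_small d0; exists N => n /hN tn; apply: hd.
by rewrite t0 tn.
Qed.

(** If [y] is the difference quotient at step [t], then [nrm (T t u) = nrm u] expands to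
    [2 B y u + t B y y = 0]; let [t] tend to 0. *)
Lemma gen_isometric_ip0 u p : gen u p -> isometric u -> B p u = 0.
Proof.
move=> hu iu; apply/eqP; rewrite -normr_eq0 eq_le normr_ge0 andbT.
apply/ler_addgt0Pr => e e0; rewrite add0r.
pose C := 2 * nrm u + (nrm p + 1) ^+ 2 + 1.
have nu := nrm_ge0 B u; have np := nrm_ge0 B p.
have C0 : 0 < C by have := sqr_ge0 (nrm p + 1); rewrite /C; lra.
pose a := Num.min 1 (e / C).
have a0 : 0 < a by rewrite lt_min ltr01 divr_gt0.
have [d d0 hd] := hu _ a0.
pose t := Num.min (d / 2) a.
have t0 : 0 < t by rewrite lt_min a0 divr_gt0.
have td : t < d by rewrite gt_min; apply/orP; left; lra.
have := hd t; rewrite t0 td => /(_ erefl); set y := t^-1 *: _ => hy.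
have ny : nrm y <= nrm p + 1.
  have -> : y = (y - p) + p by rewrite subrK.
  apply: le_trans (nrmD _ _ _) _; rewrite addrC lerD2l.
  by apply/ltW/(lt_le_trans hy); rewrite /a ge_min lexx.
have key : 2 * B y u + t * B y y = 0.
  have : B (T t u) (T t u) = B u u by rewrite isometric_ip // ltW.
  have -> : B y y = t^-1 * t^-1 * (B (T t u) (T t u) - 2 * B (T t u) u + B u u).
    by rewrite /y !ipE (ipC _ u (T t u)); ring.
  rewrite /y !ipE => ->; field.
  by rewrite gt_eqF.
have k1 := cauchy_schwarz B (y - p) u; rewrite ipDl ipNl in k1.
have k2 : nrm (y - p) * nrm u <= a * nrm u by rewrite ler_wpM2r // ltW.
have k3 : t * B y y <= a * (nrm p + 1) ^+ 2.
  rewrite -(nrm2 B) ler_pM ?(ltW t0) ?sqr_ge0//.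
    by rewrite /t ge_min lexx orbT.
  by rewrite ler_pXn2r ?nnegrE ?nrm_ge0 // addr_ge0.
have k4 : 0 <= t * B y y by rewrite mulr_ge0 ?ip_ge0 ?ltW.
have k5 : a * C <= e by rewrite -ler_pdivlMr // /a ge_min lexx orbT.
have k6 : 0 <= a * (nrm p + 1) ^+ 2 by rewrite mulr_ge0 ?sqr_ge0 ?ltW.
have k7 : 0 <= a * nrm u := mulr_ge0 (ltW a0) nu.
rewrite /C in k5; move: k1; rewrite !ler_norml => /andP[m1 m2].
by apply/andP; split; lra.
Qed.

(** Polarisation of the preceding identity on the subspace of isometric vectors. *)
Lemma gen_isometric_skew u p v q : gen u p -> isometric u -> gen v q -> isometric v ->
  B p v + B u q = 0.
Proof.
move=> hu iu hv iv; have := gen_isometric_ip0 (genD hu hv) (isometricD iu iv).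
rewrite !ipE (gen_isometric_ip0 hu iu) (gen_isometric_ip0 hv iv) (ipC _ q u).
by lra.
Qed.

End Semigroup.

(** * From compactness to a mode of the generator *)

Section StrongStability.
Context {R : realType} {H : lmodType R} (B : semiInner H) (T : R -> H -> H).
Hypotheses (hT : contractive B T) (cpl : hcomplete B).
Hypothesis hcompact : forall (z y : nat -> H) (C : R), (forall n, gen B T (z n) (y n)) ->
  (forall n, nrm B (z n) <= C) -> (forall n, nrm B (y n) <= C) ->
  exists2 k : nat -> nat, (forall n, (n <= k n)%N) & hcauchy B (fun n => z (k n)).
Local Notation nrm := (nrm B).
Local Notation gen := (gen B T).
Local Notation isometric := (isometric B T).

(** Averaging an orbit over a short time enters the domain and preserves isometry, so the
    regularised vector can be used wherever an isometric one is required. *)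
Lemma gen_dense u (e : R) : 0 < e -> exists v p, [/\ gen v p, nrm (v - u) <= e &
  isometric u -> isometric v].
Proof.
move=> e0; have [d d0 hd] := csg_cont hT u e0.
have h0 : 0 < d / 2 by lra.
have [w hw] := semigroup_integral hT cpl u (ltW h0).
exists ((d / 2)^-1 *: w), ((d / 2)^-1 *: (T (d / 2) u - u)); split.
- exact: genZ (gen_integral hT cpl h0 hw).
- apply: (gen_integral_dist hT h0 (ltW e0) hw) => t /andP[t0 td].
  by apply/ltW/hd; rewrite t0 /=; lra.
- by move=> iu; apply: isometricZ => //; exact: (isometric_integral hT cpl iu (ltW h0) hw).
Qed.

(** A limit [w] of the orbit along integer times tending to infinity exists by compactness. The norm
    does not increase along the orbit, so [nrm (T s w)] is the infimum of the orbit norms for every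
    [s]. *)
Lemma orbit_limit v p (c : R) : gen v p -> 0 < c -> (forall t, 0 <= t -> c <= nrm (T t v)) ->
  exists2 w, isometric w & c <= nrm w.
Proof.
move=> gv c0 hc.
have n0 (n : nat) : 0 <= n%:R :> R by [].
have [||k hk hcau] := hcompact (C := Num.max (nrm v) (nrm p)) (fun n => genT hT (n0 n) gv).
- by move=> n; rewrite (le_trans (csg_le hT _ _))// le_max lexx.
- by move=> n; rewrite (le_trans (csg_le hT _ _))// le_max lexx orbT.
have [w hw] := cpl hcau.
pose S := [set nrm (T t v) | t in [set t : R | 0 <= t]].
have Slb : has_inf S.
  by split; [exists (nrm (T 0 v)), 0 => //=|exists 0 => _ [t _ <-]; exact: nrm_ge0].
have nw s : 0 <= s -> nrm (T s w) = inf S.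
  move=> s0; apply/eqP; rewrite -subr_eq0 -normr_eq0 eq_le normr_ge0 andbT.
  apply/ler_addgt0Pr => e e0; rewrite add0r.
  have e2 : 0 < e / 2 by lra.
  have [N hN] := hw _ e2.
  have [_ [t0 /= t00 <-] ht0] := inf_adherent e2 Slb.
  pose n := maxn N (Num.truncn t0).+1.
  have /hN h1 : (N <= n)%N by exact: leq_maxl.
  have tn : t0 <= (k n)%:R.
    apply/ltW/(lt_le_trans (truncnS_gt _)); rewrite ler_nat.
    by apply: leq_trans (hk n); exact: leq_maxr.
  have kn0 := n0 (k n).
  have h2 := nrm_distn B (T s w) (T s (T (k n)%:R v)).
  have h3 := nrmT_sub hT w (T (k n)%:R v) s0.
  rewrite (nrmBC _ w) in h3; rewrite -(nrm_null (csgA hT v s0 kn0)) in h2.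
  have h4 : nrm (T (s + (k n)%:R) v) <= nrm (T t0 v).
    by apply: (nrmT_antitone hT) => //; lra.
  have h5 : inf S <= nrm (T (s + (k n)%:R) v).
    by apply: ge_inf; [case: Slb|exists (s + (k n)%:R) => //=; exact: addr_ge0].
  move: h2; rewrite !ler_norml => /andP[b1 b2].
  by apply/andP; split; lra.
have n0w : nrm w = inf S by rewrite -(nw 0) // (nrm_null (csg0 hT w)).
exists w; first by move=> s s0; rewrite nw.
rewrite n0w; apply: lb_le_inf; first by case: Slb.
by move=> _ [t t0 <-]; exact: hc.
Qed.

(* Minimise [nrm p ^ 2] over the isometric pairs [gen v p] with [nrm v = 1]. *)
Lemma minimal_pair w q : gen w q -> isometric w -> 0 < nrm w ->
  exists v p (l : R), [/\ gen v p, isometric v, B v v = 1, B p p = l &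
    forall v' p', gen v' p' -> isometric v' -> l * B v' v' <= B p' p'].
Proof.
move=> gw iw w0.
pose S := [set B x.2 x.2 | x in [set x : H * H | [/\ gen x.1 x.2, isometric x.1 & B x.1 x.1 = 1]]].
have normalize v p : gen v p -> isometric v -> 0 < nrm v ->
    [/\ gen ((nrm v)^-1 *: v) ((nrm v)^-1 *: p), isometric ((nrm v)^-1 *: v) &
     B ((nrm v)^-1 *: v) ((nrm v)^-1 *: v) = 1].
  move=> gv iv v0; split; [exact: genZ|exact: isometricZ|].
  by rewrite !ipE -(nrmM B); field; rewrite gt_eqF.
have hS : has_inf S.
  split; last by exists 0 => _ [x _ <-]; exact: ip_ge0.
  exists (B ((nrm w)^-1 *: q) ((nrm w)^-1 *: q)).
  by exists ((nrm w)^-1 *: w, (nrm w)^-1 *: q) => //=; exact: normalize.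
set l := inf S.
have lmin v p : gen v p -> isometric v -> l * B v v <= B p p.
  move=> gv iv; have := nrm_ge0 B v; rewrite le_eqVlt => /predU1P[v0|v0].
    by rewrite -(nrm2 B v) -v0 expr0n mulr0 ip_ge0.
  have : l <= B ((nrm v)^-1 *: p) ((nrm v)^-1 *: p).
    apply: ge_inf; first by case: hS.
    by exists ((nrm v)^-1 *: v, (nrm v)^-1 *: p) => //=; exact: normalize.
  by rewrite !ipE mulrA -expr2 exprVn mulrC ler_pdivlMr ?exprn_gt0 // (nrm2 B v).
have l0 : 0 <= l by apply: lb_le_inf; [case: hS|move=> _ [x _ <-]; exact: ip_ge0].
have n0 (n : nat) : 0 < (n.+1%:R)^-1 :> R by rewrite invr_gt0.
have /choice[vp hvp] (n : nat) : exists x : H * H,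
    [/\ gen x.1 x.2, isometric x.1, B x.1 x.1 = 1 & B x.2 x.2 < l + (n.+1%:R)^-1].
  by have [_ [x [x1 x2 x3] <-] hx] := inf_adherent (n0 n) hS; exists x; split.
have n1 (n : nat) : (n.+1%:R)^-1 <= 1 :> R by rewrite invf_le1 // ler1n.
clearbody l.
have [|||k hk hcau] := hcompact (z := fun n => (vp n).1) (y := fun n => (vp n).2) (C := l + 2).
- by move=> n; case: (hvp n).
- by move=> n; have [_ _ e _] := hvp n; rewrite /nrm e sqrtr1; lra.
- move=> n; have [_ _ _ e] := hvp n.
  rewrite -(@ler_pXn2r _ 2) ?nnegrE ?nrm_ge0 //; last by lra.
  have h : B (vp n).2 (vp n).2 <= l + 1 by apply/ltW/(lt_le_trans e); rewrite lerD2l.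
  by rewrite nrm2 (le_trans h) // expr2; have := mulr_ge0 l0 l0; lra.
(* Compactness handles the vectors only. For their images, the parallelogram law with minimality at
   the sum gives [|p_i - p_j|^2 <= 2 r_i + 2 r_j + l |v_i - v_j|^2], where [r_i] is the excess of
   [|p_i|^2] over [l]. *)
have cauP : hcauchy B (fun n => (vp (k n)).2).
  move=> e e0; have a0 : 0 < e ^+ 2 / 8 by rewrite divr_gt0 ?exprn_gt0.
  have [N1 hN1] := inv_succ_small a0.
  have l1 : 0 < 2 * (l + 1) by lra.
  have [N2 hN2] := hcau _ (divr_gt0 e0 l1).
  exists (maxn N1 N2) => i j; rewrite !geq_max => /andP[i1 i2] /andP[j1 j2].
  have [gi ii ei hi] := hvp (k i); have [gj ij ej hj] := hvp (k j).
  have hd := hN2 i j i2 j2; have hri := hN1 _ (leq_trans i1 (hk i)).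
  have hrj := hN1 _ (leq_trans j1 (hk j)).
  have := lmin _ _ (genD hT gi gj) (isometricD hT ii ij).
  have : nrm ((vp (k i)).1 - (vp (k j)).1) ^+ 2 = 2 - 2 * B (vp (k i)).1 (vp (k j)).1.
    by rewrite nrm2 !ipE (ipC _ (vp (k j)).1 (vp (k i)).1) ei ej; ring.
  have : nrm ((vp (k i)).2 - (vp (k j)).2) ^+ 2 =
      B (vp (k i)).2 (vp (k i)).2 + B (vp (k j)).2 (vp (k j)).2 - 2 * B (vp (k i)).2 (vp (k j)).2.
    by rewrite nrm2 !ipE (ipC _ (vp (k j)).2 (vp (k i)).2); ring.
  rewrite !ipE ei ej (ipC _ (vp (k j)).1 (vp (k i)).1) (ipC _ (vp (k j)).2 (vp (k i)).2).
  move: hi hj hri hrj hd; move: (_^-1) => ri; move: (_.+1%:R^-1) => rj.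
  have := nrm_ge0 B ((vp (k i)).1 - (vp (k j)).1).
  have := nrm_ge0 B ((vp (k i)).2 - (vp (k j)).2).
  move: (nrm _) (nrm _) (B _ _) (B _ _) (B _ _) (B _ _) => dp dv x y z t.
  move=> dp0 dv0 h1 h2 h3 h4 h5 h6 h7 h8.
  rewrite -(@ltr_pXn2r _ 2) ?nnegrE ?(ltW e0)// h6.
  have h9 : (dp * (2 * (l + 1))) ^+ 2 <= e ^+ 2.
    have hA : 0 <= dp * (2 * (l + 1)) := mulr_ge0 dv0 (ltW l1).
    have hB : dp * (2 * (l + 1)) <= e by rewrite -ler_pdivlMr // ltW.
    by rewrite ler_pXn2r ?nnegrE ?(ltW e0).
  have h10 : 4 * (l * dp ^+ 2) <= e ^+ 2.
    apply: le_trans h9; rewrite exprMn [leRHS]mulrC mulrA ler_wpM2r ?sqr_ge0//.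
    by rewrite exprMn sqrrD; have := sqr_ge0 l; lra.
  rewrite h7 in h10; have E0 : 0 < e ^+ 2 by exact: exprn_gt0.
  by lra.
have [v hv] := cpl hcau; have [p hp] := cpl cauP.
have gv : gen v p by apply: (gen_closed hT _ hv hp) => n; case: (hvp (k n)).
have iv : isometric v by apply: (isometric_closed hT _ hv) => n; case: (hvp (k n)).
have v1 : nrm v = 1.
  apply/eqP; rewrite eq_sym -subr_eq0 -normr_eq0 eq_le normr_ge0 andbT.
  apply/ler_addgt0Pr => e e0; rewrite add0r.
  have [N /(_ N (leqnn N))] := hcvg_nrm hv e0.
  have [_ _ e1 _] := hvp (k N).
  have -> : nrm (vp (k N)).1 = 1 by rewrite /nrm e1 sqrtr1.
  exact: ltW.
have p1 : B p p <= l.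
  rewrite leNgt; apply/negP; set s := B p p => ls.
  have e0 : 0 < (s - l) / 4 by lra.
  have [N1 hN1] := hcvg_ip p hp e0; have [N2 hN2] := inv_succ_small e0.
  pose n := maxn N1 N2.
  have := hN1 n (leq_maxl _ _); have := hN2 (k n) (leq_trans (leq_maxr N1 N2 : (N2 <= n)%N) (hk n)).
  have [_ _ _ ] := hvp (k n); have := cauchy_schwarz B (vp (k n)).2 p.
  rewrite -(@ler_pXn2r _ 2) ?nnegrE ?mulr_ge0 ?nrm_ge0// exprMn !(nrm2 B) real_normK ?num_real//.
  rewrite -/s; move: (B (vp (k n)).2 p) (B (vp (k n)).2 (vp (k n)).2) => x y.
  move: (_^-1) => r.
  rewrite ltr_norml => h1 h2 h3 /andP[h4 _].
  have x0 : 0 <= s - (s - l) / 4 by lra.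
  have h5 : (s - (s - l) / 4) ^+ 2 <= x ^+ 2.
    by rewrite ler_pXn2r ?nnegrE //; lra.
  have s0 : 0 < s by lra.
  have h6 : y * s <= (l + (s - l) / 4) * s by rewrite ler_pM2r //; lra.
  have h7 : 0 < (s - l) * s by rewrite mulr_gt0 // subr_gt0.
  have := sqr_ge0 ((s - l) / 4); rewrite sqrrB in h5; lra.
exists v, p, l; split=> //; first by rewrite -(nrm2 B) v1 expr1n.
apply/le_anti; rewrite p1 /=; apply: le_trans (lmin _ _ gv iv).
by rewrite -(nrm2 B) v1 expr1n mulr1.
Qed.

(** Membership of [p] in the domain is part of the claim, so the difference quotient of [p] is
    estimated directly. With [rho s = B (T s v) v], skewness and the minimality condition give
    [rho' = - B (T s v) p] and [(B (T s v) p)' = l rho]. The resulting comparison with a cosine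
    bounds every term of the squared distance to [- l v]. *)
Lemma minimal_pair_eigen v p (l : R) : gen v p -> isometric v -> B v v = 1 -> B p p = l ->
  (forall v' p', gen v' p' -> isometric v' -> l * B v' v' <= B p' p') ->
  gen p ((- l) *: v).
Proof.
move=> gv iv v1 pl lmin.
have l0 : 0 <= l by rewrite -pl ip_ge0.
have ip_ := isometric_gen hT gv iv.
(* Euler-Lagrange equation of the minimisation: [B p' p' - l B v' v'] is a nonnegative quadratic
   form that vanishes at the pair [(v, p)]. *)
have EL v' p' : gen v' p' -> isometric v' -> B p' p = l * B v' v.
  move=> gv' iv'; apply/eqP; rewrite -subr_eq0 -sqrf_eq0.
  apply/eqP/le_anti; rewrite sqr_ge0 andbT.
  rewrite -[leRHS](mul0r (B p' p' - l * B v' v')).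
  apply: quadratic_discriminant; rewrite ?subr_ge0 ?lmin // => e.
  have := lmin _ _ (genD hT gv (genZ hT e gv')) (isometricD hT iv (isometricZ hT e iv')).
  rewrite !ipE (ipC _ v v') (ipC _ p p') v1 pl; lra.
pose rho s := B (T s v) v.
have rho_deriv b : deriv_on 0 b rho (fun s => - B (T s v) p).
  apply: deriv_on_eq (gen_deriv_on hT v b gv) _ _ => // s /andP[s0 _].
  have := gen_isometric_skew hT (genT hT (ltW s0) gv) (isometricT hT (ltW s0) iv) gv iv.
  by lra.
have sig_deriv b : deriv_on 0 b (fun s => B (T s v) p) (fun s => l * rho s).
  apply: deriv_on_eq (gen_deriv_on hT p b gv) _ _ => // s /andP[s0 _].
  by rewrite /rho (EL _ _ (genT hT (ltW s0) gv) (isometricT hT (ltW s0) iv)).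
have rho1 s : 0 <= s -> rho s <= 1.
  move=> s0; apply: le_trans (ip_le _ _ _) _; rewrite (iv s s0) nrmM v1 lexx //.
have sig0 : B (T 0 v) p = 0.
  rewrite (ipT0 hT); have := gen_isometric_ip0 hT gv iv; by rewrite ipC.
have rho0 : rho 0 = 1 by rewrite /rho (ipT0 hT).
have sig_le s : 0 <= s -> B (T s v) p <= l * s.
  move=> s0; have dd := deriv_onB (deriv_onZ l (deriv_on_id 0 s)) (sig_deriv s).
  have := deriv_on_le dd _ (lexx _) s0 (lexx _).
  rewrite sig0 mulr0 subrr subr_ge0; apply=> z /andP[z0 _].
  by rewrite -mulrBr mulr_ge0 // subr_ge0 rho1 // ltW.
have rho_ge s : 0 <= s -> 1 - l * (s * s / 2) <= rho s.
  move=> s0.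
  have dd := deriv_onD (rho_deriv s) (deriv_onZ (l / 2) (deriv_onM (deriv_on_id 0 s) (deriv_on_id 0 s))).
  have := deriv_on_le dd _ (lexx _) s0 (lexx _).
  rewrite rho0 mulr0 mulr0 addr0 => h; have {h} : 1 <= rho s + l / 2 * (s * s).
    apply: h => z /andP[z0 _]; have := sig_le _ (ltW z0).
    by rewrite mul1r mulr1; lra.
  by lra.
move=> e e0.
(* The squared distance turns out to be at most [2 a l^2], which this choice keeps below [e^2]. *)
pose a := e ^+ 2 / (2 * (l + 1) ^+ 2).
have l1 : 0 < 2 * (l + 1) ^+ 2 by rewrite mulr_gt0 // exprn_gt0 //; lra.
have a0 : 0 < a by rewrite divr_gt0 // exprn_gt0.
have [d d0 hd] := csg_cont hT v a0.
exists d => // t /andP[t0 td].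
have nv : nrm v = 1 by rewrite /nrm v1 sqrtr1.
have rho_a s : 0 < s < d -> 1 - a <= rho s.
  move=> /andP[s0 sd]; have := hd s; rewrite (ltW s0) sd => /(_ erefl) h.
  have := cauchy_schwarz B (T s v - v) v; rewrite nv mulr1 !ipE v1 ler_norml => /andP[h1 _].
  by rewrite /rho; lra.
have sig_ge : l * (1 - a) * t <= B (T t v) p.
  have dd := deriv_onB (sig_deriv t) (deriv_onZ (l * (1 - a)) (deriv_on_id 0 t)).
  have := deriv_on_le dd _ (lexx _) (ltW t0) (lexx _).
  rewrite sig0 mulr0 subrr subr_ge0; apply=> z /andP[z0 zt].
  by rewrite mulr1 -mulrBr mulr_ge0 // subr_ge0 rho_a // z0 (lt_trans zt).
rewrite -(@ltr_pXn2r _ 2) ?nnegrE ?nrm_ge0 ?(ltW e0)// nrm2.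
have e1 : B (T t p) p = l * rho t by exact: EL (genT hT (ltW t0) gv) (isometricT hT (ltW t0) iv).
have e2 : B (T t p) v = - B (T t v) p.
  have := gen_isometric_skew hT (genT hT (ltW t0) gv) (isometricT hT (ltW t0) iv) gv iv.
  by lra.
have e3 := gen_isometric_ip0 hT gv iv.
have e4 : B (T t p) (T t p) = l by rewrite (isometric_ip hT) // ltW.
have -> : B (t^-1 *: (T t p - p) - (- l) *: v) (t^-1 *: (T t p - p) - (- l) *: v) =
    t^-1 * t^-1 * (2 * l * (1 - rho t)) - 2 * l * (t^-1 * B (T t v) p) + l * l.
  rewrite !ipE (ipC _ p (T t p)) (ipC _ v (T t p)) (ipC _ v p) e1 e2 e3 e4 pl v1; ring.
have k1 : t^-1 * t^-1 * (2 * l * (1 - rho t)) <= l * l.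
  rewrite -invfM ler_pdivrMl ?mulr_gt0 //.
  have := ler_wpM2l l0 (rho_ge _ (ltW t0)); lra.
have k2 : l * (1 - a) <= t^-1 * B (T t v) p.
  by rewrite ler_pdivlMl // mulrC.
have k3 := ler_wpM2l l0 k2.
have ae : a * (2 * (l + 1) ^+ 2) = e ^+ 2 by rewrite /a divfK // gt_eqF.
have k4 := mulr_ge0 l0 (ltW a0).
by rewrite -ae sqrrD expr1n; lra.
Qed.

Hypothesis heigen : forall v p (l : R), gen v p -> gen p ((- l) *: v) -> 0 <= l ->
  B p v = 0 -> nrm v = 0.

Theorem strong_stability u (e : R) : 0 < e ->
  exists s : R, forall t, s <= t -> nrm (T t u) < e.
Proof.
move=> e0; have [//|hne] := pselect (exists s, forall t, s <= t -> nrm (T t u) < e).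
have hge t : 0 <= t -> e <= nrm (T t u).
  move=> t0; rewrite leNgt; apply/negP => ht; apply: hne; exists t => s ts.
  exact: le_lt_trans (nrmT_antitone hT u t0 ts) ht.
have e2 : 0 < e / 2 by lra.
have [v [p [gv vu _]]] := gen_dense u e2.
have hv t : 0 <= t -> e / 2 <= nrm (T t v).
  move=> t0; have := hge t t0; have := nrmT_sub hT v u t0.
  have := nrm_distn B (T t v) (T t u); rewrite ler_norml => /andP[h1 _] h2 h3.
  by lra.
have [w iw ew] := orbit_limit gv e2 hv.
have e4 : 0 < e / 4 by lra.
(* The limit vector need not lie in the domain; averaging restores this while keeping isometry, and
   [e / 4 < e / 2] keeps it nonzero. *)
have [x [q [gx xw /(_ iw) ix]]] := gen_dense w e4.
have x0 : 0 < nrm x.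
  have := nrm_distn B x w; rewrite ler_norml => /andP[h1 _].
  by lra.
have [y [z [l [gy iy y1 zl lmin]]]] := minimal_pair gx ix x0.
have := heigen gy (minimal_pair_eigen gy iy y1 zl lmin) _ (gen_isometric_ip0 hT gy iy).
rewrite -zl ip_ge0 => /(_ erefl) ny.
by have := nrm2 B y; rewrite ny y1 expr0n /= => /eqP; rewrite eq_sym oner_eq0.
Qed.

End StrongStability.

(** * Square integrable functions *)

Definition sqint {R : realType} (L : R) (f : R -> R) : Prop :=
  measurable_fun `]0, L[ f /\ intble L (fun x => f x ^+ 2).

Section SquareIntegrable.
Context {R : realType}.
Implicit Types (L x y k : R) (f g : R -> R).

Lemma intble_le L f g : measurable_fun `]0, L[ f -> intble L g ->
  (forall x, 0 < x < L -> `|f x| <= g x) -> intble L f.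
Proof.
move=> mf gi fg; apply: le_integrable gi => //; first exact/measurable_EFinP.
move=> x /=; rewrite in_itv => /fg h; rewrite lee_fin.
exact: le_trans h (ler_norm _).
Qed.

Lemma sqint_mul L f g : sqint L f -> sqint L g -> intble L (fun x => f x * g x).
Proof.
move=> [mf fi] [mg gi]; apply: intble_le (intbleD fi gi) _.
  exact: measurable_funM.
move=> x _; rewrite normrM.
have := sqr_ge0 (`|f x| - `|g x|); have := sqr_ge0 (f x); have := sqr_ge0 (g x).
by rewrite sqrrB !real_normK ?num_real //; lra.
Qed.

Lemma within_continuous_sqint L f : {within `[0, L], continuous f} -> sqint L f.
Proof.
move=> cf; split; last first.
  apply: within_continuous_intble.
  by move=> x; rewrite /GRing.exp /=; apply: continuousM; exact: cf.
have /measurable_int := within_continuous_intble cf.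
by move=> /measurable_EFinP.
Qed.

Lemma sqint_cst L k : sqint L (fun=> k).
Proof. by apply: within_continuous_sqint; exact: cst_continuous. Qed.

Lemma sqint_intble L f : sqint L f -> intble L f.
Proof.
move=> sf; have := sqint_mul sf (sqint_cst L 1).
by rewrite (_ : (fun x => f x * 1) = f) //; apply/funext => x; rewrite mulr1.
Qed.

Lemma sqintD L f g : sqint L f -> sqint L g -> sqint L (fun x => f x + g x).
Proof.
move=> sf sg; have [mf fi] := sf; have [mg gi] := sg.
split; first exact: measurable_funD.
have := intbleD (intbleD fi gi) (intbleZ 2 (sqint_mul sf sg)).
by congr (intble L _); apply/funext => x; ring.
Qed.

Lemma sqintZ L k f : sqint L f -> sqint L (fun x => k * f x).
Proof.
move=> [mf fi]; split; first exact: measurable_funM.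
have := intbleZ (k ^+ 2) fi.
by congr (intble L _); apply/funext => x; ring.
Qed.

Lemma sqintB L f g : sqint L f -> sqint L g -> sqint L (fun x => f x - g x).
Proof.
move=> sf sg; have := sqintD sf (sqintZ (-1) sg).
by congr (sqint L _); apply/funext => x; ring.
Qed.

Lemma primB L f g : intble L f -> intble L g ->
  prim (fun x => f x - g x) L = prim f L - prim g L.
Proof. by move=> fi gi; rewrite /prim RintegralB. Qed.

Lemma prim_cauchy_schwarz L f g : sqint L f -> sqint L g ->
  prim (fun x => f x * g x) L ^+ 2 <= prim (fun x => f x ^+ 2) L * prim (fun x => g x ^+ 2) L.
Proof.
move=> sf sg; have [_ fi] := sf; have [_ gi] := sg; have fgi := sqint_mul sf sg.
apply: quadratic_discriminant; try by apply: prim_ge0 => x _; exact: sqr_ge0.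
move=> e; rewrite -!primZ // -!primD //; try exact: intbleZ; try exact: intbleD.
  by apply: prim_ge0 => x _; have := sqr_ge0 (f x + e * g x); rewrite sqrrD exprMn; lra.
by apply: intbleD => //; exact: intbleZ.
Qed.

Lemma ae_eq_prim L f g : intble L f -> intble L g ->
  {ae leb R, forall x, x \in `]0, L[ -> f x = g x} -> prim f L = prim g L.
Proof.
move=> fi gi fg; congr (fine _); apply: ae_eq_integral => //.
- exact: (measurable_int (leb R)).
- exact: (measurable_int (leb R)).
- by apply: (@filterS _ _ (ae_filter_ringOfSetsType (leb R)) _ _ _ fg) => x h xL; rewrite /= h // inE.
Qed.

(* Lebesgue differentiation: [f] is almost everywhere the derivative of [prim f]. *)
Lemma prim_eq0_ae L f : intble L f -> (forall x, 0 <= x <= L -> prim f x = 0) ->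
  {ae leb R, forall x, x \in `]0, L[ -> f x = 0}.
Proof.
move=> fi f0; pose g := f \_ `]0, L[.
have gi : (leb R).-integrable setT (EFin \o g).
  by rewrite -restrict_EFin; apply/integrable_restrict => //; rewrite setTI.
have gl : locally_integrable setT g by exact: integrable_locally_restrict.
have := lebesgue_differentiation gl.
apply: ae_filterS => x gx; rewrite in_itv/= => /andP[x0 xL].
have x0' : (BRight (0 : R)%R < BRight x)%O by rewrite bnd_simp.
pose y := (x + L) / 2.
have xy : x < y by rewrite /y; lra.
have yL : y < L by rewrite /y; lra.
have gi' : (leb R).-integrable `]0, y] (EFin \o g) by apply: integrableS gi.
have [d1 d2] := FTC1_lebesgue_pt xy gi' x0' gx.
have -> : f x = g x by rewrite /g patchE mem_set //= in_itv/= x0.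
rewrite -d2 derive1E.
have dc : is_derive x 1 (fun z => \int[leb R]_(t in `]0, z]) g t) 0.
  apply: near_eq_is_derive (is_derive_cst (0 : R) x (1 : R)).
  near=> z.
  have z0 : 0 < z by near: z; exact: lt_nbhsr.
  have zL : z < L by near: z; exact: lt_nbhsl.
  transitivity (prim f z); first by rewrite f0 // !ltW.
  rewrite -Rintegral_itv_bndo_bndc; last by apply: integrableS gi.
  apply: eq_Rintegral => t; rewrite inE/= in_itv/= => /andP[t0 tz].
  by rewrite /g patchE mem_set //= in_itv/= t0 (lt_trans tz).
by have /@derive_val -> := dc.
Unshelve. all: by end_near. Qed.

End SquareIntegrable.

(** * Integration by parts for integrable functions *)

Section ByParts.
Context {R : realType}.
Implicit Types (L x y k : R) (f g : R -> R).

Lemma within_continuous_bounded L f : {within `[0, L], continuous f} ->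
  exists M : R, forall x, 0 <= x <= L -> `|f x| <= M.
Proof.
move=> cf; have [L0|L0] := ltP L 0.
  by exists 0 => x /andP[x0 xL]; have := le_lt_trans (le_trans x0 xL) L0; rewrite ltxx.
have cn : {within `[0, L], continuous (fun x => `|f x|)}.
  apply/within_continuous_itvP => x xL e e0.
  have [d d0 hd] := (within_continuous_itvP _ _ _).1 cf x xL e e0.
  by exists d => // y yL /(hd _ yL); apply: le_lt_trans; exact: ler_dist_dist.
have [c _ hc] := EVT_max L0 cn; exists `|f c| => x xL.
by apply: hc; rewrite in_itv.
Qed.

Lemma intbleM_continuous L f g : intble L f -> {within `[0, L], continuous g} ->
  intble L (fun x => f x * g x).
Proof.
move=> fi cg; have [M hM] := within_continuous_bounded cg.
have fn : intble L (fun x => `|f x|).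
  by have := integrable_norm fi.
apply: intble_le (intbleZ M fn) _; first apply: measurable_funM.
- by have /measurable_int/measurable_EFinP := fi.
- by have [] := within_continuous_sqint cg.
- move=> x /andP[x0 xL]; rewrite normrM mulrC ler_wpM2r // hM //.
  by rewrite !ltW.
Qed.

Lemma prim_split L y f : intble L f -> 0 <= y <= L ->
  \int[leb R]_(x in `]y, L[) f x = prim f L - prim f y.
Proof.
move=> fi /andP[y0 yL].
have fi1 : (leb R).-integrable `]0, y[ (EFin \o f) by exact: intble_sub fi.
have e1 := Rintegral_itv_bndo_bndc fi1.
move: y0; rewrite le_eqVlt => /predU1P[<-|y0]; first by rewrite prim0 subr0.
move: yL; rewrite le_eqVlt => /predU1P[->|yL].
  by rewrite subrr set_itv_ge ?Rintegral_set0 // bnd_simp ltxx.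
by rewrite /prim e1 Rintegral_itvB ?bnd_simp // ltW.
Qed.

Lemma mem_itvoo (a b z : R) : (z \in `]a, b[%classic) = (a < z < b).
Proof. by apply/idP/idP; rewrite inE /= in_itv. Qed.

Lemma intble_patch L f : intble L f -> (leb R).-integrable setT (EFin \o (f \_ `]0, L[)).
Proof.
by move=> fi; rewrite -restrict_EFin; apply/integrable_restrict => //; rewrite setTI.
Qed.

Lemma prim_EFin L f : intble L f -> (\int[leb R]_(t in `]0%R, L[) (f t)%:E)%E = (prim f L)%:E.
Proof. by move=> fi; rewrite /prim /Rintegral fineK // integrable_fin_num. Qed.

(** Both sides integrate [f x * g y] over the triangle [0 < y < x < L]; integrability on the square
    comes from the product of [|f|] and [|g|]. *)
Lemma prim_fubini L f g : 0 <= L -> intble L f -> intble L g ->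
  prim (fun x => f x * prim g x) L = prim (fun y => g y * \int[leb R]_(x in `]y, L[) f x) L.
Proof.
move=> L0 fi gi.
pose D := `]0, L[%classic : set R.
pose F := f \_ D; pose G := g \_ D.
have Fi : (leb R).-integrable setT (EFin \o F) by exact: intble_patch.
have Gi : (leb R).-integrable setT (EFin \o G) by exact: intble_patch.
have mF : measurable_fun setT F by apply/measurable_EFinP; exact: measurable_int Fi.
have mG : measurable_fun setT G by apply/measurable_EFinP; exact: measurable_int Gi.
pose h (z : measurableTypeR R * measurableTypeR R) : \bar R :=
  (if z.2 < z.1 then F z.1 * G z.2 else 0)%:E.
have mh : measurable_fun setT h.
  apply/measurable_EFinP; apply: measurable_fun_ifT => //.
  - by apply: measurable_fun_ltr; [exact: measurable_snd|exact: measurable_fst].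
  - by apply: measurable_funM; [exact: (measurableT_comp mF)|exact: (measurableT_comp mG)].
have hi : (leb R \x leb R)%E.-integrable setT h.
  apply/integrable12ltyP => //.
  apply: (@le_lt_trans _ _ (\int[leb R]_x (`|F x|%:E * \int[leb R]_y `|G y|%:E))%E).
    apply: ge0_le_integral => //.
    - by move=> x _; exact: integral_ge0.
    - apply: (measurable_fun_fubini_tonelli_F (abse \o h)) => //=.
      exact: measurableT_comp.
    - by apply: emeasurable_funM => //; apply/measurable_EFinP; exact: measurableT_comp.
    - move=> x _; rewrite -ge0_integralZl //.
      + apply: ge0_le_integral => //.
        * by apply: measurableT_comp => //; exact: (measurableT_comp mh (measurable_pair1 x)).
        * by apply/measurable_EFinP; apply: measurable_funM => //; exact: measurableT_comp.
        * move=> y _; rewrite /h /= -EFinM lee_fin; case: ifPn => _.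
            by rewrite normrM.
          by rewrite normr0 mulr_ge0.
      + by apply/measurable_EFinP; exact: measurableT_comp.
  have /integrableP[_ Foo] := Fi; have /integrableP[_ Goo] := Gi.
  rewrite ge0_integralZr //; last 2 first.
  - by apply/measurable_EFinP; exact: measurableT_comp.
  - by apply: integral_ge0.
  by rewrite lte_mul_pinfty // ?integral_ge0 // ge0_fin_numE // integral_ge0.
have cg : {within `[0, L], continuous (prim g)} by exact: prim_continuous.
have cf : {within `[0, L], continuous (prim f)} by exact: prim_continuous.
have fgi : intble L (fun x => f x * prim g x) by exact: intbleM_continuous.
have gfi : intble L (fun y => g y * \int[leb R]_(x in `]y, L[) f x).
  apply: (@eq_integrable _ _ _ (leb R) _ _ (EFin \o (fun y => g y * (prim f L - prim f y)))) => //.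
    move=> y; rewrite inE /= in_itv/= => /andP[y0 yL].
    by rewrite prim_split // !ltW.
  apply: intbleM_continuous => //.
  apply: within_continuousB => //.
  by apply: continuous_subspaceT => x; exact: cst_continuous.
apply: EFin_inj; rewrite -!prim_EFin //.
have := Fubini hi.
have -> : (\int[leb R]_x \int[leb R]_y h (x, y))%E =
    (\int[leb R]_(x in `]0%R, L[) (f x * prim g x)%:E)%E.
  rewrite [RHS]integral_mkcond; apply: eq_integral => x _.
  rewrite patchE; case: ifPn => [|xD].
    rewrite inE /= in_itv/= => /andP[x0 xL].
    have gx : intble x (fun y => f x * g y) by apply/intbleZ/intble_sub/gi; exact: ltW.
    rewrite -primZ; last by apply: intble_sub gi; exact: ltW.
    rewrite -prim_EFin // [RHS]integral_mkcond; apply: eq_integral => y _.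
    rewrite patchE /h /= /F /G !patchE /D !mem_itvoo x0 xL /=.
    have [yx|yx] := ltP y x; rewrite ?andbF //.
    by rewrite (lt_trans yx xL) !andbT; case: ifP => // _; rewrite mulr0.
  apply: integral0_eq => y _; rewrite /h /= /F patchE (negbTE xD) mul0r.
  by case: ifP.
move=> ->.
rewrite [RHS]integral_mkcond; apply: eq_integral => y _.
rewrite patchE; case: ifPn => [|yD]; last first.
  apply: integral0_eq => x _; rewrite /h /= /G patchE (negbTE yD) mulr0.
  by case: ifP.
rewrite inE /= in_itv/= => /andP[y0 yL].
have fy : (leb R).-integrable `]y, L[ (EFin \o f).
  by apply: integrableS fi => //; apply: subset_itvr; rewrite bnd_simp ltW.
rewrite -RintegralZl // /Rintegral fineK; last first.
  by apply: integrable_fin_num => //; exact: (@integrableZl _ _ _ _ _ _ (g y) _ fy).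
rewrite [RHS]integral_mkcond; apply: eq_integral => x _.
rewrite patchE /h /= /F /G !patchE /D !mem_itvoo y0 yL /=.
have [yx|yx] := ltP y x; rewrite //=.
by rewrite (lt_trans y0 yx) /=; case: ifP => [|_]; rewrite ?mul0r // mulrC.
Qed.

Lemma prim_by_parts L f g : 0 <= L -> intble L f -> intble L g ->
  prim (fun x => f x * prim g x) L + prim (fun x => prim f x * g x) L = prim f L * prim g L.
Proof.
move=> L0 fi gi; rewrite prim_fubini //.
have cf : {within `[0, L], continuous (prim f)} by exact: prim_continuous.
have i1 : intble L (fun x => prim f L * g x) by exact: intbleZ.
have i2 : intble L (fun x => prim f x * g x).
  have := intbleM_continuous gi cf.
  by congr (intble L _); apply/funext => x; rewrite mulrC.
have -> : prim (fun y => g y * \int[leb R]_(x in `]y, L[) f x) L =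
    prim (fun x => prim f L * g x - prim f x * g x) L.
  apply: eq_prim => y /andP[y0 yL]; rewrite prim_split //; last by rewrite !ltW.
  by ring.
by rewrite primB // primZ // subrK.
Qed.

End ByParts.

(** * Completeness of the space of square integrable functions *)

Section SquareIntegrableComplete.
Context {R : realType}.
Implicit Types (L x y k : R) (f g : R -> R).

Lemma sqint_norm L f : sqint L f -> sqint L (fun x => `|f x|).
Proof.
move=> [mf fi]; split; first exact: measurableT_comp.
by move: fi; congr (intble L _); apply/funext => x; rewrite real_normK ?num_real.
Qed.

Lemma prim_norm_le L f (e : R) : 0 <= L -> 0 <= e -> sqint L f ->
  prim (fun x => f x ^+ 2) L <= e ^+ 2 / (L + 1) -> prim (fun x => `|f x|) L <= e.
Proof.
move=> L0 e0 sf he.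
have p0 : 0 <= prim (fun x => `|f x|) L by apply: prim_ge0.
rewrite -(@ler_pXn2r _ 2) ?nnegrE //.
have := prim_cauchy_schwarz (sqint_norm sf) (sqint_cst L 1).
rewrite (_ : prim (fun x => `|f x| * 1) L = prim (fun x => `|f x|) L); last first.
  by apply: eq_prim => x _; rewrite mulr1.
rewrite (_ : prim (fun=> 1 ^+ 2) L = L); last first.
  by rewrite (_ : (fun=> 1 ^+ 2) = (fun=> 1)) ?prim_cst ?mul1r //; apply/funext => x; rewrite expr1n.
rewrite (_ : prim (fun x => `|f x| ^+ 2) L = prim (fun x => f x ^+ 2) L); last first.
  by apply: eq_prim => x _; rewrite real_normK ?num_real.
move=> /le_trans; apply; apply: le_trans (ler_wpM2r L0 he) _.
rewrite mulrAC ler_pdivrMr; last by lra.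
by rewrite ler_wpM2l ?sqr_ge0 //; lra.
Qed.

(** The factor [1 / (L + 1)] converts the square bound into an [L^1] bound by [2^-(n+1)] on the
    increments. Their sum is integrable, hence finite almost everywhere, and the sequence converges
    absolutely there. *)
Lemma sqint_cauchy_cvg_ae L (f : nat -> R -> R) : 0 <= L -> (forall n, sqint L (f n)) ->
  (forall n, prim (fun x => (f n.+1 x - f n x) ^+ 2) L <= ((2 ^ n.+1)%:R^-1) ^+ 2 / (L + 1)) ->
  {ae leb R, forall x, x \in `]0, L[ -> cvgn (fun n => f n x)}.
Proof.
move=> L0 sf hf.
pose d n x := f n.+1 x - f n x.
have sd n : sqint L (d n) by exact: sqintB.
have di n : intble L (fun x => `|d n x|) by apply/sqint_intble/sqint_norm.
pose S x : \bar R := (\sum_(n <oo) `|d n x|%:E)%E.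
have md n : measurable_fun `]0, L[ (fun x => `|d n x|%:E).
  by have /measurable_int := di n.
have Si : (leb R).-integrable `]0, L[ S.
  apply/integrableP; split.
    by apply: ge0_emeasurable_sum => [n x _ _|n _]; [rewrite lee_fin|exact: md].
  under eq_integral => x _ do rewrite gee0_abs ?nneseries_ge0 //.
  rewrite integral_nneseries //.
  apply: (@le_lt_trans _ _ (\sum_(n <oo) (1 / (2 ^ (n + 1))%:R)%:E)%E).
    apply: lee_nneseries => [n _ _|n _]; first exact: integral_ge0.
    rewrite prim_EFin // lee_fin addn1 div1r prim_norm_le ?invr_ge0//.
    exact: hf.
  have := @cvg_geometric_eseries_half R 1 0.
  by move/cvg_lim => ->; rewrite ?ltry.
have := @integrable_ae _ _ _ (leb R) _ _ S Si.
move=> /(_ (measurable_itv _)).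
apply: ae_filterS => x hx xL.
have {}hx : S x \is a fin_num by apply: hx.
have cS : cvgn [normed series (d ^~ x)].
  apply: nondecreasing_is_cvgn.
    by apply: nondecreasing_series => n; rewrite /= normr_ge0.
  exists (fine (S x)) => _ [n _ <-].
  rewrite -lee_fin fineK //= -sumEFin.
  exact: nneseries_lim_ge.
have /cvg_ex[l cl] := normed_cvg cS.
apply/cvg_ex; exists (f 0%N x + l).
have -> : (fun n => f n x) = (fun n => f 0%N x + series (d ^~ x) n).
  by apply/funext => n; exact: (@eq_sum_telescope _ (fun n => f n x)).
by apply: cvgD => //; exact: cvg_cst.
Qed.

Definition sqcauchy L (f : nat -> R -> R) := forall e : R, 0 < e -> exists N : nat,
  forall m n, (N <= m)%N -> (N <= n)%N -> prim (fun x => (f m x - f n x) ^+ 2) L < e.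

(** Riesz-Fischer: a fast subsequence converges almost everywhere, and Fatou's lemma along it bounds
    the distance of each late member to the limit. *)
Lemma sqint_complete L (f : nat -> R -> R) : 0 <= L -> (forall n, sqint L (f n)) ->
  sqcauchy L f -> exists2 g, sqint L g &
  forall e : R, 0 < e -> exists N : nat, forall n, (N <= n)%N ->
    prim (fun x => (f n x - g x) ^+ 2) L <= e.
Proof.
move=> L0 sf cf.
pose ee (j : nat) : R := ((2 ^ j.+1)%:R^-1) ^+ 2 / (L + 1).
have ee0 j : 0 < ee j.
  by rewrite divr_gt0 ?exprn_gt0 ?invr_gt0 ?ltr0n ?expn_gt0 //; lra.
have /choice[N hN] := fun j => cf _ (ee0 j).
(* Summing the thresholds makes the indices monotone; the added [j] makes them tend to infinity. *)
pose k j := (\sum_(i < j.+1) N i + j)%N.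
have kN j : (N j <= k j)%N by rewrite /k big_ord_recr /= -addnA addnCA leq_addr.
have kS j : (k j <= k j.+1)%N by rewrite /k [in leqRHS]big_ord_recr /= -addnA leq_add2l addnS ltnW // ltnS leq_addl.
have kj j : (j <= k j)%N by rewrite leq_addl.
have hk n : prim (fun x => (f (k n.+1) x - f (k n) x) ^+ 2) L <= ee n.
  by apply/ltW/hN; [exact: leq_trans (kN n) (kS n)|exact: kN].
have cae := sqint_cauchy_cvg_ae L0 (fun n => sf (k n)) hk.
(* The upper limit is measurable on the whole interval and agrees with the limit wherever the
   subsequence converges. *)
pose g x := fine (limn_esup (fun n => (f (k n) x)%:E)).
have mf n : measurable_fun `]0, L[ (f n) by case: (sf n).
have mg : measurable_fun `]0, L[ g.
  apply: (measurableT_comp (fine_measurable measurableT)).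
  by apply: measurable_fun_limn_esup => n; exact/measurable_EFinP.
have mh m : measurable_fun `]0, L[ (fun x => (f m x - g x) ^+ 2).
  by apply: measurable_funX; exact: measurable_funB.
have key e m : 0 < e -> (forall n, (m <= n)%N -> prim (fun x => (f n x - f m x) ^+ 2) L <= e) ->
    (\int[leb R]_(x in `]0%R, L[) ((f m x - g x) ^+ 2)%:E <= e%:E)%E.
  move=> e0 hm.
  pose F n x := ((f (k (n + m)%N) x - f m x) ^+ 2)%:E.
have sFm n : sqint L (fun x => f (k (n + m)%N) x - f m x) by exact: sqintB.
  have mF n : measurable_fun `]0, L[ (F n).
    by apply/measurable_EFinP; have [_ /measurable_int/measurable_EFinP] := sFm n.
  have F0 n x : (0 <= F n x)%E by rewrite lee_fin sqr_ge0.
  have intF n : (\int[leb R]_(x in `]0%R, L[) F n x <= e%:E)%E.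
    rewrite prim_EFin; last by case: (sFm n).
    by rewrite lee_fin hm // (leq_trans _ (kj _)) // leq_addl.
  have -> : (\int[leb R]_(x in `]0%R, L[) ((f m x - g x) ^+ 2)%:E =
      \int[leb R]_(x in `]0%R, L[) limn_einf (F ^~ x))%E.
    apply: ge0_ae_eq_integral => //.
    - by apply/measurable_EFinP; exact: mh.
    - rewrite (_ : (fun _ => _) = (fun x => - limn_esup (-%E \o (F ^~ x)))%E); last first.
        by apply/funext => x; rewrite limn_esupN oppeK.
      by apply: measurableT_comp => //; apply: measurable_fun_limn_esup => n; apply: (measurableT_comp (f := -%E)) (mF n).
    - by move=> x _; rewrite lee_fin sqr_ge0.
    - move=> x _; rewrite limn_einf_lim; apply: lime_ge; first exact: is_cvg_einfs.
      by apply: nearW => n; apply: le_ereal_inf_tmp => _ [p /= _ <-]; exact: F0.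
    apply: (@filterS _ _ (ae_filter_ringOfSetsType (leb R)) _ _ _ cae) => x hx xL.
    have {hx} : cvgn (fun n => f (k n) x) by apply: hx; rewrite inE in xL *.
    move=> /cvg_ex[l cl].
    have gl : g x = l.
      rewrite /g; have cl' : (f (k n) x)%:E @[n --> \oo] --> l%:E by apply: cvg_EFin; [exact: nearW|exact: cl].
      by have [_ ->] := cvg_limn_einf_sup cl'.
    have cF : F n x @[n --> \oo] --> ((l - f m x) ^+ 2)%:E.
      apply: cvg_EFin; first exact: nearW.
      have cl' : f (k (n + m)%N) x - f m x @[n --> \oo] --> l - f m x.
        by apply: cvgB; [have := cl; rewrite -(cvg_shiftn m); exact|exact: cvg_cst].
      exact: (cvgM cl' cl').
    have [-> _] := cvg_limn_einf_sup cF.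
    by rewrite gl; congr (_%:E); ring.
  have F0' n (x : R) : `]0, L[%classic x -> (0 <= F n x)%E by move=> _; exact: F0.
  apply: (le_trans (@fatou _ _ _ (leb R) _ (measurable_itv _) _ mF F0')).
  rewrite limn_einf_lim; apply: lime_le; first exact: is_cvg_einfs.
  apply: nearW => n; apply: le_trans (intF n).
  by apply: ereal_inf_lbound; exists n => /=.
have gs : sqint L g.
  have [m0 hm0] := cf 1 ltr01.
  have h1 : sqint L (fun x => f m0 x - g x).
    split; first exact: measurable_funB.
    apply/integrableP; split.
      by apply/measurable_EFinP; exact: mh.
    have h1 : forall n, (m0 <= n)%N -> prim (fun x => (f n x - f m0 x) ^+ 2) L <= 1.
      by move=> n /hm0 /(_ (leqnn m0)) /ltW.
    have := key _ _ ltr01 h1.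
    move=> /le_lt_trans h; have {}h := h _ (ltry 1); move: h.
    apply: le_lt_trans; rewrite le_eqVlt; apply/orP; left; apply/eqP.
    by apply: eq_integral => x _; rewrite /= ger0_norm ?sqr_ge0.
  have := sqintB (sf m0) h1.
  by congr (sqint L _); apply/funext => x; ring.
exists g => // e e0; have [m0 hm0] := cf e e0; exists m0 => n nm.
have := key _ n e0; rewrite prim_EFin; last by case: (sqintB (sf n) gs).
rewrite lee_fin; apply => p np.
by apply/ltW/hm0 => //; exact: leq_trans np.
Qed.

End SquareIntegrableComplete.

(** * Fundamental theorem, reflection and Poincare inequalities *)

Section Calculus.
Context {R : realType}.
Implicit Types (L x y k : R) (f g : R -> R).

Lemma deriv_on_within_continuous (a b : R) f f' : deriv_on a b f f' -> {within `[a, b], continuous f}.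
Proof. by case. Qed.

Lemma within_continuousM (a b : R) f g : {within `[a, b], continuous f} ->
  {within `[a, b], continuous g} -> {within `[a, b], continuous (fun x => f x * g x)}.
Proof. by move=> cf cg x; apply: continuousM; [exact: cf|exact: cg]. Qed.

Lemma within_continuous_add (a b : R) f g : {within `[a, b], continuous f} ->
  {within `[a, b], continuous g} -> {within `[a, b], continuous (fun x => f x + g x)}.
Proof. by move=> cf cg x; apply: continuousD; [exact: cf|exact: cg]. Qed.

Lemma within_continuous_cst (a b k : R) : {within `[a, b], continuous (fun=> k)}.
Proof. by apply: continuous_subspaceT => x; exact: cst_continuous. Qed.

Lemma within_continuousZ (a b k : R) f : {within `[a, b], continuous f} ->
  {within `[a, b], continuous (fun x => k * f x)}.
Proof. by move=> cf; apply: within_continuousM => //; exact: within_continuous_cst. Qed.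

Lemma within_continuous_sub (a b : R) f g : {within `[a, b], continuous f} ->
  {within `[a, b], continuous g} -> {within `[a, b], continuous (fun x => f x - g x)}.
Proof. by move=> cf cg; exact: within_continuousB. Qed.

Lemma deriv_on_ext (a b : R) f f' g g' : (forall x, a <= x <= b -> f x = g x) ->
  (forall x, a < x < b -> f' x = g' x) -> deriv_on a b f f' -> deriv_on a b g g'.
Proof.
move=> fg fg' [cf df]; split=> [|x /andP[ax xb]].
  apply: subspace_eq_continuous cf => x; rewrite inE /= in_itv => xab.
  exact: fg.
have := df x; rewrite ax xb => /(_ erefl); rewrite fg' ?ax ?xb//.
apply: near_eq_is_derive; have xab : x \in `]a, b[ by rewrite in_itv/= ax.
apply: filterS (near_in_itvoo xab) => z; rewrite in_itv/= => /andP[az zb].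
by apply: fg; rewrite !ltW.
Qed.

Lemma prim_FTC L f f' : 0 <= L -> deriv_on 0 L f f' -> {within `[0, L], continuous f'} ->
  prim f' L = f L - f 0.
Proof.
move=> L0 df cf'; have d := deriv_onB (prim_deriv_on cf') df.
have b0 : 0 <= (0 : R) <= L by rewrite lexx.
have bL : 0 <= L <= L by rewrite lexx L0.
have z0 z : 0 < z < L -> f' z - f' z = 0 by rewrite subrr.
have := deriv_on_const d z0 b0 bL; rewrite prim0; lra.
Qed.

Lemma prim_reflect L f : 0 <= L -> {within `[0, L], continuous f} ->
  prim (fun x => f (L - x)) L = prim f L.
Proof.
move=> L0 cf; have d := deriv_on_reflect (prim_deriv_on cf).
have cr : {within `[0, L], continuous (fun x => f (L - x))}.
  apply/within_continuous_itvP => x /andP[x0 xL] e e0.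
  have [|d' d0 hd] := (within_continuous_itvP _ _ _).1 cf (L - x) _ e e0.
    by rewrite subr_ge0 xL gerBl.
  exists d' => // y /andP[y0 yL] xy; apply: hd; first by rewrite subr_ge0 yL gerBl.
  by rewrite (_ : L - x - (L - y) = - (x - y)) ?normrN //; ring.
have dn := deriv_onN d.
have dn' : deriv_on 0 L (fun x => - prim f (L - x)) (fun x => f (L - x)).
  by apply: deriv_on_eq dn _ _ => // x _; rewrite opprK.
by rewrite (prim_FTC L0 dn' cr) subrr prim0 subr0 oppr0 sub0r opprK.
Qed.

Lemma sqint_prim L f : sqint L f -> sqint L (prim f).
Proof. by move=> sf; exact: within_continuous_sqint (prim_continuous (sqint_intble sf)). Qed.

Lemma prim_sqr_le L f x : sqint L f -> 0 <= x <= L ->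
  prim f x ^+ 2 <= x * prim (fun y => f y ^+ 2) L.
Proof.
move=> sf /andP[x0 xL].
have sfx : sqint x f.
  split; last by apply: intble_sub xL _; case: sf.
  by have [/measurable_funS mf _] := sf; apply: mf => //; apply: subset_itvl; rewrite bnd_simp.
have := prim_cauchy_schwarz sfx (sqint_cst x 1).
rewrite (_ : prim (fun y => f y * 1) x = prim f x); last by apply: eq_prim => y _; rewrite mulr1.
rewrite (_ : prim (fun=> 1 ^+ 2) x = x); last first.
  by rewrite (_ : (fun=> 1 ^+ 2) = (fun=> 1)) ?prim_cst ?mul1r //; apply/funext => y; rewrite expr1n.
move=> /le_trans; apply; rewrite mulrC ler_wpM2l //.
have fi : intble L (fun y => f y ^+ 2) by case: sf.
have xL' : 0 <= x <= L by rewrite x0.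
rewrite -subr_ge0 -(prim_split fi xL').
by apply: Rintegral_ge0 => y _; exact: sqr_ge0.
Qed.

(** The pointwise Cauchy-Schwarz bound [(prim f x)^2 <= x |f|^2] is integrated over [[0, L]]; this
    is the origin of the constant [L^2 / 2], and of [2 / L^2] in the exclusion of modes. *)
Lemma poincare L f : 0 <= L -> sqint L f ->
  prim (fun x => prim f x ^+ 2) L <= L ^+ 2 / 2 * prim (fun x => f x ^+ 2) L.
Proof.
move=> L0 sf; set K := prim (fun x => f x ^+ 2) L.
have di := deriv_onZ (K / 2) (deriv_onM (deriv_on_id 0 L) (deriv_on_id 0 L)).
have cK : {within `[0, L], continuous (fun x => K * x)}.
  by apply: within_continuousZ; case: (deriv_on_id 0 L).
have dK : deriv_on 0 L (fun x => K / 2 * (x * x)) (fun x => K * x).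
  by apply: deriv_on_eq di _ _ => // x _; field.
have -> : L ^+ 2 / 2 * K = prim (fun x => K * x) L by rewrite (prim_FTC L0 dK cK); field.
have cp := prim_continuous (sqint_intble sf).
apply: prim_le; [|exact: within_continuous_intble|].
  by apply: within_continuous_intble; exact: within_continuousM.
move=> x /andP[x0 xL]; rewrite mulrC; apply: prim_sqr_le => //.
by rewrite !ltW.
Qed.

Lemma poincare_deriv L f f' : 0 <= L -> deriv_on 0 L f f' -> {within `[0, L], continuous f'} ->
  f 0 = 0 -> prim (fun x => f x ^+ 2) L <= L ^+ 2 / 2 * prim (fun x => f' x ^+ 2) L.
Proof.
move=> L0 df cf' f0.
have := poincare L0 (within_continuous_sqint cf').
congr (_ <= _); apply: eq_prim => x /andP[x0 xL]; congr (_ ^+ 2).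
rewrite (@prim_FTC x f f') ?f0 ?subr0 ?(ltW x0)//.
  by apply: deriv_on_sub df => //; exact: ltW.
apply: continuous_subspaceW cf'; apply: subset_itvl; rewrite bnd_simp; exact: ltW.
Qed.

Lemma poincare_deriv_end L f f' : 0 <= L -> deriv_on 0 L f f' -> {within `[0, L], continuous f'} ->
  f L = 0 -> prim (fun x => f x ^+ 2) L <= L ^+ 2 / 2 * prim (fun x => f' x ^+ 2) L.
Proof.
move=> L0 df cf' fL.
have cf := deriv_on_within_continuous df.
have dr := deriv_on_reflect df.
have cr : {within `[0, L], continuous (fun x => - f' (L - x))}.
  apply/within_continuous_itvP => x /andP[x0 xL] e e0.
  have [|d' d0 hd] := (within_continuous_itvP _ _ _).1 cf' (L - x) _ e e0.
    by rewrite subr_ge0 xL gerBl.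
  exists d' => // y /andP[y0 yL] xy; rewrite -opprD normrN; apply: hd.
    by rewrite subr_ge0 yL gerBl.
  by rewrite (_ : L - x - (L - y) = - (x - y)) ?normrN //; ring.
have := poincare_deriv L0 dr cr; rewrite subr0 => /(_ fL).
rewrite -(prim_reflect L0 (within_continuousM cf cf)) -(prim_reflect L0 (within_continuousM cf' cf')).
congr (_ <= _ * _).
by apply: eq_prim => x _; rewrite sqrrN.
Qed.

End Calculus.

(** * The operator P and the energy form *)

Section Helmholtz.
Context {R : realType}.
Implicit Types (c L x k : R) (f g p q : R -> R).

Lemma deriv_on_by_parts L f f' g g' : 0 <= L -> deriv_on 0 L f f' -> deriv_on 0 L g g' ->
  {within `[0, L], continuous f'} -> {within `[0, L], continuous g'} ->
  prim (fun x => f' x * g x) L + prim (fun x => f x * g' x) L = f L * g L - f 0 * g 0.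
Proof.
move=> L0 df dg cf' cg'.
have cf := deriv_on_within_continuous df; have cg := deriv_on_within_continuous dg.
have c1 := within_continuousM cf' cg; have c2 := within_continuousM cf cg'.
rewrite -(prim_FTC L0 (deriv_onM df dg) (within_continuous_add c1 c2)).
by rewrite primD //; exact: within_continuous_intble.
Qed.

(* p1 stands for p': the boundary value problem p'' = c p - f, p(0) = p'(L) = 0. *)
Definition helm c L f p (p1 : R -> R) := [/\ deriv_on 0 L p p1,
  deriv_on 0 L p1 (fun x => c * p x - f x), p 0 = 0 & p1 L = 0].

(** The difference [w] satisfies [(w w')' = w'^2 + c w^2 >= 0], and [w w'] vanishes at both ends,
    hence everywhere. So [w^2] is constant, equal to its value 0 at the left end. *)
Lemma helm_uniq c L f p p1 q q1 : 0 < c -> 0 < L -> helm c L f p p1 -> helm c L f q q1 ->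
  forall x, 0 <= x <= L -> p x = q x /\ p1 x = q1 x.
Proof.
move=> c0 L0 [dp dp1 p0 pL] [dq dq1 q0 qL].
have dw := deriv_onB dp dq; have dw1 := deriv_onB dp1 dq1.
set w := (fun x => p x - q x) in dw; set w1 := (fun x => p1 x - q1 x) in dw dw1.
have {}dw1 : deriv_on 0 L w1 (fun x => c * w x).
  by apply: deriv_on_eq dw1 _ _ => // x _; rewrite /w; ring.
have w0 : w 0 = 0 by rewrite /w p0 q0 subrr.
have wL : w1 L = 0 by rewrite /w1 pL qL subrr.
have ww x : 0 <= x <= L -> w x * w1 x = 0.
  move=> /andP[x0 xL]; have d0 z : 0 < z < L -> 0 <= w1 z * w1 z + w z * (c * w z).
    by move=> _; rewrite addr_ge0 // -?expr2 ?sqr_ge0 // mulrCA -expr2 mulr_ge0 ?sqr_ge0 // ltW.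
  have l1 := deriv_on_le (deriv_onM dw dw1) d0 (lexx 0) x0 xL.
  have l2 := deriv_on_le (deriv_onM dw dw1) d0 x0 xL (lexx L).
  by move: l1 l2; rewrite w0 wL mul0r mulr0 => l1 l2; apply/eqP; rewrite eq_le l1 l2.
have b0 : 0 <= (0 : R) <= L by rewrite lexx ltW.
have bL : 0 <= L <= L by rewrite lexx ltW.
have wz x : 0 <= x <= L -> w x = 0.
  move=> xL; have z0 z : 0 < z < L -> w1 z * w z + w z * w1 z = 0.
    by move=> /andP[z0 zL]; rewrite [w1 z * _]mulrC ww ?addr0 // !ltW.
  have := deriv_on_const (deriv_onM dw dw) z0 xL b0.
  by rewrite w0 mul0r => /eqP; rewrite mulf_eq0 orbb => /eqP.
move=> x xL; split; apply/eqP; rewrite -subr_eq0; apply/eqP; first exact: wz.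
rewrite -[LHS]/(w1 x) -wL; apply: deriv_on_const dw1 _ xL bL => z /andP[z0 zL].
by rewrite wz ?mulr0 // !ltW.
Qed.

(* [hsol] and [hsol1] are the solution and its derivative given by variation of constants. *)
Definition hsol_coef (mu L : R) f : R :=
  (expR (mu * L) * prim (fun s => expR (- mu * s) * f s) L
   + expR (- mu * L) * prim (fun s => expR (mu * s) * f s) L)
  / (2 * mu * (expR (mu * L) + expR (- mu * L))).

Definition hsol c L f x : R := let mu := Num.sqrt c in
  hsol_coef mu L f * (expR (mu * x) - expR (- mu * x))
  - (2 * mu)^-1 * (expR (mu * x) * prim (fun s => expR (- mu * s) * f s) x
                   - expR (- mu * x) * prim (fun s => expR (mu * s) * f s) x).

Definition hsol1 c L f x : R := let mu := Num.sqrt c in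
  hsol_coef mu L f * (mu * (expR (mu * x) + expR (- mu * x)))
  - 2^-1 * (expR (mu * x) * prim (fun s => expR (- mu * s) * f s) x
            + expR (- mu * x) * prim (fun s => expR (mu * s) * f s) x).

Lemma hsolP c L f : 0 < c -> 0 < L -> {within `[0, L], continuous f} ->
  helm c L f (hsol c L f) (hsol1 c L f).
Proof.
move=> c0 L0 cf; set mu := Num.sqrt c.
have mu0 : 0 < mu by rewrite sqrtr_gt0.
have muE : mu ^+ 2 = c by rewrite sqr_sqrtr // ltW.
have de k := deriv_on_expR 0 L k.
have da k : deriv_on 0 L (prim (fun s => expR (k * s) * f s)) (fun s => expR (k * s) * f s).
  apply: prim_deriv_on; apply: within_continuousM => //.
  exact: deriv_on_within_continuous (de k).
have ee x : expR (mu * x) * expR (- mu * x) = 1.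
  by rewrite -expRD mulNr subrr expR0.
set K := hsol_coef mu L f.
split.
- have d := deriv_onB (deriv_onZ K (deriv_onB (de mu) (de (- mu))))
    (deriv_onZ (2 * mu)^-1 (deriv_onB (deriv_onM (de mu) (da (- mu))) (deriv_onM (de (- mu)) (da mu)))).
  apply: deriv_on_eq d _ _ => // x _; rewrite /hsol1 -/mu -/K.
  have := ee x; move: (expR _) (expR _) (prim _ _) (prim _ _) => b a q p ab.
  have {ab} -> : mu * a * p + a * (b * f x) - (- mu * b * q + b * (a * f x)) = mu * (a * p + b * q).
    by ring.
  by field; exact: lt0r_neq0.
- have d := deriv_onB (deriv_onZ K (deriv_onZ mu (deriv_onD (de mu) (de (- mu)))))
    (deriv_onZ 2^-1 (deriv_onD (deriv_onM (de mu) (da (- mu))) (deriv_onM (de (- mu)) (da mu)))).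
  apply: deriv_on_eq d _ _ => // x _; rewrite /hsol -/mu -/K -muE.
  have := ee x; move: (expR _) (expR _) (prim _ _) (prim _ _) => b a q p ab.
  have -> : mu * a * p + a * (b * f x) + (- mu * b * q + b * (a * f x)) =
    mu * (a * p - b * q) + 2 * (a * b) * f x by ring.
  by rewrite ab; field; exact: lt0r_neq0.
- by rewrite /hsol !prim0 !mulr0 !subrr !mulr0 subr0.
- rewrite /hsol1 -/mu /hsol_coef.
  have := expR_gt0 (- mu * L); have := expR_gt0 (mu * L).
  move: (expR _) (expR _) (prim _ _) (prim _ _) => b a q p a0 b0.
  by field; rewrite !lt0r_neq0 // addr_gt0.
Qed.

Lemma helmD c L f g p p1 q q1 k : helm c L f p p1 -> helm c L g q q1 ->
  helm c L (fun x => f x + k * g x) (fun x => p x + k * q x) (fun x => p1 x + k * q1 x).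
Proof.
move=> [dp dp1 p0 pL] [dq dq1 q0 qL]; split; last 2 first.
- by rewrite p0 q0 mulr0 addr0.
- by rewrite pL qL mulr0 addr0.
- exact: deriv_onD dp (deriv_onZ k dq).
- by apply: deriv_on_eq (deriv_onD dp1 (deriv_onZ k dq1)) _ _ => // x _; ring.
Qed.

Lemma helm_ext c L f g p p1 : (forall x, 0 <= x <= L -> f x = g x) ->
  helm c L f p p1 -> helm c L g p p1.
Proof.
move=> fg [dp dp1 p0 pL]; split=> //.
by apply: deriv_on_eq dp1 _ _ => // x /andP[x0 xL]; rewrite fg // !ltW.
Qed.

Lemma hsolD c L f g k : 0 < c -> 0 < L -> {within `[0, L], continuous f} ->
  {within `[0, L], continuous g} -> forall x, 0 <= x <= L ->
  hsol c L (fun x => f x + k * g x) x = hsol c L f x + k * hsol c L g x.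
Proof.
move=> c0 L0 cf cg x xL.
have cs := within_continuous_add cf (within_continuousZ (k:=k) cg).
by have [->] := helm_uniq c0 L0 (hsolP c0 L0 cs) (helmD k (hsolP c0 L0 cf) (hsolP c0 L0 cg)) xL.
Qed.

Lemma eq_hsol c L f g : 0 < c -> 0 < L -> {within `[0, L], continuous f} ->
  {within `[0, L], continuous g} -> (forall x, 0 <= x <= L -> f x = g x) ->
  forall x, 0 <= x <= L -> hsol c L f x = hsol c L g x.
Proof.
move=> c0 L0 cf cg fg x xL.
by have [->] := helm_uniq c0 L0 (helm_ext fg (hsolP c0 L0 cf)) (hsolP c0 L0 cg) xL.
Qed.

End Helmholtz.

Definition tail {R : realType} (L : R) (f : R -> R) (x : R) : R := prim f L - prim f x.

Section Tail.
Context {R : realType}.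
Implicit Types (L x : R) (f g : R -> R).

Lemma tail_end L f : tail L f L = 0.
Proof. exact: subrr. Qed.

Lemma tail_continuous L f : intble L f -> {within `[0, L], continuous (tail L f)}.
Proof.
move=> fi; apply: within_continuous_sub; last exact: prim_continuous.
exact: within_continuous_cst.
Qed.

Lemma deriv_on_tail L f : {within `[0, L], continuous f} ->
  deriv_on 0 L (tail L f) (fun x => - f x).
Proof.
move=> cf; have d := deriv_onB (deriv_on_cst 0 L (prim f L)) (prim_deriv_on cf).
by apply: deriv_on_eq d _ _ => // x _; rewrite sub0r.
Qed.

Lemma prim_tail L f g : 0 <= L -> intble L f -> intble L g ->
  prim (fun x => f x * prim g x) L = prim (fun x => tail L f x * g x) L.
Proof.
move=> L0 fi gi; have := prim_by_parts L0 fi gi; have cp := prim_continuous fi.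
have i1 : intble L (fun x => prim f x * g x).
  rewrite (_ : (fun x => _) = (fun x => g x * prim f x)); first exact: intbleM_continuous.
  by apply/funext => x; rewrite mulrC.
rewrite (_ : (fun x => tail L f x * g x) = (fun x => prim f L * g x - prim f x * g x)).
  by rewrite primB ?primZ//; [lra|exact: intbleZ].
by apply/funext => x; rewrite mulrBl.
Qed.

End Tail.

(** * The energy form as a function of second derivatives *)

Section Energy.
Context {R : realType} (c L At kap b1 b3 : R).
Hypotheses (c0 : 0 < c) (L0 : 0 < L) (At0 : 0 < At) (kap0 : 0 < kap).
Implicit Types (x s k : R) (f g h F : R -> R).

(** Here [g] stands for the second derivative of a real displacement [u] with [u(0) = u'(0) = 0], so
    [prim g] is [u']. With [p = P u'], the function [jop g] is [J u' = p'']; [alpha] and [rell] are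
    [a(u, v)] and [ell(u)] in these terms. *)
Definition jop g x : R := c * hsol c L (prim g) x - prim g x.

Definition alpha g h : R :=
  prim (fun x => At * (g x * h x) - kap * (jop g x * prim h x)) L.

Definition rell g : R := b1 * hsol c L (prim g) L + b3 * prim g L.

Let pr_cont g (sg : sqint L g) : {within `[0, L], continuous (prim g)}.
Proof. exact: prim_continuous (sqint_intble sg). Qed.

Let hP g (sg : sqint L g) : helm c L (prim g) (hsol c L (prim g)) (hsol1 c L (prim g)).
Proof. exact: hsolP (pr_cont sg). Qed.

Lemma hsol_continuous g : sqint L g -> {within `[0, L], continuous (hsol c L (prim g))}.
Proof. by move=> /hP[/deriv_on_within_continuous]. Qed.

Lemma hsol1_continuous g : sqint L g -> {within `[0, L], continuous (hsol1 c L (prim g))}.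
Proof. by move=> /hP[_ /deriv_on_within_continuous]. Qed.

Lemma jop_continuous g : sqint L g -> {within `[0, L], continuous (jop g)}.
Proof.
move=> sg; apply: within_continuous_sub (pr_cont sg).
exact: within_continuousZ (hsol_continuous sg).
Qed.

Lemma alphaE g h : sqint L g -> sqint L h -> alpha g h =
  At * prim (fun x => g x * h x) L - kap * prim (fun x => jop g x * prim h x) L.
Proof.
move=> sg sh; have i1 := sqint_mul sg sh.
have i2 := within_continuous_intble (within_continuousM (jop_continuous sg) (pr_cont sh)).
by rewrite /alpha primB ?primZ //; exact: intbleZ.
Qed.

Lemma prim_jop_hsol g h : sqint L g -> sqint L h ->
  prim (fun x => jop g x * hsol c L (prim h) x) L =
  - prim (fun x => hsol1 c L (prim g) x * hsol1 c L (prim h) x) L.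
Proof.
move=> sg sh; have [dp dp1 p0 pL] := hP sg; have [dq dq1 q0 qL] := hP sh.
have := deriv_on_by_parts (ltW L0) dp1 dq (jop_continuous sg) (hsol1_continuous sh).
by rewrite q0 pL mulr0 mul0r subrr => /eqP; rewrite addr_eq0 => /eqP.
Qed.

(** Writing [v' = c q - q''] with [q = P v'] and integrating [p'' q] by parts makes the nonlocal
    term manifestly symmetric and nonnegative; symmetry, coercivity and boundedness of [alpha]
    follow from this formula. *)
Lemma alpha_energy g h : sqint L g -> sqint L h -> alpha g h =
  At * prim (fun x => g x * h x) L
  + kap * (c * prim (fun x => hsol1 c L (prim g) x * hsol1 c L (prim h) x) L
           + prim (fun x => jop g x * jop h x) L).
Proof.
move=> sg sh; rewrite (alphaE sg sh); congr (_ + _); rewrite -mulrN; congr (_ * _).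
rewrite (_ : (fun x => jop g x * prim h x) =
  (fun x => c * (jop g x * hsol c L (prim h) x) - jop g x * jop h x)); last first.
  by apply/funext => x; rewrite [jop h x]/jop; ring.
have i1 := within_continuous_intble (within_continuousM (jop_continuous sg) (hsol_continuous sh)).
have i2 := within_continuous_intble (within_continuousM (jop_continuous sg) (jop_continuous sh)).
by rewrite primB ?primZ //; [rewrite prim_jop_hsol //; ring|exact: intbleZ].
Qed.

Lemma alphaC g h : sqint L g -> sqint L h -> alpha g h = alpha h g.
Proof.
move=> sg sh; rewrite (alpha_energy sg sh) (alpha_energy sh sg).
have C f1 f2 : prim (fun x => f1 x * f2 x) L = prim (fun x => f2 x * f1 x) L.
  by apply: eq_prim => x _; rewrite mulrC.
have cg (a a' b b' d d' : R) : a = a' -> b = b' -> d = d' ->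
  At * a + kap * (c * b + d) = At * a' + kap * (c * b' + d') by move=> -> -> ->.
by apply: cg (C g h) (C (hsol1 c L (prim g)) (hsol1 c L (prim h))) (C (jop g) (jop h)).
Qed.

Lemma prim_sqr_ge0 f x : 0 <= prim (fun x => f x ^+ 2) x.
Proof. by apply: prim_ge0 => y _; exact: sqr_ge0. Qed.

Lemma alpha_diag g : sqint L g -> alpha g g =
  At * prim (fun x => g x ^+ 2) L
  + kap * (c * prim (fun x => hsol1 c L (prim g) x ^+ 2) L + prim (fun x => jop g x ^+ 2) L).
Proof. by move=> sg; rewrite (alpha_energy sg sg). Qed.

Lemma alpha_ge g : sqint L g -> At * prim (fun x => g x ^+ 2) L <= alpha g g.
Proof.
move=> sg; rewrite (alpha_diag sg) lerDl mulr_ge0 ?(ltW kap0) // addr_ge0 ?prim_sqr_ge0 //.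
by rewrite mulr_ge0 ?prim_sqr_ge0 // ltW.
Qed.

(** Expand the square of [u' = c p - p''] and integrate the cross term by parts. *)
Lemma prim_slope_sqr g : sqint L g -> prim (fun x => prim g x ^+ 2) L =
  c ^+ 2 * prim (fun x => hsol c L (prim g) x ^+ 2) L
  + 2 * c * prim (fun x => hsol1 c L (prim g) x ^+ 2) L + prim (fun x => jop g x ^+ 2) L.
Proof.
move=> sg; have cj := jop_continuous sg; have cp := hsol_continuous sg.
rewrite (_ : (fun x => prim g x ^+ 2) = (fun x => c ^+ 2 * hsol c L (prim g) x ^+ 2
  + (- 2 * c) * (jop g x * hsol c L (prim g) x) + jop g x ^+ 2)); last first.
  by apply/funext => x; rewrite /jop; ring.
have i1 := within_continuous_intble (within_continuousM cp cp).
have i2 := within_continuous_intble (within_continuousM cj cp).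
have i3 := within_continuous_intble (within_continuousM cj cj).
rewrite !primD ?primZ ?prim_jop_hsol //; try by do ?apply: intbleD => //; exact: intbleZ.
have -> : prim (fun x => hsol1 c L (prim g) x * hsol1 c L (prim g) x) L =
  prim (fun x => hsol1 c L (prim g) x ^+ 2) L by [].
by ring.
Qed.

Lemma alpha_le g : sqint L g ->
  alpha g g <= (At + kap * (L ^+ 2 / 2)) * prim (fun x => g x ^+ 2) L.
Proof.
move=> sg; rewrite (alpha_diag sg) mulrDl lerD2l -mulrA ler_pM2l //.
apply: le_trans (poincare (ltW L0) sg); rewrite (prim_slope_sqr sg) lerD2r.
have := prim_sqr_ge0 (hsol c L (prim g)) L; have := prim_sqr_ge0 (hsol1 c L (prim g)) L.
move: (prim _ _) (prim _ _) c0 => P0 P1 c0' P10 P00; nra.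
Qed.

(** [sinh (mu x) / (mu cosh (mu L))], the Green function of the boundary value problem with one
    argument at [L]. It writes the end value of [P u'], which occurs in [ell], as an integral
    against [u']. *)
Let gam x : R := let mu := Num.sqrt c in
  (mu * (expR (mu * L) + expR (- mu * L)))^-1 * (expR (mu * x) - expR (- mu * x)).
Let gam1 x : R := let mu := Num.sqrt c in
  (expR (mu * L) + expR (- mu * L))^-1 * (expR (mu * x) + expR (- mu * x)).

(* [G] solves G'' = c G, G(0) = 0, G'(L) = 1. *)
Lemma helm_end : exists2 G : R -> R, {within `[0, L], continuous G} &
  forall h, sqint L h -> hsol c L (prim h) L = prim (fun x => G x * prim h x) L.
Proof.
set mu := Num.sqrt c.
have mu0 : 0 < mu by rewrite sqrtr_gt0.
have muE : mu ^+ 2 = c by rewrite sqr_sqrtr // ltW.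
have de k := deriv_on_expR 0 L k.
have S0 : 0 < expR (mu * L) + expR (- mu * L) by rewrite addr_gt0 ?expR_gt0.
set S := expR (mu * L) + expR (- mu * L) in S0.
have dG : deriv_on 0 L gam gam1.
  have d := deriv_onZ (mu * S)^-1 (deriv_onB (de mu) (de (- mu))).
  apply: deriv_on_eq d _ _ => // x _; rewrite /gam1 -/mu -/S.
  by field; rewrite !lt0r_neq0.
have dG1 : deriv_on 0 L gam1 (fun x => c * gam x).
  have d := deriv_onZ S^-1 (deriv_onD (de mu) (de (- mu))).
  apply: deriv_on_eq d _ _ => // x _; rewrite /gam -/mu -/S -muE.
  by field; rewrite !lt0r_neq0.
have G0 : gam 0 = 0 by rewrite /gam !mulr0 subrr mulr0.
have G1 : gam1 L = 1 by rewrite /gam1 -/mu -/S mulVf // lt0r_neq0.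
have cG := deriv_on_within_continuous dG; have cG1 := deriv_on_within_continuous dG1.
exists gam => // h sh; have [dq dq1 q0 qL] := hP sh.
have cq := hsol_continuous sh; have cq1 := hsol1_continuous sh; have cj := jop_continuous sh.
have e1 := deriv_on_by_parts (ltW L0) dG1 dq (within_continuousZ (k:=c) cG) cq1.
have e2 := deriv_on_by_parts (ltW L0) dG dq1 cG1 cj.
move: e1 e2; rewrite q0 mulr0 G1 G0 mul0r qL mulr0 mul1r !subr0 => e1 e2.
rewrite (_ : (fun x => gam x * prim h x) =
  (fun x => c * gam x * hsol c L (prim h) x - gam x * jop h x)); last first.
  by apply/funext => x; rewrite /jop; ring.
rewrite primB.
- by move: e1 e2; rewrite /jop; lra.
- by apply: within_continuous_intble; apply: within_continuousM => //; exact: within_continuousZ.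
- by apply: within_continuous_intble; apply: within_continuousM.
Qed.

Let prim_affine_comb (s : R) (f1 f2 f3 f4 f5 : R -> R) : intble L f1 -> intble L f2 -> intble L f3 ->
  intble L f4 -> intble L f5 ->
  prim (fun x => At * f1 x - (kap * f2 x + f3 x - s * (b1 * f4 x + b3 * f5 x))) L =
  At * prim f1 L - (kap * prim f2 L + prim f3 L - s * (b1 * prim f4 L + b3 * prim f5 L)).
Proof.
move=> i1 i2 i3 i4 i5; have iB f h : intble L f -> intble L h -> intble L (fun x => f x - h x).
  by move=> fi hi; have := intbleD fi (intbleZ (-1) hi); congr (intble L _); apply/funext => x; ring.
have k1 := intbleZ At i1; have k2 := intbleZ kap i2; have k4 := intbleZ b1 i4.
have k5 := intbleZ b3 i5; have k45 := intbleD k4 k5; have ks := intbleZ s k45.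
have k23 := intbleD k2 i3; have kB := iB _ _ k23 ks.
by rewrite (primB k1 kB) (primB k23 ks) (primD k2 i3) (primZ s k45) (primD k4 k5) !primZ.
Qed.

(* Natural boundary conditions at L are encoded in the vanishing of the tails there. *)
Lemma weak_strong : exists2 G : R -> R, {within `[0, L], continuous G} &
  forall g F s, sqint L g -> sqint L F ->
  (forall h, sqint L h -> alpha g h = prim (fun x => F x * prim (prim h) x) L - s * rell h) ->
  prim (fun x => (At * g x - (kap * tail L (jop g) x + tail L (tail L F) x
                              - s * (b1 * tail L G x + b3))) ^+ 2) L = 0.
Proof.
have aux (X Y Z W : R) : X - Y = Z - W -> X - (Y + Z - W) = 0 by move=> ?; lra.
have [G cG hG] := helm_end; exists G => // g F s sg sF weak.
have L0' := ltW L0; have ij := within_continuous_intble (jop_continuous sg).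
have iF := sqint_intble sF; have iG := within_continuous_intble cG.
have ct := tail_continuous iF; have it := within_continuous_intble ct.
pose E x := At * g x - (kap * tail L (jop g) x + tail L (tail L F) x - s * (b1 * tail L G x + b3)).
rewrite -[X in prim X L]/(fun x => E x ^+ 2).
have sE : sqint L E.
  have sT f : intble L f -> sqint L (tail L f).
    by move=> fi; apply: within_continuous_sqint; exact: tail_continuous.
  apply: sqintB; first exact: sqintZ.
  apply: sqintB; first by apply: sqintD; [apply: sqintZ|]; exact: sT.
  by apply: sqintZ; apply: sqintD; [apply: sqintZ; exact: sT|exact: sqint_cst].
(* Testing with the residual [E] itself gives the claim; this is possible because every square
   integrable function is the second derivative of an admissible test function. *)
suff Eh h : sqint L h -> prim (fun x => E x * h x) L = 0 by exact: Eh.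
move=> sh; have ih := sqint_intble sh; have ip := within_continuous_intble (pr_cont sh).
(* Integration by parts moves each primitive from [h] onto a tail of the other factor, so the weak
   equation becomes orthogonality of [E] to [h]. *)
have := weak h sh; rewrite (alphaE sg sh) /rell (hG h sh) !prim_tail // => e.
have m1 := sqint_mul sg sh.
have mT f : intble L f -> intble L (fun x => tail L f x * h x).
  by move=> /tail_continuous/within_continuous_sqint/sqint_mul; exact.
have EE : (fun x => E x * h x) = (fun x => At * (g x * h x) - (kap * (tail L (jop g) x * h x)
  + tail L (tail L F) x * h x - s * (b1 * (tail L G x * h x) + b3 * h x))).
  apply/funext => x; rewrite /E.
  move: (g x) (h x) (tail _ _ x) (tail _ _ x) (tail _ _ x) => *; ring.
rewrite EE; apply: etrans (prim_affine_comb s m1 (mT _ ij) (mT _ it) (mT _ iG) ih) _.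
exact: aux e.
Qed.

End Energy.

(** * Absence of undamped modes: the energy form *)

Section Eigen.
Context {R : realType} (c L At kap b1 b3 : R).
Hypotheses (c0 : 0 < c) (L0 : 0 < L) (At0 : 0 < At) (kap0 : 0 < kap).
Hypotheses (b10 : 0 < b1) (b30 : 0 < b3).
Implicit Types (x s k : R) (f g h F : R -> R).

Notation alpha := (alpha c L At kap).
Notation rell := (rell c L b1 b3).
Notation jop := (jop c L).

(** A lower bound for the Rayleigh quotient, in the shape of the characteristic polynomial so that
    it can be read as a bound on the root [- t]. It uses the Poincare inequality for [u], [u'], [p]
    (zero at 0) and [p'] (zero at [L]). *)
Lemma alpha_eigen_poincare g lam : sqint L g ->
  alpha g g = lam * prim (fun x => prim (prim g) x ^+ 2) L ->
  0 < prim (fun x => prim (prim g) x ^+ 2) L ->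
  (2 / L ^+ 2) ^+ 2 * (2 / L ^+ 2 + (c + kap / At)) <= lam / At * (c + 2 / L ^+ 2).
Proof.
move=> sg; rewrite (alpha_diag At kap c0 L0 sg).
have cu := prim_continuous (sqint_intble sg).
have [dp dp1 p0 pL] := hsolP c0 L0 cu.
have cp1 := hsol1_continuous c0 L0 sg; have cj := jop_continuous c0 L0 sg.
have := poincare_deriv_end (ltW L0) dp1 cj pL.
have := poincare_deriv (ltW L0) dp cp1 p0.
have := prim_slope_sqr c0 L0 sg.
have := poincare (ltW L0) (within_continuous_sqint cu).
have := poincare (ltW L0) sg.
have := prim_sqr_ge0 (hsol c L (prim g)) L.
set G2 := prim (fun x => g x ^+ 2) L; set U1 := prim (fun x => prim g x ^+ 2) L.
set U0 := prim (fun x => prim (prim g) x ^+ 2) L.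
set P0 := prim (fun x => hsol c L (prim g) x ^+ 2) L.
set P1 := prim (fun x => hsol1 c L (prim g) x ^+ 2) L.
set J2 := prim (fun x => (c * hsol c L (prim g) x - prim g x) ^+ 2) L.
move: G2 U1 U0 P0 P1 J2 => G2 U1 U0 P0 P1 J2 P00.
set x := 2 / L ^+ 2; have x0 : 0 < x by rewrite divr_gt0 // exprn_gt0.
have xV : L ^+ 2 / 2 = x^-1 by rewrite /x invf_div.
rewrite xV ![x^-1 * _]mulrC !ler_pdivlMr // => hG hU eU hP hJ e U00.
clearbody x; have cx0 : 0 < c + x by rewrite addr_gt0.
(* The nonlocal energy is at least [x / (c + x)] times [|u'|^2], the value it would have if
   [p'' = - x p]. *)
have key : x * U1 <= (c + x) * (c * P1 + J2).
  rewrite -subr_ge0 eU.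
  have -> : (c + x) * (c * P1 + J2) - x * (c ^+ 2 * P0 + 2 * c * P1 + J2) =
    c * (c * (P1 - P0 * x) + (J2 - P1 * x)) by ring.
  by rewrite mulr_ge0 ?(ltW c0) // addr_ge0 ?subr_ge0 // mulr_ge0 ?subr_ge0 // ltW.
have e2 : lam / At = (G2 + kap / At * (c * P1 + J2)) / U0.
  apply/(canRL (mulfK (lt0r_neq0 U00))); rewrite mulrAC -e.
  by field; exact: lt0r_neq0.
rewrite e2 [leRHS]mulrAC ler_pdivlMr //.
have k0 : 0 < kap / At by rewrite divr_gt0.
move: (kap / At) k0 => k k0; set S := c * P1 + J2 in key *.
have x2U : x ^+ 2 * U0 <= x * U1 by rewrite expr2 -mulrA ler_pM2l // mulrC.
have xU : x * U1 <= G2 by rewrite mulrC.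
have h1 : x ^+ 2 * U0 * (c + x) <= G2 * (c + x).
  by rewrite ler_pM2r //; apply: le_trans xU.
have h2 : k * (x ^+ 2 * U0) <= k * ((c + x) * S) by rewrite ler_pM2l //; apply: le_trans key.
have -> : x ^+ 2 * (x + (c + k)) * U0 = x ^+ 2 * U0 * (c + x) + k * (x ^+ 2 * U0) by ring.
have -> : (G2 + k * S) * (c + x) = G2 * (c + x) + k * ((c + x) * S) by ring.
exact: lerD.
Qed.

(** For [lam = 0] coercivity suffices. Otherwise [g] is shown to have a smooth representative, and
    [u], [p] and their derivatives, read from [x = L] backwards, form an [eigen_ode] with the extra
    end condition coming from [rell g = 0]. *)
Lemma alpha_eigen g lam : 0 <= lam -> sqint L g ->
  (forall h, sqint L h ->
     alpha g h = lam * prim (fun x => prim (prim g) x * prim (prim h) x) L) ->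
  (lam != 0 -> rell g = 0) -> prim (fun x => g x ^+ 2) L = 0.
Proof.
move=> lam0 sg eig l0; have L0' := ltW L0.
set U0 := prim (fun x => prim (prim g) x ^+ 2) L.
have eg : alpha g g = lam * U0 by rewrite eig.
have fin : lam * U0 = 0 -> prim (fun x => g x ^+ 2) L = 0.
  move=> z; have := alpha_ge At c0 L0 kap0 sg; rewrite eg z.
  rewrite pmulr_rle0 // => h; apply/eqP; rewrite eq_le h; exact: prim_sqr_ge0.
have := lam0; rewrite le_eqVlt => /predU1P[lz|lamp]; first by apply: fin; rewrite -lz mul0r.
have := prim_sqr_ge0 (prim (prim g)) L; rewrite -/U0 le_eqVlt => /predU1P[z|U00].
  by apply: fin; rewrite -z mulr0.
have poin := alpha_eigen_poincare sg eg U00.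
have cu := prim_continuous (sqint_intble sg); set u1 := prim g in cu *.
have cu0 := prim_continuous (within_continuous_intble cu); set u := prim u1 in cu0 *.
have [dp dp1 p0 pL] := hsolP c0 L0 cu.
set p := hsol c L u1 in dp dp1 p0; set p1 := hsol1 c L u1 in dp dp1 pL.
have cj := jop_continuous c0 L0 sg; have ij := within_continuous_intble cj.
have iu := within_continuous_intble cu0.
have iu1 := within_continuous_intble cu.
have ct := tail_continuous iu; have it := within_continuous_intble ct.
(* The strong form of the equation expresses [At g] by tails of continuous functions, so [G] is a
   continuous representative of [g]; [u] and [p] then solve the system classically. *)
pose G x := At^-1 * (kap * tail L (jop g) x + lam * tail L (tail L u) x).
have cG : {within `[0, L], continuous G}.
  by apply: within_continuousZ; apply: within_continuous_add; apply: within_continuousZ; exact: tail_continuous.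
have [G' cG' hG'] := weak_strong At kap b1 b3 c0 L0.
have sF := within_continuous_sqint (within_continuousZ (k:=lam) cu0).
have sg' := sg.
have e0 := hG' g (fun x => lam * u x) 0 sg sF _.
have {e0} e0 : prim (fun x => (At * g x - At * G x) ^+ 2) L = 0.
  apply: etrans (e0 _) => [|h sh]; last first.
    rewrite (eig h sh) (mul0r (rell h)) subr0.
    have ch := prim_continuous (within_continuous_intble (prim_continuous (sqint_intble sh))).
    apply: etrans (esym (primZ lam (within_continuous_intble (within_continuousM cu0 ch)))) _.
    by apply: eq_prim => x _; exact: mulrA.
  have lt f : intble L f -> forall x, 0 <= x <= L -> tail L (fun y => lam * f y) x = lam * tail L f x.
    move=> fi x /andP[x0 xL]; rewrite /tail !primZ // ?mulrBr //.
    exact: intble_sub fi.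
  apply: eq_prim => x /andP[x0 xL]; have xL' : 0 <= x <= L by rewrite !ltW.
  have -> : tail L (tail L (fun y => lam * u y)) x = lam * tail L (tail L u) x.
    rewrite -lt // /tail; congr (_ - _); apply: eq_prim => y /andP[y0 yL].
      by rewrite -/(tail L _ y) lt // !ltW.
    by rewrite -/(tail L _ y) lt // ltW //= (le_trans (ltW yL)) // ltW.
  by rewrite mul0r subr0 /G mulVKf // lt0r_neq0.
have gG x : 0 <= x <= L -> u1 x = prim G x.
  move=> xL; have [x0 xL'] := andP xL.
  have sG := within_continuous_sqint cG; have sAG := sqintZ At sG; have sAg := sqintZ At sg.
  have := prim_sqr_le (sqintB sAg sAG) xL; rewrite e0 mulr0.
  have i1 := intble_sub xL' (sqint_intble sg); have i2 := intble_sub xL' (sqint_intble sG).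
  rewrite (primB (intbleZ At i1) (intbleZ At i2)) (primZ At i1) (primZ At i2) -mulrBr.
  rewrite real_exprn_even_le0 ?num_real //= mulf_eq0 (gt_eqF At0) /= subr_eq0 => /eqP.
  exact.
have du1 : deriv_on 0 L u1 G.
  apply: deriv_on_ext (prim_deriv_on cG) => // x xL; exact/esym/gG.
have dj : deriv_on 0 L (jop g) (fun x => c * p1 x - G x) by exact: deriv_onB (deriv_onZ c dp) du1.
pose th := c + kap / At; pose k := lam / At.
have dG : deriv_on 0 L G (fun x => At^-1 * (kap * - jop g x + lam * - tail L u x)).
  apply: deriv_onZ; apply: deriv_onD; apply: deriv_onZ; exact: deriv_on_tail.
have dj1 : deriv_on 0 L (fun x => c * p1 x - G x) (fun x => th * jop g x + k * tail L u x).
  apply: deriv_on_eq (deriv_onB (deriv_onZ c dp1) dG) _ _ => // x _.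
  rewrite -/(jop g x) /th /k; move: (jop g x) (tail L u x) => a b; field.
  exact: lt0r_neq0.
have du : deriv_on 0 L u u1 by exact: prim_deriv_on.
have dt : deriv_on 0 L (tail L u) (fun x => - u x) by exact: deriv_on_tail.
have kp : 0 < k by rewrite divr_gt0.
(* From [b1 p(L) + b3 u'(L) = 0] and [u' = c p - p''] follows [p''(L) = (c + b1 / b3) p(L)]. *)
pose K := c + b1 / b3.
have ode : eigen_ode L c th k (fun s => k * tail L u (L - s)) (fun s => k * u (L - s))
  (fun s => - jop g (L - s)) (fun s => c * p1 (L - s) - G (L - s))
  (fun s => - p (L - s)) (fun s => p1 (L - s)).
  split.
  - exact: L0.
  - exact: c0.
  - by rewrite /th ltrDl divr_gt0.
  - exact: kp.
  - by apply: deriv_on_eq (deriv_on_reflect (deriv_onZ k dt)) _ _ => // x _ /=; ring.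
  - apply: deriv_on_eq (deriv_on_reflect (deriv_onZ k du)) _ _ => // x _ /=.
    by rewrite /jop -/u1 -/p; ring.
  - by apply: deriv_on_eq (deriv_onN (deriv_on_reflect dj)) _ _ => // x _ /=; ring.
  - by apply: deriv_on_eq (deriv_on_reflect dj1) _ _ => // x _ /=; ring.
  - by apply: deriv_on_eq (deriv_onN (deriv_on_reflect dp)) _ _ => // x _ /=; ring.
  - by apply: deriv_on_eq (deriv_on_reflect dp1) _ _ => // x _ /=.
  - by rewrite subr0 tail_end mulr0.
  - by rewrite subr0 pL /G !tail_end !mulr0 addr0 mulr0 subrr.
  - by rewrite subr0.
  - by rewrite subrr /u prim0 mulr0.
  - by rewrite subrr /jop -/u1 -/p p0 /u1 prim0 mulr0 subrr oppr0.
  - by rewrite subrr p0 oppr0.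
have cK : c < K by rewrite ltrDl divr_gt0.
have WQ : - jop g (L - 0) = K * - p (L - 0).
  rewrite subr0 /jop -/u1 -/p /K; move: (l0 (lt0r_neq0 lamp)); rewrite /rell -/u1 -/p => {}l0.
  have -> : u1 L = - (b1 * p L) / b3.
    by apply/(canRL (mulfK (lt0r_neq0 b30))); move: l0; move: (u1 L) (p L) => a b; lra.
  by field; exact: lt0r_neq0.
have u0 x : 0 <= x <= L -> u x = 0.
  move=> /andP[x0 xL]; have := eigen_ode_unique ode cK WQ poin (s:=L - x).
  rewrite subr_ge0 xL gerBl x0 => /(_ isT)/eqP.
  by rewrite mulf_eq0 (gt_eqF kp) subKr => /eqP.
apply: fin; rewrite (_ : U0 = 0) ?mulr0 // /U0.
rewrite (eq_prim (g:=fun=> 0)) ?prim_cst ?mul0r // => x /andP[x0 xL].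
by rewrite -/u u0 ?expr0n // !ltW.
Qed.

End Eigen.

(** * Compactness along ultrafilters *)

(** A primitive of a square integrable function is Hoelder continuous of exponent 1/2, with a
    constant governed by the [L^2] norm: the equicontinuity behind all compactness below. *)
Lemma prim_diff_sqr_le {R : realType} (L : R) f x y : sqint L f -> 0 <= x -> x <= y -> y <= L ->
  (prim f y - prim f x) ^+ 2 <= (y - x) * prim (fun t => f t ^+ 2) L.
Proof.
move=> sf x0 xy yL; have y0 := le_trans x0 xy; have L0 := le_trans y0 yL.
have [_ f2] := sf; have f1 := sqint_intble sf.
have mono g : intble L g -> (forall t, 0 <= g t) -> forall a b, 0 <= a -> a <= b -> b <= L ->
    prim g a <= prim g b.
  move=> gi g0 a b a0 ab bL; rewrite -subr_ge0 -(prim_split (intble_sub bL gi)) ?a0 //.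
  exact: Rintegral_ge0.
apply: (@le_trans _ _ ((y - x) * (prim (fun t => f t ^+ 2) y - prim (fun t => f t ^+ 2) x))).
  rewrite mulrC; apply: quadratic_discriminant; rewrite ?subr_ge0 //.
    by apply: mono => // t; exact: sqr_ge0.
  move=> e; have i1 := intbleZ (2 * e) f1; have i2 := intbleD f2 i1.
  have i3 := within_continuous_intble (@within_continuous_cst R 0 L (e ^+ 2)); have i4 := intbleD i2 i3.
  have h : 0 <= prim (fun t => f t ^+ 2 + 2 * e * f t + e ^+ 2) y
                - prim (fun t => f t ^+ 2 + 2 * e * f t + e ^+ 2) x.
    rewrite subr_ge0; apply: mono => // t.
    by rewrite (_ : _ + _ = (f t + e) ^+ 2) ?sqr_ge0 //; ring.
  have E z : 0 <= z -> z <= L -> prim (fun t => f t ^+ 2 + 2 * e * f t + e ^+ 2) z =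
      prim (fun t => f t ^+ 2) z + 2 * e * prim f z + e ^+ 2 * z.
    move=> z0 zL; rewrite (primD (intble_sub zL i2) (intble_sub zL i3)) prim_cst //.
    by rewrite (primD (intble_sub zL f2) (intble_sub zL i1)) (primZ _ (intble_sub zL f1)).
  move: h; rewrite (E y) // (E x) // ?(le_trans xy) //.
  move: (prim _ _) (prim _ _) (prim _ _) (prim _ _) => *; lra.
rewrite ler_wpM2l ?subr_ge0 // lerBlDl.
apply: le_trans (_ : _ <= prim (fun t => f t ^+ 2) L) _; first by apply: mono => // t; exact: sqr_ge0.
by rewrite lerDr; exact: prim_sqr_ge0.
Qed.

Section UltraCauchy.
Context {R : realType} (U : set_system nat) {UU : UltraFilter U}.
Implicit Types (L e C k : R) (f g : nat -> R -> R) (s : nat -> R).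

(** A finite cover of the indices has a member in the ultrafilter. *)
Lemma ultra_pick (N : nat) (P : nat -> set nat) :
  (forall n, exists2 i, (i < N)%N & P i n) -> exists2 i, (i < N)%N & U (P i).
Proof.
move=> hP; apply: contrapT => nP.
have hM M : (M <= N)%N -> U [set n | forall i, (i < M)%N -> ~ P i n].
  elim: M => [_|M IH MN]; first by apply: filterS filterT => n _ i.
  have uM : U (~` P M).
    by have [uM|//] := in_ultra_setVsetC (P M) UU; exfalso; apply: nP; exists M.
  apply: filterS (filterI (IH (ltnW MN)) uM) => n [h1 h2] i.
  by rewrite ltnS leq_eqVlt => /predU1P[->|]; [exact: h2|exact: h1].
have [n hn] := filter_ex (hM N (leqnn N)).
by have [i iN] := hP n; exact: hn.
Qed.

Lemma ultra_forall_lt (N : nat) (Q : nat -> nat -> nat -> Prop) :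
  (forall j, (j < N)%N -> exists2 A, U A & forall m n, A m -> A n -> Q j m n) ->
  exists2 A, U A & forall j m n, (j < N)%N -> A m -> A n -> Q j m n.
Proof.
elim: N => [|N IH] h; first by exists setT => //; exact: filterT.
have [|A uA hA] := IH; first by move=> j jN; apply: h; exact: ltnW.
have [|B uB hB] := h N; first exact: ltnSn.
exists (A `&` B); first exact: filterI.
move=> j m n; rewrite ltnS leq_eqVlt => /predU1P[->|jN] [Am Bm] [An Bn]; first exact: hB.
exact: hA.
Qed.

(** Uniform Cauchy property along the ultrafilter. Bounded sequences have it at once, so compactness
    statements can be added and combined without extracting successive subsequences. *)
Definition ucauchy L f := forall e, 0 < e -> exists2 A, U A &
  forall m n x, A m -> A n -> 0 <= x <= L -> `|f m x - f n x| <= e.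

Lemma ucauchy_bounded L s C : (forall n, `|s n| <= C) -> ucauchy L (fun n _ => s n).
Proof.
move=> sC e e0; pose N := (Num.truncn ((C + C) / e)).+1.
pose P i := [set n | s n + C \in `[i%:R * e, i.+1%:R * e] ].
have C0 : 0 <= C := le_trans (normr_ge0 _) (sC 0%N).
have [|i _ uP] := @ultra_pick N P.
  move=> n; have := sC n; rewrite ler_norml => /andP[h1 h2].
  have h0 : 0 <= (s n + C) / e by rewrite divr_ge0 ?(ltW e0) // -lerBlDr sub0r.
  exists (Num.truncn ((s n + C) / e)).
    rewrite ltnS; apply: le_truncn.
    by rewrite ler_pM2r ?invr_gt0 // lerD2r.
  have /andP[t1 t2] := truncn_itv h0.
  by rewrite /P /= in_itv /= -ler_pdivlMr // t1 -ler_pdivrMr // ltW.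
exists (P i) => // m n x; rewrite /P /= !in_itv /= -[i.+1]addn1 natrD mulrDl mul1r.
move: (i%:R * e) (s m) (s n) => a b d /andP[m1 m2] /andP[n1 n2] _.
by rewrite ler_norml; apply/andP; split; lra.
Qed.

Lemma ucauchyD L f g : ucauchy L f -> ucauchy L g -> ucauchy L (fun n x => f n x + g n x).
Proof.
move=> hf hg e e0; have e2 : 0 < e / 2 by rewrite divr_gt0.
have [A uA hA] := hf _ e2; have [B uB hB] := hg _ e2.
exists (A `&` B); first exact: filterI.
move=> m n x [Am Bm] [An Bn] xL; rewrite opprD addrACA.
apply: le_trans (ler_normD _ _) _; rewrite [leRHS]splitr lerD //; [exact: hA|exact: hB].
Qed.

Lemma ucauchyM L f (G : R -> R) C : (forall x, 0 <= x <= L -> `|G x| <= C) ->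
  ucauchy L f -> ucauchy L (fun n x => f n x * G x).
Proof.
move=> GC hf e e0; have C1 : 0 < `|C| + 1 by rewrite ltr_wpDl.
have [A uA hA] := hf (e / (`|C| + 1)) (divr_gt0 e0 C1).
exists A => // m n x Am An xL; rewrite -mulrBl normrM.
have := hA m n x Am An xL; rewrite ler_pdivlMr //; apply: le_trans.
by rewrite ler_wpM2l // (le_trans (GC _ xL)) // (le_trans (ler_norm C)) // lerDl.
Qed.

Lemma ucauchyZ L f k : ucauchy L f -> ucauchy L (fun n x => k * f n x).
Proof.
move=> hf; have := @ucauchyM L f (fun=> k) `|k| (fun _ _ => lexx _) hf.
by congr (ucauchy L _); apply/funext => n; apply/funext => x; rewrite mulrC.
Qed.

(** Arzela-Ascoli: the primitives are equicontinuous, so their values on a finite grid determine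
    them up to [2 e / 3], and each grid value is a bounded sequence of numbers. *)
Lemma ucauchy_prim L f C : 0 < L -> (forall n, sqint L (f n)) ->
  (forall n, prim (fun x => f n x ^+ 2) L <= C) -> ucauchy L (fun n => prim (f n)).
Proof.
move=> L0 sf fC e e0; have C0 : 0 <= C := le_trans (prim_sqr_ge0 _ _) (fC 0%N).
have C1 : 0 < C + 1 by rewrite ltr_wpDl.
(* A grid step over which Hoelder continuity allows a variation of at most [e / 3]. *)
pose d := (e / 3) ^+ 2 / (C + 1); have e3 : 0 < e / 3 by rewrite divr_gt0.
have d0 : 0 < d by rewrite divr_gt0 // exprn_gt0.
have near_pt n x y : 0 <= x -> x <= y -> y <= L -> y - x <= d -> `|prim (f n) y - prim (f n) x| <= e / 3.
  move=> x0 xy yL xyd; rewrite -(@ler_pXn2r _ 2) ?nnegrE ?normr_ge0 ?(ltW e3) //.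
  rewrite real_normK ?num_real //; apply: le_trans (prim_diff_sqr_le (sf n) x0 xy yL) _.
  apply: le_trans (_ : _ <= d * (C + 1)) _; last by rewrite /d divfK ?lt0r_neq0.
  apply: ler_pM => //; rewrite ?subr_ge0 ?prim_sqr_ge0 // (le_trans (fC n)) //.
  by rewrite lerDl.
pose N := (Num.truncn (L / d)).+1.
pose Q (j m n : nat) := j%:R * d <= L -> `|prim (f m) (j%:R * d) - prim (f n) (j%:R * d)| <= e / 3.
have [|A uA hA] := @ultra_forall_lt N Q.
  move=> j jN; have [jL|jL] := leP (j%:R * d) L; last first.
    by exists setT; [exact: filterT|move=> m n _ _; rewrite /Q leNgt jL].
  have jd0 : 0 <= j%:R * d by rewrite mulr_ge0 // ltW.
  have bd n : `|prim (f n) (j%:R * d)| <= L * C + 1.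
    have LC : 0 <= L * C by rewrite mulr_ge0 // ltW.
    rewrite -(@ler_pXn2r _ 2) ?nnegrE ?normr_ge0 ?addr_ge0 //.
    rewrite real_normK ?num_real //.
    have jin : 0 <= j%:R * d <= L by rewrite jd0.
    apply: le_trans (prim_sqr_le (sf n) jin) _.
    apply: le_trans (_ : _ <= L * C) _; first by apply: ler_pM => //; exact: prim_sqr_ge0.
    by move: (L * C) LC => a a0; nra.
  have [B uB hB] := ucauchy_bounded L bd e3.
  exists B => // m n Bm Bn _; apply: (hB m n 0) => //.
  by rewrite lexx ltW.
exists A => // m n x Am An /andP[x0 xL].
have h0 : 0 <= x / d by rewrite divr_ge0 // ltW.
have /andP[t1 t2] := truncn_itv h0; set j := Num.truncn (x / d) in t1 t2.
have jx : j%:R * d <= x by rewrite -ler_pdivlMr.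
have jd : x - j%:R * d <= d.
  by move: t2; rewrite -addn1 natrD ltr_pdivrMr // mulrDl mul1r; lra.
have jN : (j < N)%N by rewrite ltnS; apply: le_truncn; rewrite ler_pM2r // invr_gt0.
have jd0 : 0 <= j%:R * d by rewrite mulr_ge0 // ltW.
have h1 := hA j m n jN Am An (le_trans jx xL).
have h2 := near_pt m _ _ jd0 jx xL jd; have h3 := near_pt n _ _ jd0 jx xL jd.
move: h1 h2 h3; move: (prim (f m) _) (prim (f n) _) (prim (f m) _) (prim (f n) _) => a b a' b'.
rewrite !ler_norml => /andP[? ?] /andP[? ?] /andP[? ?]; apply/andP; split; lra.
Qed.

Lemma ucauchy_tail L f C : 0 < L -> (forall n, sqint L (f n)) ->
  (forall n, prim (fun x => f n x ^+ 2) L <= C) -> ucauchy L (fun n => tail L (f n)).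
Proof.
move=> L0 sf fC e e0; have e2 : 0 < e / 2 by rewrite divr_gt0.
have [A uA hA] := ucauchy_prim L0 sf fC e2.
exists A => // m n x Am An xL; rewrite /tail.
have LL : 0 <= L <= L by rewrite lexx ltW.
have := hA m n L Am An LL; have := hA m n x Am An xL.
move: (prim _ _) (prim _ _) (prim _ _) (prim _ _) => a b a' b'.
rewrite !ler_norml => /andP[? ?] /andP[? ?]; apply/andP; split; lra.
Qed.

Lemma tail_sqr_bounded L (f : R -> R) C : 0 < L -> sqint L f -> prim (fun x => f x ^+ 2) L <= C ->
  prim (fun x => tail L f x ^+ 2) L <= L * C * L.
Proof.
move=> L0 sf fC; have C0 : 0 <= C := le_trans (prim_sqr_ge0 _ _) fC.
have ct := tail_continuous (sqint_intble sf).
rewrite -(prim_cst _ (ltW L0)); apply: prim_le.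
- exact: within_continuous_intble (within_continuousM ct ct).
- exact: within_continuous_intble (@within_continuous_cst R 0 L _).
- move=> x /andP[x0 xL]; apply: le_trans (prim_diff_sqr_le sf (ltW x0) (ltW xL) (lexx L)) _.
  apply: ler_pM => //; [by rewrite subr_ge0 ltW|exact: prim_sqr_ge0|].
  by rewrite gerBl ltW.
Qed.

(** Returns from the ultrafilter to a genuine subsequence. The [n]-th index is taken in finitely
    many sets of the ultrafilter and beyond [n]; the latter is possible because the ultrafilter
    refines the filter at infinity. *)
Lemma ucauchy_subseq (q : nat -> nat -> R) : \oo `<=` U ->
  (forall e, 0 < e -> exists2 A, U A & forall m n, A m -> A n -> q m n <= e) ->
  exists2 k : nat -> nat, (forall n, (n <= k n)%N) &
  forall e, 0 < e -> exists N : nat, forall m n, (N <= m)%N -> (N <= n)%N -> q (k m) (k n) <= e.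
Proof.
move=> Uoo hq.
have hj (j : nat) : {A | U A & forall m n, A m -> A n -> q m n <= (j.+1%:R)^-1}.
  by apply: cid2; apply: hq; rewrite invr_gt0.
pose A j := s2val (hj j).
have hk n : {i : nat | (n <= i)%N & forall j, (j <= n)%N -> A j i}.
  apply: cid2.
  have uA : U [set i | forall j, (j <= n)%N -> A j i].
    elim: n => [|n IH].
      by apply: filterS (s2valP (hj 0%N)) => i Ai j; rewrite leqn0 => /eqP ->.
    apply: filterS (filterI IH (s2valP (hj n.+1))) => i [h1 h2] j.
    by rewrite leq_eqVlt => /predU1P[->//|]; exact: h1.
  have un : U [set i | (n <= i)%N] by apply: Uoo; exists n.
  by have [i [h1 h2]] := filter_ex (filterI uA un); exists i.
exists (fun n => s2val (hk n)) => [n|e e0]; first exact: s2valP (hk n).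
have [N hN] := inv_succ_small e0; exists N => m n Nm Nn.
apply: le_trans (ltW (hN N (leqnn N))).
by apply: (s2valP' (hj N)); [apply: (s2valP' (hk m))|apply: (s2valP' (hk n))].
Qed.

End UltraCauchy.

(** * The beam in terms of real and imaginary parts *)

Section ComplexParts.
Context {R : realType}.
Implicit Types (x y : R[i]) (k : R).

Lemma cReD x y : complex.Re (x + y) = complex.Re x + complex.Re y.
Proof. by case: x y => [a b] [c d]. Qed.

Lemma cImD x y : complex.Im (x + y) = complex.Im x + complex.Im y.
Proof. by case: x y => [a b] [c d]. Qed.

Lemma cReN x : complex.Re (- x) = - complex.Re x.
Proof. by case: x. Qed.

Lemma cImN x : complex.Im (- x) = - complex.Im x.
Proof. by case: x. Qed.

Lemma cReM x y : complex.Re (x * y) =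
  complex.Re x * complex.Re y - complex.Im x * complex.Im y.
Proof. by case: x y => [a b] [c d]. Qed.

Lemma cImM x y : complex.Im (x * y) =
  complex.Re x * complex.Im y + complex.Im x * complex.Re y.
Proof. by case: x y => [a b] [c d]. Qed.

Lemma cReZ k x : complex.Re (k%:C%C * x) = k * complex.Re x.
Proof. by rewrite cReM mul0r subr0. Qed.

Lemma cImZ k x : complex.Im (k%:C%C * x) = k * complex.Im x.
Proof. by rewrite cImM mul0r addr0. Qed.

Lemma cReJ x : complex.Re (Num.conj x) = complex.Re x.
Proof. by case: x. Qed.

Lemma cImJ x : complex.Im (Num.conj x) = - complex.Im x.
Proof. by case: x. Qed.

Lemma cRe_form k l (p q r s : R[i]) :
  complex.Re (k%:C%C * p * Num.conj q - l%:C%C * r * Num.conj s) =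
  k * (complex.Re p * complex.Re q + complex.Im p * complex.Im q)
  - l * (complex.Re r * complex.Re s + complex.Im r * complex.Im s).
Proof. by case: p q r s => [p p'] [q q'] [r r'] [s s'] /=; ring. Qed.

Lemma cIm_form k l (p q r s : R[i]) :
  complex.Im (k%:C%C * p * Num.conj q - l%:C%C * r * Num.conj s) =
  k * (complex.Im p * complex.Re q - complex.Re p * complex.Im q)
  - l * (complex.Im r * complex.Re s - complex.Re r * complex.Im s).
Proof. by case: p q r s => [p p'] [q q'] [r r'] [s s'] /=; ring. Qed.

Lemma complex_ext x y : complex.Re x = complex.Re y -> complex.Im x = complex.Im y -> x = y.
Proof. by case: x y => [a b] [c d] /= -> ->. Qed.

End ComplexParts.

Definition reF {R : realType} (f : R -> R[i]) (x : R) : R := complex.Re (f x).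
Definition imF {R : realType} (f : R -> R[i]) (x : R) : R := complex.Im (f x).
Definition cfun {R : realType} (g h : R -> R) (x : R) : R[i] := Complex (g x) (h x).

Definition aeq {R : realType} (L : R) (f g : R -> R) : Prop :=
  {ae leb R, forall x, x \in `]0, L[ -> f x = g x}.

(* [H2_derivatives] for a real-valued function. *)
Definition h2 {R : realType} (L : R) (f f1 f2 : R -> R) : Prop :=
  [/\ forall x, 0 <= x <= L -> f x = f 0 + prim f1 x,
      forall x, 0 <= x <= L -> f1 x = f1 0 + prim f2 x & sqint L f2].

Section RealH2.
Context {R : realType}.
Implicit Types (L x k : R) (f g h : R -> R).

Lemma intbleB L f g : intble L f -> intble L g -> intble L (fun x => f x - g x).
Proof.
move=> fi gi; have := intbleD fi (intbleZ (-1) gi).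
by congr (intble L _); apply/funext => x; ring.
Qed.

Lemma aeq_sym L f g : aeq L f g -> aeq L g f.
Proof.
by apply: ae_filterS => x h xL; rewrite h.
Qed.

Lemma aeq_trans L f g h : aeq L f g -> aeq L g h -> aeq L f h.
Proof.
move=> fg gh; apply: ae_filterS (ae_filterI fg gh) => x [h1 h2] xL.
by rewrite h1 // h2.
Qed.

Lemma aeq_prim L f g x : intble L f -> intble L g -> aeq L f g -> 0 <= x <= L ->
  prim f x = prim g x.
Proof.
move=> fi gi fg /andP[x0 xL]; apply: ae_eq_prim; [exact: intble_sub fi|exact: intble_sub gi|].
apply: ae_filterS fg => y h yx; apply: h.
by move: yx; rewrite !in_itv /= => /andP[-> yx]; exact: lt_le_trans yx xL.
Qed.

Lemma prim_aeq L f g : intble L f -> intble L g ->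
  (forall x, 0 <= x <= L -> prim f x = prim g x) -> aeq L f g.
Proof.
move=> fi gi fg; have := prim_eq0_ae (intbleB fi gi).
have h x : 0 <= x <= L -> prim (fun y => f y - g y) x = 0.
  move=> xL; have [x0 xL'] := andP xL.
  by rewrite (primB (intble_sub xL' fi) (intble_sub xL' gi)) fg // subrr.
move=> /(_ h); apply: ae_filterS => x e xL.
by apply/eqP; rewrite -subr_eq0 e.
Qed.

Lemma prim_inj_continuous L f g : 0 < L -> {within `[0, L], continuous f} ->
  {within `[0, L], continuous g} -> (forall x, 0 <= x <= L -> prim f x = prim g x) ->
  forall x, 0 <= x <= L -> f x = g x.
Proof.
move=> L0 cf cg fg.
have cF := within_continuous_sub cf cg; set F := (fun x => f x - g x) in cF.
have dP : deriv_on 0 L (fun=> 0) F.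
  apply: deriv_on_ext (deriv_onB (prim_deriv_on cf) (prim_deriv_on cg)) => // x xL.
  by rewrite fg // subrr.
have F0 x : 0 < x < L -> F x = 0.
  move=> xL; have [_ /(_ x xL) d1] := dP.
  have := @derive_val _ _ _ _ _ _ _ d1.
  by rewrite (@derive_val _ _ _ _ _ _ _ (is_derive_cst 0 x 1)).
have dF : deriv_on 0 L F (fun=> 0).
  have dz := deriv_on_cst 0 L (0 : R); split=> // x xL.
  have [_ /(_ x xL)] := dz; apply: near_eq_is_derive.
  have xL' : x \in `]0, L[ by rewrite in_itv.
  by apply: filterS (near_in_itvoo xL') => z; rewrite in_itv/= => /F0 ->.
have mid : 0 < L / 2 < L by rewrite divr_gt0 //= ltr_pdivrMr // ltr_pMr // ltr1n.
move=> x xL; apply/eqP; rewrite -subr_eq0 -/(F x); apply/eqP.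
rewrite -(F0 _ mid); apply: deriv_on_const dF _ xL _ => //.
by have /andP[m1 m2] := mid; rewrite !ltW.
Qed.

Lemma h2_continuous L f f1 f2 : h2 L f f1 f2 -> {within `[0, L], continuous f1}.
Proof.
move=> [_ e1 s2]; have c := within_continuous_add (@within_continuous_cst R 0 L (f1 0))
  (prim_continuous (sqint_intble s2)).
apply: subspace_eq_continuous c => x; rewrite inE /= in_itv /= => xL.
exact/esym/e1.
Qed.

(** Makes the choice in [Dx] and [Dxx] harmless: the first derivative is continuous and hence
    determined pointwise, the second almost everywhere. *)
Lemma h2_uniq L f f1 f2 g1 g2 : 0 < L -> h2 L f f1 f2 -> h2 L f g1 g2 ->
  (forall x, 0 <= x <= L -> f1 x = g1 x) /\ aeq L f2 g2.
Proof.
move=> L0 hf hg; have cf := h2_continuous hf; have cg := h2_continuous hg.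
have [e1 e2 s2] := hf; have [e1' e2' s2'] := hg.
have eq1 : forall x, 0 <= x <= L -> f1 x = g1 x.
  apply: prim_inj_continuous => // x xL.
  by have := e1 x xL; rewrite e1' // => /addrI.
split=> //; apply: prim_aeq; [exact: sqint_intble|exact: sqint_intble|] => x xL.
have z : 0 <= (0 : R) <= L by rewrite lexx ltW.
by have := e2 x xL; rewrite eq1 // e2' // eq1 // => /addrI.
Qed.

End RealH2.

Section ComplexH2.
Context {R : realType} (L : R) (L0 : 0 < L).
Implicit Types (x k : R) (f g u v psi : R -> R[i]).

Lemma L2P f : L2 L f <-> sqint L (reF f) /\ sqint L (imF f).
Proof.
split=> [[m1 m2 i]|[[m1 i1] [m2 i2]]]; last by split=> //; exact: (intbleD i1 i2).
split; split=> //.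
- apply: intble_le i _ => [|x _]; first by apply: measurable_funM.
  by rewrite ger0_norm ?sqr_ge0 // lerDl sqr_ge0.
- apply: intble_le i _ => [|x _]; first by apply: measurable_funM.
  by rewrite ger0_norm ?sqr_ge0 // lerDr sqr_ge0.
Qed.

Lemma ae_equalP f g : ae_equal L f g <-> aeq L (reF f) (reF g) /\ aeq L (imF f) (imF g).
Proof.
split=> [fg|[h1 h2]].
  by split; apply: ae_filterS fg => x e xL;
     rewrite /reF /imF e.
apply: ae_filterS (ae_filterI h1 h2) => x [e1 e2] xL.
by apply: complex_ext; [exact: e1|exact: e2].
Qed.

Lemma H2_derivativesP psi p : H2_derivatives L psi p <->
  h2 L (reF psi) (reF p.1) (reF p.2) /\ h2 L (imF psi) (imF p.1) (imF p.2).
Proof.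
split=> [[e1 e2 /L2P[s1 s2]]|[[e1 e2 s] [e1' e2' s']]].
  split; split=> // x xL.
  - by rewrite /reF e1 ?in_itv // cReD.
  - by rewrite /reF e2 ?in_itv // cReD.
  - by rewrite /imF e1 ?in_itv // cImD.
  - by rewrite /imF e2 ?in_itv // cImD.
split; last exact/L2P.
- move=> x; rewrite in_itv => xL; apply: complex_ext.
    by rewrite cReD; exact: e1.
  by rewrite cImD; exact: e1'.
- move=> x; rewrite in_itv => xL; apply: complex_ext.
    by rewrite cReD; exact: e2.
  by rewrite cImD; exact: e2'.
Qed.

Lemma Dx_Dxx_spec psi : H2 L psi -> H2_derivatives L psi (Dx L psi, Dxx L psi).
Proof.
move=> [p hp]; have := @xgetPex _ (0, 0) (H2_derivatives L psi) (ex_intro _ p hp).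
by rewrite [xget _ _]surjective_pairing.
Qed.

Lemma H2P psi : H2 L psi -> h2 L (reF psi) (reF (Dx L psi)) (reF (Dxx L psi)) /\
  h2 L (imF psi) (imF (Dx L psi)) (imF (Dxx L psi)).
Proof. by move=> /Dx_Dxx_spec/H2_derivativesP. Qed.

Lemma H2_intro psi (f1 f2 g1 g2 : R -> R) : h2 L (reF psi) f1 f2 -> h2 L (imF psi) g1 g2 ->
  [/\ H2 L psi, forall x, 0 <= x <= L -> reF (Dx L psi) x = f1 x,
      forall x, 0 <= x <= L -> imF (Dx L psi) x = g1 x,
      aeq L (reF (Dxx L psi)) f2 & aeq L (imF (Dxx L psi)) g2].
Proof.
move=> hf hg; have H : H2 L psi by exists (cfun f1 g1, cfun f2 g2); apply/H2_derivativesP.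
have [hr hi] := H2P H; have [r1 r2] := h2_uniq L0 hr hf; have [i1 i2] := h2_uniq L0 hi hg.
by split.
Qed.

End ComplexH2.

Definition Pcoef {R : realType} (b : beam R) : R := beam_varsigma b * Ctilde b.
Definition kappa {R : realType} (b : beam R) : R :=
  beam_gamma b * beam_beta b * beam_varsigma b * beam_h2 b * beam_h3 b * Btilde b ^+ 2.
Definition ellcoef {R : realType} (b : beam R) : R :=
  beam_varsigma b * beam_h2 b * beam_h3 b * Btilde b * beam_B2 b.
Definition gain {R : realType} (b : beam R) (k1 : R) : R := k1 * beam_gamma b / beam_B4 b.

(** * The beam operators on V, by real and imaginary parts *)

Section Beam.
Context {R : realType} (b : beam R).
Hypotheses (hL : 0 < beam_len b) (hc : 0 < Pcoef b).
Implicit Types (x k : R) (f u v psi : R -> R[i]).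

Notation L := (beam_len b).
Notation c := (Pcoef b).
Notation kap := (kappa b).
Notation b1 := (ellcoef b).

Definition rdd u : R -> R := reF (Dxx L u).
Definition idd u : R -> R := imF (Dxx L u).

Lemma deriv_on_prim (M : R) (g g' : R -> R) : deriv_on 0 M g g' -> {within `[0, M], continuous g'} ->
  forall x, 0 <= x <= M -> g x = g 0 + prim g' x.
Proof.
move=> dg cg' x /andP[x0 xM]; rewrite (@prim_FTC R x g g') //; first by rewrite subrKC.
  exact: deriv_on_sub dg.
by apply: continuous_subspaceW cg'; apply: subset_itvl; rewrite bnd_simp.
Qed.

Lemma Vspace_parts u : Vspace b u ->
  [/\ sqint L (rdd u), sqint L (idd u),
      forall x, 0 <= x <= L -> reF (Dx L u) x = prim (rdd u) x
        /\ imF (Dx L u) x = prim (idd u) x &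
      forall x, 0 <= x <= L -> reF u x = prim (prim (rdd u)) x
        /\ imF u x = prim (prim (idd u)) x].
Proof.
move=> [/H2P[[e1 e2 s] [e1' e2' s']] u0 d0].
have r0 : reF (Dx L u) 0 = 0 by rewrite /reF d0.
have i0 : imF (Dx L u) 0 = 0 by rewrite /imF d0.
have D x : 0 <= x <= L -> reF (Dx L u) x = prim (rdd u) x /\ imF (Dx L u) x = prim (idd u) x.
  by move=> xL; rewrite e2 // e2' // r0 i0 !add0r.
split=> // x xL; rewrite e1 // e1' // /reF /imF u0 /= !add0r.
by have /andP[x0 xL'] := xL; split; apply: eq_prim => y /andP[y0 yx];
   have /D[] : 0 <= y <= L by rewrite (ltW y0) (le_trans (ltW yx)).
Qed.

Lemma Vspace_intro u (g h : R -> R) : sqint L g -> sqint L h ->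
  (forall x, 0 <= x <= L -> reF u x = prim (prim g) x) ->
  (forall x, 0 <= x <= L -> imF u x = prim (prim h) x) ->
  [/\ Vspace b u, aeq L (rdd u) g & aeq L (idd u) h].
Proof.
move=> sg sh eg eh; have z : 0 <= (0 : R) <= L by rewrite lexx ltW.
have hg : h2 L (reF u) (prim g) g.
  by split=> // x xL; rewrite ?prim0 ?add0r // eg // (eg 0) // prim0 add0r.
have hh : h2 L (imF u) (prim h) h.
  by split=> // x xL; rewrite ?prim0 ?add0r // eh // (eh 0) // prim0 add0r.
have [H r i ar ai] := H2_intro hL hg hh; split=> //; split=> //.
  by apply: complex_ext; [have := eg 0 z|have := eh 0 z]; rewrite prim0.
by apply: complex_ext; [have := r 0 z|have := i 0 z]; rewrite prim0.
Qed.

Lemma prim_prim_comb k (g g' : R -> R) x : sqint L g -> sqint L g' -> 0 <= x <= L ->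
  prim (prim (fun y => g y + k * g' y)) x = prim (prim g) x + k * prim (prim g') x.
Proof.
move=> sg sg' /andP[x0 xL]; have ig := sqint_intble sg; have ig' := sqint_intble sg'.
have jg := intble_sub xL (within_continuous_intble (prim_continuous ig)).
have jg' := intble_sub xL (within_continuous_intble (prim_continuous ig')).
apply: etrans (_ : prim (fun y => prim g y + k * prim g' y) x = _).
  apply: eq_prim => y /andP[y0 yx]; have yL := le_trans (ltW yx) xL.
  by rewrite (primD (intble_sub yL ig) (intbleZ k (intble_sub yL ig'))) (primZ _ (intble_sub yL ig')).
by rewrite (primD jg (intbleZ k jg')) (primZ _ jg').
Qed.

Lemma Vspace_comb k u v w : Vspace b u -> Vspace b v -> (forall x, w x = u x + k%:C%C * v x) ->
  [/\ Vspace b w, aeq L (rdd w) (fun x => rdd u x + k * rdd v x) &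
      aeq L (idd w) (fun x => idd u x + k * idd v x)].
Proof.
move=> /Vspace_parts[su su' _ eu] /Vspace_parts[sv sv' _ ev] ew.
apply: Vspace_intro => [||x xL|x xL]; try by apply: sqintD => //; exact: sqintZ.
  rewrite prim_prim_comb // /reF ew cReD cReZ.
  by have [<- _] := eu x xL; have [<- _] := ev x xL.
rewrite prim_prim_comb // /imF ew cImD cImZ.
by have [_ <-] := eu x xL; have [_ <-] := ev x xL.
Qed.

(** For continuous data an equation holding almost everywhere in the [H^2] sense holds classically,
    since [psi_x] is the primitive of a continuous function. *)
Lemma Pop_graph_helm f psi : {within `[0, L], continuous (reF f)} ->
  {within `[0, L], continuous (imF f)} -> Pop_graph b f psi ->
  helm c L (reF f) (reF psi) (reF (Dx L psi)) /\ helm c L (imF f) (imF psi) (imF (Dx L psi)).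
Proof.
move=> cr ci [/H2P[hr hi] p0 dL /ae_equalP[ar ai]].
have key (q q1 q2 g : R -> R) : {within `[0, L], continuous g} -> h2 L q q1 q2 ->
    aeq L (fun x => c * q x - q2 x) g -> q 0 = 0 -> q1 L = 0 -> helm c L g q q1.
  move=> cg hq aq q0 qL; have cq1 := h2_continuous hq; have [e1 e2 s2] := hq.
  have dq : deriv_on 0 L q q1.
    have d := deriv_onD (deriv_on_cst 0 L (q 0)) (prim_deriv_on cq1).
    by apply: deriv_on_ext d => [x xL|x _]; [exact/esym/e1|exact: add0r].
  have cq := deriv_on_within_continuous dq.
  have cG := within_continuous_sub (within_continuousZ (k:=c) cq) cg.
  split=> //.
  have d := deriv_onD (deriv_on_cst 0 L (q1 0)) (prim_deriv_on cG).
  apply: deriv_on_ext d => [x xL|x _]; last exact: add0r.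
  apply/esym; apply: etrans (e2 x xL) _; congr (_ + _).
  apply: (aeq_prim (L:=L)) => //; [exact: sqint_intble|exact: within_continuous_intble|].
  apply: ae_filterS aq => y e yL.
  by rewrite -(e yL); ring.
split; [apply: key cr hr _ _ _|apply: key ci hi _ _ _].
- by apply: aeq_trans ar; apply: aeW => x _; rewrite /reF cReD cReN cReZ.
- by rewrite /reF p0.
- by rewrite /reF dL.
- by apply: aeq_trans ai; apply: aeW => x _; rewrite /imF cImD cImN cImZ.
- by rewrite /imF p0.
- by rewrite /imF dL.
Qed.

(** The explicit solution inhabits the graph, so the chosen value of [Pop] is a genuine solution;
    uniqueness of the classical problem identifies the two on [[0, L]]. *)
Lemma Pop_hsol f : {within `[0, L], continuous (reF f)} -> {within `[0, L], continuous (imF f)} ->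
  forall x, 0 <= x <= L ->
  reF (Pop b f) x = hsol c L (reF f) x /\ imF (Pop b f) x = hsol c L (imF f) x.
Proof.
move=> cr ci; have hr := hsolP hc hL cr; have hi := hsolP hc hL ci.
have h2h (g : R -> R) : {within `[0, L], continuous g} ->
    h2 L (hsol c L g) (hsol1 c L g) (fun x => c * hsol c L g x - g x).
  move=> cg; have [d d1 _ _] := hsolP hc hL cg.
  have cj := within_continuous_sub (within_continuousZ (k:=c) (deriv_on_within_continuous d)) cg.
  have c1 := deriv_on_within_continuous d1.
  by split; [exact: deriv_on_prim|exact: deriv_on_prim|exact: within_continuous_sqint].
have ex : exists psi, Pop_graph b f psi.
  exists (cfun (hsol c L (reF f)) (hsol c L (imF f))).
  have := H2_intro hL (psi:=cfun (hsol c L (reF f)) (hsol c L (imF f))) (h2h _ cr) (h2h _ ci).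
  set psi := cfun _ _ => -[H r i ar ai]; have LL : 0 <= L <= L by rewrite lexx ltW.
  have [_ _ r0 rL] := hr; have [_ _ i0 iL] := hi.
  split=> //.
  - exact: complex_ext.
  - by apply: complex_ext; [have := r L LL; rewrite rL|have := i L LL; rewrite iL].
  - apply/ae_equalP; split.
      apply: ae_filterS ar => x e xL.
      by rewrite {1}/reF cReD cReN cReZ; move: (e xL); rewrite {1}/reF => ->; rewrite /= subKr.
    apply: ae_filterS ai => x e xL.
    by rewrite {1}/imF cImD cImN cImZ; move: (e xL); rewrite {1}/imF => ->; rewrite /= subKr.
have [gr gi] := Pop_graph_helm cr ci (xgetPex 0 ex).
move=> x xL; have [-> _] := helm_uniq hc hL gr hr xL.
by have [-> _] := helm_uniq hc hL gi hi xL.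
Qed.

Lemma Vspace_Dx_continuous u : Vspace b u ->
  {within `[0, L], continuous (reF (Dx L u))} /\ {within `[0, L], continuous (imF (Dx L u))}.
Proof. by move=> [/H2P[/h2_continuous h /h2_continuous h'] _ _]. Qed.

Lemma Pop_Dx u : Vspace b u -> forall x, 0 <= x <= L ->
  reF (Pop b (Dx L u)) x = hsol c L (prim (rdd u)) x
  /\ imF (Pop b (Dx L u)) x = hsol c L (prim (idd u)) x.
Proof.
move=> Vu x xL; have [cr ci] := Vspace_Dx_continuous Vu; have [s s' D _] := Vspace_parts Vu.
have [-> ->] := Pop_hsol cr ci xL.
by split; apply: eq_hsol => //; try exact: prim_continuous (sqint_intble _); move=> y /D[].
Qed.

Lemma a_formE u v : Vspace b u -> Vspace b v -> a_form b u v =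
  Complex (alpha c L (Atilde b) kap (rdd u) (rdd v) + alpha c L (Atilde b) kap (idd u) (idd v))
          (alpha c L (Atilde b) kap (idd u) (rdd v) - alpha c L (Atilde b) kap (rdd u) (idd v)).
Proof.
move=> Vu Vv; have [s s' D _] := Vspace_parts Vu; have [t t' E _] := Vspace_parts Vv.
have P := Pop_Dx Vu.
have i0 (g h : R -> R) : sqint L g -> sqint L h ->
    intble L (fun x => Atilde b * (g x * h x) - kap * (jop c L g x * prim h x)).
  move=> sg sh; apply: intbleB; apply: intbleZ; first exact: sqint_mul.
  apply: within_continuous_intble; apply: within_continuousM; first exact: jop_continuous.
  exact: prim_continuous (sqint_intble sh).
have Jr x : 0 < x < L -> reF (Jop b (Dx L u)) x = jop c L (rdd u) x
    /\ imF (Jop b (Dx L u)) x = jop c L (idd u) x.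
  move=> /andP[x0 xL]; have xL' : 0 <= x <= L by rewrite !ltW.
  rewrite /reF /imF /Jop cReD cImD cReN cImN cReZ cImZ.
  have [d e] := D x xL'; have [p q] := P x xL'.
  by rewrite /jop -p -q -d -e.
rewrite /a_form /cintegral; apply: complex_ext => /=.
  rewrite /alpha -primD; [|exact: i0|exact: i0].
  apply: eq_prim => x xL; have [jr ji] := Jr x xL.
  have xL' : 0 <= x <= L by have /andP[x0 xL'] := xL; rewrite !ltW.
  have [er ei] := E x xL'.
  by rewrite /= cRe_form -/(kappa b) -jr -ji -er -ei /rdd /idd /reF /imF; ring.
rewrite /alpha -primB; [|exact: i0|exact: i0].
apply: eq_prim => x xL; have [jr ji] := Jr x xL.
have xL' : 0 <= x <= L by have /andP[x0 xL'] := xL; rewrite !ltW.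
have [er ei] := E x xL'.
by rewrite /= cIm_form -/(kappa b) -jr -ji -er -ei /rdd /idd /reF /imF; ring.
Qed.

Lemma ellE u : Vspace b u -> ell b u =
  Complex (rell c L b1 (beam_B3 b) (rdd u)) (rell c L b1 (beam_B3 b) (idd u)).
Proof.
move=> Vu; have LL : 0 <= L <= L by rewrite lexx ltW.
have [_ _ D _] := Vspace_parts Vu; have [d e] := D L LL; have [p q] := Pop_Dx Vu LL.
apply: complex_ext => /=; rewrite /ell.
  by rewrite cReD !cReZ /rell -d -p.
by rewrite cImD !cImZ /rell -e -q.
Qed.

End Beam.

(** * Linearity and almost everywhere invariance of the energy form *)

Section EnergyBilinear.
Context {R : realType} (c L At kap b1 b3 : R).
Hypotheses (c0 : 0 < c) (L0 : 0 < L) (At0 : 0 < At) (kap0 : 0 < kap).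
Implicit Types (x k : R) (f g h : R -> R).

Notation alpha := (alpha c L At kap).
Notation rell := (rell c L b1 b3).
Notation jop := (jop c L).

Lemma prim_comb k g h x : sqint L g -> sqint L h -> 0 <= x <= L ->
  prim (fun y => g y + k * h y) x = prim g x + k * prim h x.
Proof.
move=> sg sh /andP[x0 xL]; have ig := intble_sub xL (sqint_intble sg).
have ih := intble_sub xL (sqint_intble sh).
by rewrite (primD ig (intbleZ k ih)) (primZ k ih).
Qed.

Lemma hsol_comb k g h x : sqint L g -> sqint L h -> 0 <= x <= L ->
  hsol c L (prim (fun y => g y + k * h y)) x = hsol c L (prim g) x + k * hsol c L (prim h) x.
Proof.
move=> sg sh xL; have cg := prim_continuous (sqint_intble sg).
have ch := prim_continuous (sqint_intble sh).
have cs := within_continuous_add cg (within_continuousZ (k:=k) ch).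
have cp := prim_continuous (sqint_intble (sqintD sg (sqintZ k sh))).
rewrite -(hsolD k c0 L0 cg ch xL); apply: eq_hsol c0 L0 cp cs _ _ xL => y yL.
exact: prim_comb.
Qed.

Lemma jop_comb k g h x : sqint L g -> sqint L h -> 0 <= x <= L ->
  jop (fun y => g y + k * h y) x = jop g x + k * jop h x.
Proof.
move=> sg sh xL; rewrite /jop (hsol_comb k sg sh xL) (prim_comb k sg sh xL).
move: (hsol c L (prim g) x) (hsol c L (prim h) x) (prim g x) (prim h x) => *; ring.
Qed.

Lemma rell_comb k g h : sqint L g -> sqint L h ->
  rell (fun y => g y + k * h y) = rell g + k * rell h.
Proof.
move=> sg sh; have LL : 0 <= L <= L by rewrite lexx ltW.
rewrite /rell (hsol_comb k sg sh LL) (prim_comb k sg sh LL).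
move: (hsol c L (prim g) L) (hsol c L (prim h) L) (prim g L) (prim h L) => *; ring.
Qed.

Lemma alpha_comb k g g' h : sqint L g -> sqint L g' -> sqint L h ->
  alpha (fun y => g y + k * g' y) h = alpha g h + k * alpha g' h.
Proof.
move=> sg sg' sh.
have i f : sqint L f -> intble L (fun x => At * (f x * h x) - kap * (jop f x * prim h x)).
  move=> sf; apply: intbleB; apply: intbleZ; first exact: sqint_mul.
  apply: within_continuous_intble; apply: within_continuousM; first exact: jop_continuous.
  exact: prim_continuous (sqint_intble sh).
rewrite /alpha -(primZ k (i _ sg')) -(primD (i _ sg) (intbleZ k (i _ sg'))).
apply: eq_prim => x /andP[x0 xL]; have xL' : 0 <= x <= L by rewrite !ltW.
by rewrite (jop_comb k sg sg' xL'); ring.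
Qed.

Lemma hsol_aeq g g' x : sqint L g -> sqint L g' -> aeq L g g' -> 0 <= x <= L ->
  hsol c L (prim g) x = hsol c L (prim g') x.
Proof.
move=> sg sg' e xL; have ig := sqint_intble sg; have ig' := sqint_intble sg'.
apply: (eq_hsol c0 L0 (prim_continuous ig) (prim_continuous ig')) xL => y yL.
exact: aeq_prim ig ig' e yL.
Qed.

Lemma rell_aeq g g' : sqint L g -> sqint L g' -> aeq L g g' -> rell g = rell g'.
Proof.
move=> sg sg' e; have LL : 0 <= L <= L by rewrite lexx ltW.
rewrite /rell (hsol_aeq sg sg' e LL).
by rewrite (aeq_prim (sqint_intble sg) (sqint_intble sg') e LL).
Qed.

Lemma aeqM f f' g g' : aeq L f f' -> aeq L g g' -> aeq L (fun x => f x * g x) (fun x => f' x * g' x).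
Proof.
move=> h1 h2; apply: ae_filterS
  (ae_filterI h1 h2) => x [e1 e2] xL.
by rewrite e1 // e2.
Qed.

Lemma aeq_refl f : aeq L f f.
Proof. by apply: aeW. Qed.

Lemma alpha_aeq g g' h : sqint L g -> sqint L g' -> sqint L h -> aeq L g g' ->
  alpha g h = alpha g' h.
Proof.
move=> sg sg' sh e; have LL : 0 <= L <= L by rewrite lexx ltW.
rewrite (alphaE At kap c0 L0 sg sh) (alphaE At kap c0 L0 sg' sh).
rewrite (aeq_prim (sqint_mul sg sh) (sqint_mul sg' sh) (aeqM e (aeq_refl h)) LL).
apply: (congr1 (fun z => _ - _ * z)); apply: eq_prim => x /andP[x0 xL]; have xL' : 0 <= x <= L by rewrite !ltW.
rewrite /jop (hsol_aeq sg sg' e xL').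
by rewrite (aeq_prim (sqint_intble sg) (sqint_intble sg') e xL').
Qed.

Lemma alpha0 h : alpha (fun=> 0) h = 0.
Proof.
have p0 x : 0 <= x <= L -> prim (fun=> 0) x = 0 :> R.
  by move=> /andP[x0 _]; rewrite prim_cst // mul0r.
have s0 := sqint_cst L (0 : R).
have hz : helm c L (fun=> 0) (fun=> 0) (fun=> 0).
  split=> //; first exact: deriv_on_cst.
  by apply: deriv_on_eq (deriv_on_cst 0 L 0) _ _ => // x _; rewrite mulr0 subrr.
have hs x : 0 <= x <= L -> hsol c L (prim (fun=> 0)) x = 0.
  move=> xL; have cp := prim_continuous (sqint_intble s0).
  have hp : helm c L (fun=> 0) (hsol c L (prim (fun=> 0))) (hsol1 c L (prim (fun=> 0))).
    exact: helm_ext p0 (hsolP c0 L0 cp).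
  by have [->] := helm_uniq c0 L0 hp hz xL.
rewrite /alpha (eq_prim (g:=fun=> 0)) ?prim_cst ?mul0r ?(ltW L0) // => x /andP[x0 xL].
have xL' : 0 <= x <= L by rewrite !ltW.
by rewrite /jop hs // p0 // !mulr0 subrr !mul0r !mulr0 subrr.
Qed.

(** Continuity of the feedback functional for the energy norm: the Green function represents the end
    value of [P u'], and Cauchy-Schwarz and Poincare do the rest. It keeps the scalar feedback
    bounded in the compactness argument. *)
Lemma rell_sqr_le : exists2 K : R, 0 <= K & forall g, sqint L g ->
  rell g ^+ 2 <= K * prim (fun x => g x ^+ 2) L.
Proof.
have [G cG hG] := helm_end c0 L0; have sG := within_continuous_sqint cG.
set a := prim (fun x => G x ^+ 2) L; have a0 : 0 <= a by exact: prim_sqr_ge0.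
exists (2 * (b1 ^+ 2 * (a * (L ^+ 2 / 2)) + b3 ^+ 2 * L)).
  apply: mulr_ge0 => //; apply: addr_ge0; apply: mulr_ge0; rewrite ?sqr_ge0 //; last exact: ltW.
  by apply: mulr_ge0 => //; rewrite divr_ge0 // sqr_ge0.
move=> g sg; have cg := prim_continuous (sqint_intble sg).
have LL : 0 <= L <= L by rewrite lexx ltW.
rewrite /rell (hG g sg).
have h1 := prim_cauchy_schwarz sG (within_continuous_sqint cg); rewrite -/a in h1.
have h2 := poincare (ltW L0) sg; have h3 := prim_sqr_le sg LL.
have h4 := ler_wpM2l a0 h2; rewrite mulrA in h4; have {h1 h2 h4} h1 := le_trans h1 h4.
move: h1 h3; move: (prim _ L) (prim g L) (prim _ L) (a * _) => X Y Z A h1 h3.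
have h5 := ler_wpM2l (sqr_ge0 b1) h1; have h6 := ler_wpM2l (sqr_ge0 b3) h3.
have h7 := sqr_ge0 (b1 * Z - b3 * Y); lra.
Qed.

Lemma rell0 : rell (fun=> 0) = 0.
Proof.
have [K _ hK] := rell_sqr_le; have := hK _ (sqint_cst L 0).
rewrite (@eq_prim _ _ _ (fun=> 0)) => [|x _]; last by rewrite expr0n.
by rewrite (prim_cst _ (ltW L0)) mul0r mulr0 real_exprn_even_le0 ?num_real // => /eqP.
Qed.

End EnergyBilinear.

Lemma le_sum4 {R : realType} (A B C D : R) : 0 <= A -> 0 <= B -> 0 <= C -> 0 <= D ->
  [/\ C <= A + B + (C + D), D <= A + B + (C + D), A <= A + B + (C + D) & B <= A + B + (C + D)].
Proof. by move=> *; split; lra. Qed.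

Lemma le_weighted_sum4 {R : realType} (m K e A1 A2 P1 P2 P3 P4 : R) : 0 <= m -> 0 <= K ->
  A1 <= K * P1 -> A2 <= K * P2 -> P1 <= e -> P2 <= e -> P3 <= e -> P4 <= e ->
  m * (P3 + P4) + (A1 + A2) <= 2 * (m + K) * e.
Proof.
move=> m0 K0 h1 h2 l1 l2 l3 l4; have i1 := ler_wpM2l K0 l1; have i2 := ler_wpM2l K0 l2.
have i3 := ler_wpM2l m0 l3; have i4 := ler_wpM2l m0 l4; lra.
Qed.

(** * States described by four real functions *)

Section StateParts.
Context {R : realType} (b : beam R) (k1 : R).
Hypotheses (hL : 0 < beam_len b) (hm : 0 < beam_mass b)
  (hc : 0 < Pcoef b) (hAt : 0 < Atilde b).

Notation L := (beam_len b).
Notation m := (beam_mass b).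
Notation At := (Atilde b).
Notation c := (Pcoef b).
Notation kap := (kappa b).
Notation b1 := (ellcoef b).
Notation kk := (gain b k1).
Notation alpha := (alpha c L At kap).
Notation rell := (rell c L b1 (beam_B3 b)).
Hypothesis hkap : 0 < kap.

Implicit Types (u v w z y : state R) (k : R) (f g h r s : R -> R).

(* u_xx = g + i g' and the second component is r + i r'. *)
Record parts u g g' r r' : Prop := Parts {
  parts_H : Hspace b u;
  parts_s1 : sqint L g; parts_s2 : sqint L g'; parts_s3 : sqint L r; parts_s4 : sqint L r';
  parts_1 : aeq L (rdd b u.1) g; parts_2 : aeq L (idd b u.1) g';
  parts_3 : aeq L (reF u.2) r; parts_4 : aeq L (imF u.2) r' }.

Lemma parts_self u : Hspace b u -> parts u (rdd b u.1) (idd b u.1) (reF u.2) (imF u.2).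
Proof.
move=> Hu; have [Vu /L2P[s3 s4]] := Hu; have [s1 s2 _ _] := Vspace_parts Vu.
by split=> //; exact: aeq_refl.
Qed.

Lemma parts_exist g g' r r' : sqint L g -> sqint L g' -> sqint L r -> sqint L r' ->
  parts (cfun (prim (prim g)) (prim (prim g')), cfun r r') g g' r r'.
Proof.
move=> sg sg' sr sr'.
have [|//|V e e'] := @Vspace_intro R b hL (cfun (prim (prim g)) (prim (prim g'))) g g' sg sg'.
  by [].
split=> //; try exact: aeq_refl.
by split=> //; apply/L2P.
Qed.

Lemma parts_comb k u v g g' r r' h h' s s' : parts u g g' r r' -> parts v h h' s s' ->
  parts (u + k%:C%C *: v) (fun x => g x + k * h x) (fun x => g' x + k * h' x)
    (fun x => r x + k * s x) (fun x => r' x + k * s' x).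
Proof.
move=> [[Vu Lu] g1 g2 g3 g4 e1 e2 e3 e4] [[Vv Lv] h1 h2 h3 h4 f1 f2 f3 f4].
have [//|Vw a1 a2] := @Vspace_comb R b hL k u.1 v.1 (u + k%:C%C *: v).1 Vu Vv.
have ad (p p' q q' : R -> R) : aeq L p p' -> aeq L q q' ->
    aeq L (fun x => p x + k * q x) (fun x => p' x + k * q' x).
  move=> ap aq; apply: ae_filterS
    (ae_filterI ap aq) => x [ex ex'] xL.
  by rewrite ex // ex'.
have er : reF (u + k%:C%C *: v).2 = (fun x => reF u.2 x + k * reF v.2 x).
  by apply/funext => x; rewrite /reF /= -cReZ -cReD.
have ei : imF (u + k%:C%C *: v).2 = (fun x => imF u.2 x + k * imF v.2 x).
  by apply/funext => x; rewrite /imF /= -cImZ -cImD.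
split; try by apply: sqintD => //; exact: sqintZ.
- split=> //; move/L2P: Lu => [? ?]; move/L2P: Lv => [? ?].
  by apply/L2P; rewrite er ei; split; apply: sqintD => //; exact: sqintZ.
- exact: aeq_trans a1 (ad _ _ _ _ e1 f1).
- exact: aeq_trans a2 (ad _ _ _ _ e2 f2).
- by rewrite er; exact: ad.
- by rewrite ei; exact: ad.
Qed.

Lemma prim_mul_aeq p p' q q' : sqint L p -> sqint L p' -> sqint L q -> sqint L q' ->
  aeq L p p' -> aeq L q q' -> prim (fun x => p x * q x) L = prim (fun x => p' x * q' x) L.
Proof.
move=> sp sp' sq sq' ap aq; have LL : 0 <= L <= L by rewrite lexx ltW.
exact: aeq_prim (sqint_mul sp sq) (sqint_mul sp' sq') (aeqM ap aq) LL.
Qed.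

Lemma Hinner_parts u v g g' r r' h h' s s' : parts u g g' r r' -> parts v h h' s s' ->
  complex.Re (Hinner b u v) =
  m * (prim (fun x => r x * s x) L + prim (fun x => r' x * s' x) L) + (alpha g h + alpha g' h').
Proof.
move=> [[Vu Lu] g1 g2 g3 g4 e1 e2 e3 e4] [[Vv Lv] h1 h2 h3 h4 f1 f2 f3 f4].
have [su su' _ _] := Vspace_parts Vu; have [sv sv' _ _] := Vspace_parts Vv.
move/L2P: Lu => [su2 su2']; move/L2P: Lv => [sv2 sv2'].
have cg (A A' B B' C C' : R) : A = A' -> B = B' -> C = C' -> A + (B + C) = A' + (B' + C').
  by move=> -> -> ->.
rewrite /Hinner cReD (a_formE hL hc Vu Vv); apply: cg.
- rewrite -(prim_mul_aeq su2 g3 sv2 h3 e3 f3) -(prim_mul_aeq su2' g4 sv2' h4 e4 f4).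
  have i1 := sqint_mul su2 sv2; have i2 := sqint_mul su2' sv2'.
  rewrite -(primD i1 i2) -(primZ m (intbleD i1 i2)); apply: eq_prim => x _.
  rewrite cReM cReJ cImJ cReZ cImZ /reF /imF; ring.
- rewrite (alpha_aeq _ _ hc hL su g1 sv e1) (alphaC _ _ hc hL g1 sv).
  by rewrite (alpha_aeq _ _ hc hL sv h1 g1 f1) (alphaC _ _ hc hL h1 g1).
- rewrite (alpha_aeq _ _ hc hL su' g2 sv' e2) (alphaC _ _ hc hL g2 sv').
  by rewrite (alpha_aeq _ _ hc hL sv' h2 g2 f2) (alphaC _ _ hc hL h2 g2).
Qed.

Lemma parts_ge u g g' r r' : parts u g g' r r' -> let N := complex.Re (Hinner b u u) in
  [/\ alpha g g <= N, alpha g' g' <= N, m * prim (fun x => r x ^+ 2) L <= N &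
      m * prim (fun x => r' x ^+ 2) L <= N].
Proof.
move=> pu N; have [_ g1 g2 g3 g4 _ _ _ _] := pu.
have -> : N = m * (prim (fun x => r x ^+ 2) L + prim (fun x => r' x ^+ 2) L)
    + (alpha g g + alpha g' g') by exact: (Hinner_parts pu pu).
have n1 := mulr_ge0 (ltW hm) (prim_sqr_ge0 r L); have n2 := mulr_ge0 (ltW hm) (prim_sqr_ge0 r' L).
have n3 := le_trans (mulr_ge0 (ltW hAt) (prim_sqr_ge0 g L)) (alpha_ge At hc hL hkap g1).
have n4 := le_trans (mulr_ge0 (ltW hAt) (prim_sqr_ge0 g' L)) (alpha_ge At hc hL hkap g2).
by rewrite mulrDr; exact: (le_sum4 n1 n2 n3 n4).
Qed.

Lemma parts_le u g g' r r' e : parts u g g' r r' -> 0 <= e ->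
  prim (fun x => g x ^+ 2) L <= e -> prim (fun x => g' x ^+ 2) L <= e ->
  prim (fun x => r x ^+ 2) L <= e -> prim (fun x => r' x ^+ 2) L <= e ->
  complex.Re (Hinner b u u) <= 2 * (m + (At + kap * (L ^+ 2 / 2))) * e.
Proof.
move=> pu e0; have [_ g1 g2 g3 g4 _ _ _ _] := pu.
have -> : complex.Re (Hinner b u u) = m * (prim (fun x => r x ^+ 2) L + prim (fun x => r' x ^+ 2) L)
    + (alpha g g + alpha g' g') by exact: (Hinner_parts pu pu).
have K0 : 0 <= At + kap * (L ^+ 2 / 2).
  apply: addr_ge0; first exact: ltW.
  by apply: mulr_ge0; [exact: ltW|rewrite divr_ge0 // sqr_ge0].
move=> l1 l2 l3 l4.
exact: (le_weighted_sum4 (ltW hm) K0 (alpha_le At hc hL hkap g1) (alpha_le At hc hL hkap g2)).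
Qed.

(** Real test functions suffice: the real and imaginary parts of the weak identity then decouple
    into two copies of one real equation. *)
Lemma closed_loop_parts z y g g' r r' h h' s s' : closed_loop b k1 z y ->
  parts z g g' r r' -> parts y h h' s s' ->
  [/\ aeq L r (prim (prim h)), aeq L r' (prim (prim h')),
    forall f, sqint L f ->
      alpha g f = prim (fun x => - m * s x * prim (prim f) x) L - kk * rell h * rell f &
    forall f, sqint L f ->
      alpha g' f = prim (fun x => - m * s' x * prim (prim f) x) L - kk * rell h' * rell f].
Proof.
move=> [Vz Vy /ae_equalP[az az'] Ly weak] [_ g1 g2 g3 g4 e1 e2 e3 e4] [_ h1 h2 h3 h4 f1 f2 f3 f4].
have [sz sz' _ _] := Vspace_parts Vz; have [sy sy' _ Ey] := Vspace_parts Vy.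
move/L2P: Ly => [ly ly'].
have pp f f' : sqint L f -> sqint L f' -> aeq L f f' -> forall x, 0 <= x <= L ->
    prim (prim f) x = prim (prim f') x.
  move=> sf sf' a x /andP[x0 xL]; apply: eq_prim => y0 /andP[p q].
  by apply: (aeq_prim (sqint_intble sf) (sqint_intble sf') a); rewrite (ltW p) (le_trans (ltW q)).
have inoo (x : R) : x \in `]0, L[ -> 0 <= x <= L.
  by rewrite in_itv => /andP[? ?]; rewrite !ltW.
have ar : aeq L r (prim (prim h)).
  apply: aeq_trans (aeq_sym e3) _; apply: aeq_trans az _; apply: aeW => x /inoo xL.
  by have [-> _] := Ey x xL; exact: pp.
have ar' : aeq L r' (prim (prim h')).
  apply: aeq_trans (aeq_sym e4) _; apply: aeq_trans az' _; apply: aeW => x /inoo xL.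
  by have [_ ->] := Ey x xL; exact: pp.
have test f : sqint L f ->
  alpha g f = prim (fun x => - m * s x * prim (prim f) x) L - kk * rell h * rell f /\
  alpha g' f = prim (fun x => - m * s' x * prim (prim f) x) L - kk * rell h' * rell f.
  move=> sf; have s0 := sqint_cst L (0 : R).
  (* A test function with second derivative [f] and zero imaginary part; its pairings with [idd]
     vanish. *)
  set psi := cfun (prim (prim f)) (fun=> 0).
  have [|x xL|Vp af a0] := @Vspace_intro R b hL psi f (fun=> 0) sf s0; first by [].
    have /andP[x0 _] := xL; rewrite (eq_prim (g:=fun=> 0)) ?prim_cst ?mul0r // => t /andP[t0 _].
    by rewrite prim_cst ?mul0r // ltW.
  have [sp sp' _ _] := Vspace_parts Vp.
  have al p p' : sqint L p -> sqint L p' -> aeq L p p' ->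
      alpha p (rdd b psi) = alpha p' f /\ alpha p (idd b psi) = 0.
    move=> i i' a; split.
      rewrite (alpha_aeq _ _ hc hL i i' sp a) (alphaC _ _ hc hL i' sp).
      by rewrite (alpha_aeq _ _ hc hL sp sf i' af) (alphaC _ _ hc hL sf i').
    rewrite (alphaC _ _ hc hL i sp') (alpha_aeq _ _ hc hL sp' s0 i a0).
    exact: (alpha0 _ _ hc hL).
  have [a1 a2] := al _ _ sz g1 e1; have [a3 a4] := al _ _ sz' g2 e2.
  have l1 : ell b psi = Complex (rell f) 0.
    rewrite (ellE hL hc Vp) (rell_aeq _ _ hc hL sp sf af) (rell_aeq _ _ hc hL sp' s0 a0).
    by rewrite (rell0 _ _ hc hL).
  have l2 : ell b y.1 = Complex (rell h) (rell h').
    by rewrite (ellE hL hc Vy) (rell_aeq _ _ hc hL sy h1 f1) (rell_aeq _ _ hc hL sy' h2 f2).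
  have := weak psi Vp; rewrite (a_formE hL hc Vz Vp) a1 a2 a3 a4 l1 l2 => e.
  have cp := prim_continuous (within_continuous_intble (prim_continuous (sqint_intble sf))).
  have sc := within_continuous_sqint cp; have LL : 0 <= L <= L by rewrite lexx ltW.
  have lhs (q q' : R -> R) : sqint L q -> sqint L q' -> aeq L q q' ->
      prim (fun x => - m * q' x * prim (prim f) x) L = - prim (fun x => m * (q x * prim (prim f) x)) L.
    move=> sq sq' a.
    rewrite (primZ m (sqint_mul sq sc)) (prim_mul_aeq sq sq' sc sc a (aeq_refl L _)).
    rewrite -mulNr -(primZ (- m) (sqint_mul sq' sc)); apply: eq_prim => x _; by rewrite mulrA.
  rewrite (lhs _ _ ly h3 f3) (lhs _ _ ly' h4 f4); split.
    have eR : prim (fun x => complex.Re (m%:C%C * y.2 x * Num.conj (psi x))) L =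
        prim (fun x => m * (reF y.2 x * prim (prim f) x)) L.
      apply: eq_prim => x _; rewrite cReM cReJ cImJ cReZ cImZ /psi /cfun /= /reF; ring.
    rewrite -eR -[prim _ L]/(complex.Re (cintegral `]0, L[ (fun x => m%:C%C * y.2 x * Num.conj (psi x)))) e /=.
    move: (alpha g f) (alpha g' f) (rell h) (rell h') (rell f) => *; rewrite /gain; ring.
  have eI : prim (fun x => complex.Im (m%:C%C * y.2 x * Num.conj (psi x))) L =
      prim (fun x => m * (imF y.2 x * prim (prim f) x)) L.
    apply: eq_prim => x _; rewrite cImM cReJ cImJ cReZ cImZ /psi /cfun /= /imF; ring.
  rewrite -eI -[prim _ L]/(complex.Im (cintegral `]0, L[ (fun x => m%:C%C * y.2 x * Num.conj (psi x)))) e /=.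
  move: (alpha g f) (alpha g' f) (rell h) (rell h') (rell f) => *; rewrite /gain; ring.
split=> // f sf; by have [] := test f sf.
Qed.

End StateParts.

(** * Compactness supplied by the closed-loop equation *)

Section Precompact.
Context {R : realType} (U : set_system nat) {UU : UltraFilter U}.
Implicit Types (L e D : R) (f g h s : nat -> R -> R).

Lemma ucauchy_sqr L f e : 0 < L -> (forall n, sqint L (f n)) -> ucauchy U L f -> 0 < e ->
  exists2 A, U A & forall m n, A m -> A n -> prim (fun x => (f m x - f n x) ^+ 2) L <= e.
Proof.
move=> L0 sf uf e0; pose d := Num.sqrt (e / L).
have eL : 0 < e / L by rewrite divr_gt0.
have d0 : 0 < d by rewrite sqrtr_gt0.
have [A uA hA] := uf d d0; exists A => // m n Am An.
have dL : d ^+ 2 * L = e by rewrite sqr_sqrtr ?(ltW eL) // divfK // lt0r_neq0.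
rewrite -[leRHS]dL -(prim_cst _ (ltW L0)); apply: prim_le.
- by have [] := sqintB (sf m) (sf n).
- exact: within_continuous_intble (@within_continuous_cst R 0 L _).
- move=> x /andP[x0 xL]; rewrite -[leLHS]real_normK ?num_real // ler_pXn2r ?nnegrE ?(ltW d0) //.
  by apply: hA => //; rewrite !ltW.
Qed.

Lemma sqr0_aeq L (f : R -> R) : sqint L f -> prim (fun x => f x ^+ 2) L = 0 -> aeq L f (fun=> 0).
Proof.
move=> sf f0; apply: prim_aeq; [exact: sqint_intble|exact: sqint_intble (sqint_cst L 0)|].
move=> x xL; have := prim_sqr_le sf xL; rewrite f0 mulr0 real_exprn_even_le0 ?num_real //= => /eqP ->.
by rewrite prim_cst ?mul0r //; case/andP: xL.
Qed.

Lemma prim_prim_sqr_le L (f : R -> R) : 0 < L -> sqint L f ->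
  prim (fun x => prim (prim f) x ^+ 2) L <= (L ^+ 2 / 2) ^+ 2 * prim (fun x => f x ^+ 2) L.
Proof.
move=> L0 sf; have cf := prim_continuous (sqint_intble sf).
have h := poincare (ltW L0) sf; apply: le_trans (poincare (ltW L0) (within_continuous_sqint cf)) _.
have k0 : 0 <= L ^+ 2 / 2 by rewrite divr_ge0 // sqr_ge0.
by have := ler_wpM2l k0 h; rewrite mulrA -(expr2 (L ^+ 2 / 2)).
Qed.

Section Resolvent.
Context (c L At kap b1 b3 : R).
Hypotheses (c0 : 0 < c) (L0 : 0 < L) (At0 : 0 < At) (kap0 : 0 < kap).
Notation alpha := (alpha c L At kap).
Notation rell := (rell c L b1 b3).

(** The strong form writes [At g n] as tails of [L^2]-bounded functions plus the bounded scalar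
    [l n] times a fixed function. Each piece is uniformly Cauchy along the ultrafilter, so second
    derivatives bounded only in [L^2] become Cauchy in [L^2]. *)
Lemma precompact_potential g s (l : nat -> R) D : (forall n, sqint L (g n)) ->
  (forall n, sqint L (s n)) -> (forall n, `|l n| <= D) ->
  (forall n, alpha (g n) (g n) <= D) -> (forall n, prim (fun x => s n x ^+ 2) L <= D) ->
  (forall n (f : R -> R), sqint L f -> alpha (g n) f =
     prim (fun x => s n x * prim (prim f) x) L - l n * rell f) ->
  forall e, 0 < e -> exists2 A, U A &
    forall m n, A m -> A n -> prim (fun x => (g m x - g n x) ^+ 2) L <= e.
Proof.
move=> sg ss lD aD sD weak e e0.
have [G cG hG] := weak_strong At kap b1 b3 c0 L0.
have iG := within_continuous_intble cG.
pose F n x := kap * tail L (jop c L (g n)) x + tail L (tail L (s n)) x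
  - l n * (b1 * tail L G x + b3).
have sj n := within_continuous_sqint (jop_continuous c0 L0 (sg n)).
have st (q : R -> R) : sqint L q -> sqint L (tail L q).
  by move=> sq; apply: within_continuous_sqint; exact: tail_continuous (sqint_intble sq).
have sF n : sqint L (F n).
  apply: sqintB; first exact: sqintD (sqintZ kap (st _ (sj n))) (st _ (st _ (ss n))).
  apply: sqintZ; apply: sqintD; last exact: sqint_cst.
  by apply: sqintZ; exact: st (within_continuous_sqint cG).
have gF n : aeq L (fun x => At * g n x) (F n).
  have := sqr0_aeq (sqintB (sqintZ At (sg n)) (sF n)) (hG (g n) (s n) (l n) (sg n) (ss n) (weak n)).
  apply: ae_filterS => x h xL.
  by apply/eqP; rewrite -subr_eq0; apply/eqP; exact: h.
have jD n : prim (fun x => jop c L (g n) x ^+ 2) L <= D / kap.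
  rewrite ler_pdivlMr // mulrC; apply: le_trans (aD n).
  rewrite (alpha_diag At kap c0 L0 (sg n)).
  have h1 := mulr_ge0 (ltW At0) (prim_sqr_ge0 (g n) L).
  have h2 := mulr_ge0 (ltW c0) (prim_sqr_ge0 (hsol1 c L (prim (g n))) L).
  have h3 := mulr_ge0 (ltW kap0) h2.
  by rewrite mulrDr; apply: le_trans (_ : _ <= kap * (c * prim (fun x => hsol1 c L (prim (g n)) x ^+ 2) L)
    + kap * prim (fun x => jop c L (g n) x ^+ 2) L) _; rewrite ?lerDr ?lerDl.
have u1 := ucauchyZ kap (ucauchy_tail L0 sj jD).
have u2 := ucauchy_tail L0 (fun n => st _ (ss n)) (fun n => tail_sqr_bounded L0 (ss n) (sD n)).
have [M hM] := within_continuous_bounded (within_continuous_add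
  (within_continuousZ (k:=b1) (tail_continuous iG)) (@within_continuous_cst R 0 L b3)).
have u3 := ucauchyZ (-1) (ucauchyM hM (ucauchy_bounded L lD)).
have uF : ucauchy U L F.
  suff -> : F = (fun n x => kap * tail L (jop c L (g n)) x + tail L (tail L (s n)) x
      + -1 * (l n * (b1 * tail L G x + b3))).
    exact: ucauchyD (ucauchyD (u1 U UU) (u2 U UU)) (u3 U UU).
  by apply/funext => n; apply/funext => x; rewrite mulN1r.
have e1 : 0 < e * At ^+ 2 by rewrite mulr_gt0 // exprn_gt0.
have [A uA hA] := ucauchy_sqr L0 sF uF e1; exists A => // m n Am An.
have := hA m n Am An; have LL : 0 <= L <= L by rewrite lexx ltW.
have sgd := sqintB (sg m) (sg n).
have [_ i1] := sqintB (sF m) (sF n); have [_ i2] := sgd.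
rewrite (aeq_prim (g:=fun x => At ^+ 2 * (g m x - g n x) ^+ 2) i1 (intbleZ _ i2) _ LL).
  by rewrite (primZ _ i2) mulrC ler_pM2r // exprn_gt0.
apply: ae_filterS
  (ae_filterI (gF m) (gF n)) => x [h1 h2] xL.
by rewrite -h1 // -h2 //; ring.
Qed.

End Resolvent.
End Precompact.

(** * The state space and the semigroup *)

Section HilbertType.
Context {R : realType} {b : beam R}.

Lemma parts0 : 0 < beam_len b -> parts b 0 (fun=> 0) (fun=> 0) (fun=> 0) (fun=> 0).
Proof.
move=> hL; have s0 := sqint_cst (beam_len b) (0 : R).
have z x : 0 <= x <= beam_len b -> 0 = prim (prim (fun=> 0)) x :> R.
  move=> /andP[x0 _]; rewrite (eq_prim (g:=fun=> 0)) ?prim_cst ?mul0r // => t /andP[t0 _].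
  by rewrite prim_cst ?mul0r // ltW.
have [V e e'] := @Vspace_intro R b hL (0 : state R).1 _ _ s0 s0 z z.
by split=> //; [split=> //; apply/L2P|exact: aeq_refl|exact: aeq_refl].
Qed.

Lemma Hspace_comb (k : R) (u v : state R) : 0 < beam_len b -> Hspace b u -> Hspace b v ->
  Hspace b (u + k%:C%C *: v).
Proof.
by move=> hL /parts_self pu /parts_self pv; case: (parts_comb hL k pu pv).
Qed.

Context (hL : 0 < beam_len b).

(** Closure under subtraction relies on [0 < beam_len b]; the proof is an argument so that the
    closure instance can be attached to the predicate. *)
Definition Hpred (h : 0 < beam_len b) : {pred state R} := fun u => `[< Hspace b u >].

Lemma Hpred_zmod : zmod_closed (Hpred hL).
Proof.
split => [|u v /asboolP hu /asboolP hv]; apply/asboolP; first by case: (parts0 hL).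
by have := Hspace_comb (-1) hL hu hv; rewrite rmorphN rmorph1 scaleN1r.
Qed.
HB.instance Definition _ := GRing.isZmodClosed.Build (state R) (Hpred hL) Hpred_zmod.

(* [Hspace b] as a vector space over R: only real scalars enter the stability argument. *)
Record hstate := HState { hval : state R; hvalP : hval \in Hpred hL }.
HB.instance Definition _ := [isSub for hval].
HB.instance Definition _ := [Choice of hstate by <:].
HB.instance Definition _ := [SubChoice_isSubZmodule of hstate by <:].

Lemma hval_Hspace (u : hstate) : Hspace b (hval u).
Proof. exact/asboolP/hvalP. Qed.

Lemma hscale_subproof (k : R) (u : hstate) : k%:C%C *: hval u \in Hpred hL.
Proof.
apply/asboolP; have [H0 _ _ _ _ _ _ _ _] := parts0 hL.
by have := Hspace_comb k hL H0 (hval_Hspace u); rewrite add0r.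
Qed.

Definition hscale k u := HState (hscale_subproof k u).

Lemma hscaleA k l u : hscale k (hscale l u) = hscale (k * l) u.
Proof. by apply: val_inj; rewrite /= scalerA rmorphM. Qed.

Lemma hscale1 : left_id 1 hscale.
Proof. by move=> u; apply: val_inj; rewrite /= rmorph1 scale1r. Qed.

Lemma hscaleDr : right_distributive hscale +%R.
Proof. by move=> k u v; apply: val_inj; rewrite /= scalerDr. Qed.

Lemma hscaleDl u : {morph hscale^~ u : k l / k + l}.
Proof. by move=> k l; apply: val_inj; rewrite /= rmorphD scalerDl. Qed.

HB.instance Definition _ :=
  GRing.Zmodule_isLmodule.Build R hstate hscaleA hscale1 hscaleDr hscaleDl.

Lemma hvalB (u v : hstate) : hval (u - v) = hval u - hval v. Proof. by []. Qed.

End HilbertType.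
Arguments hstate {R b} hL.

Lemma cvg_right0P {R : realType} (f : R -> R) : f t @[t --> 0^'+] --> (0 : R) <->
  forall e : R, 0 < e -> exists2 d : R, 0 < d & forall t, 0 < t < d -> `|f t| < e.
Proof.
split=> [/cvgrPdist_lt h e e0|h].
  have /nbhs_ballP[d /= d0 hd] := h e e0; exists d => // t /andP[t0 td].
  have := hd t; rewrite /ball /= sub0r normrN gtr0_norm // sub0r normrN; exact.
apply/cvgrPdist_lt => e e0; have [d d0 hd] := h e e0.
apply/nbhs_ballP; exists d => //= t; rewrite /ball /= sub0r normrN => td t0.
by rewrite sub0r normrN; apply: hd; rewrite t0 /= -(gtr0_norm t0).
Qed.

(** * Hilbert space structure, compactness and modes of the beam *)

Section Stability.
Context {R : realType} {b : beam R} (k1 : R).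
Hypotheses (hL : 0 < beam_len b) (hm : 0 < beam_mass b) (hc : 0 < Pcoef b)
  (hAt : 0 < Atilde b) (hkap : 0 < kappa b) (hb1 : 0 < ellcoef b) (hB3 : 0 < beam_B3 b)
  (hkk : 0 < gain b k1).

Notation L := (beam_len b).
Notation m := (beam_mass b).
Notation At := (Atilde b).
Notation c := (Pcoef b).
Notation kap := (kappa b).
Notation kk := (gain b k1).
Notation alpha := (alpha c L At kap).
Notation rell := (rell c L (ellcoef b) (beam_B3 b)).
Notation H := (hstate hL).
Notation parts := (parts b).

Implicit Types (u v w z y : H) (k e : R) (f g h r s : R -> R).

Definition hip u v : R := complex.Re (Hinner b (hval u) (hval v)).

Let self u := parts_self (hval_Hspace u).

Lemma hipC u v : hip u v = hip v u.
Proof.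
have pu := self u; have pv := self v.
apply: etrans (Hinner_parts hL hc pu pv) (esym (etrans (Hinner_parts hL hc pv pu) _)).
have [_ u1 u2 _ _ _ _ _ _] := pu; have [_ v1 v2 _ _ _ _ _ _] := pv.
rewrite (alphaC At kap hc hL v1 u1) (alphaC At kap hc hL v2 u2).
have C (p q : R -> R) : prim (fun x => p x * q x) L = prim (fun x => q x * p x) L.
  by apply: eq_prim => x _; rewrite mulrC.
by rewrite (C (reF (hval v).2)) (C (imF (hval v).2)).
Qed.

Lemma hip_comb k u v w : hip (u + k *: v) w = hip u w + k * hip v w.
Proof.
have pu := self u; have pv := self v; have pw := self w.
apply: etrans (Hinner_parts hL hc (parts_comb hL k pu pv) pw) _.
have euw : hip u w = _ := Hinner_parts hL hc pu pw.
have evw : hip v w = _ := Hinner_parts hL hc pv pw.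
rewrite euw evw.
have [_ u1 u2 u3 u4 _ _ _ _] := pu; have [_ v1 v2 v3 v4 _ _ _ _] := pv.
have [_ w1 w2 w3 w4 _ _ _ _] := pw.
rewrite (alpha_comb At kap hc hL k u1 v1 w1) (alpha_comb At kap hc hL k u2 v2 w2).
have C (p q r : R -> R) : sqint L p -> sqint L q -> sqint L r ->
    prim (fun x => (p x + k * q x) * r x) L =
    prim (fun x => p x * r x) L + k * prim (fun x => q x * r x) L.
  move=> sp sq sr; have i1 := sqint_mul sp sr; have i2 := sqint_mul sq sr.
  rewrite -(primZ k i2) -(primD i1 (intbleZ k i2)).
  by apply: eq_prim => x _; rewrite mulrDl mulrA.
rewrite (C _ _ _ u3 v3 w3) (C _ _ _ u4 v4 w4).
move: (prim _ L) (prim _ L) (prim _ L) (prim _ L) (alpha _ _) (alpha _ _) (alpha _ _) (alpha _ _) m.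
by move=> *; ring.
Qed.

Lemma hipD u v w : hip (u + v) w = hip u w + hip v w.
Proof. by rewrite -[v]scale1r hip_comb mul1r scale1r. Qed.

Lemma hip0 w : hip 0 w = 0.
Proof. by apply: (addrI (hip 0 w)); rewrite -hipD !addr0. Qed.

Lemma hipZ k u w : hip (k *: u) w = k * hip u w.
Proof. by rewrite -[k *: u]add0r hip_comb hip0 add0r. Qed.

Lemma hip_ge0 u : 0 <= hip u u.
Proof.
have pu := self u; have [_ _ h _] := parts_ge hL hm hc hAt hkap pu.
apply: le_trans h; apply: mulr_ge0; [exact: ltW|exact: prim_sqr_ge0].
Qed.

Definition hinner : semiInner H := SemiInner hipC hipD hipZ hip_ge0.

Lemma nrm_Hnorm u : nrm hinner u = Hnorm b (hval u).
Proof. by []. Qed.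

Lemma nrm_sqr u : nrm hinner u ^+ 2 = hip u u.
Proof. by rewrite sqr_sqrtr // hip_ge0. Qed.

Lemma parts_sub u v g g' r r' h h' s s' : parts (hval u) g g' r r' -> parts (hval v) h h' s s' ->
  parts (hval (u - v)) (fun x => g x - h x) (fun x => g' x - h' x)
    (fun x => r x - s x) (fun x => r' x - s' x).
Proof.
move=> pu pv; have := parts_comb hL (-1) pu pv.
rewrite rmorphN rmorph1 scaleN1r.
have E (p q : R -> R) : (fun x => p x + -1 * q x) = (fun x => p x - q x).
  by apply/funext => x; rewrite mulN1r.
by rewrite !E.
Qed.

Lemma nrm_le_parts e : 0 < e -> exists2 d : R, 0 < d & forall u g g' r r',
  parts (hval u) g g' r r' ->
  prim (fun x => g x ^+ 2) L <= d -> prim (fun x => g' x ^+ 2) L <= d ->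
  prim (fun x => r x ^+ 2) L <= d -> prim (fun x => r' x ^+ 2) L <= d -> nrm hinner u <= e.
Proof.
move=> e0; pose K := 2 * (m + (At + kap * (L ^+ 2 / 2))).
have K0 : 0 < K.
  apply: mulr_gt0 => //; apply: addr_gt0 => //; apply: addr_gt0 => //.
  by apply: mulr_gt0 => //; rewrite divr_gt0 // exprn_gt0.
have d0 : 0 < e ^+ 2 / K by rewrite divr_gt0 // exprn_gt0.
exists (e ^+ 2 / K) => // u g g' r r' pu l1 l2 l3 l4.
have := parts_le hL hm hc hAt hkap pu (ltW d0) l1 l2 l3 l4.
rewrite -/(hip u u) -/K mulrCA divff ?gt_eqF // mulr1 -nrm_sqr ler_pXn2r // nnegrE.
  exact: sqrtr_ge0.
exact: ltW.
Qed.

Lemma hinner_complete : hcomplete hinner.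
Proof.
move=> u cu; have ss n := self (u n).
have lim (F : H -> R -> R) (a : R) : 0 < a -> (forall n, sqint L (F (u n))) -> (forall v w,
    a * prim (fun x => (F v x - F w x) ^+ 2) L <= hip (v - w) (v - w)) ->
    exists2 g, sqint L g & forall e, 0 < e -> exists N : nat, forall n, (N <= n)%N ->
    prim (fun x => (F (u n) x - g x) ^+ 2) L <= e.
  move=> a0 sF hF; apply: sqint_complete (ltW hL) sF _ => e e0.
  have ae : 0 < a * e by rewrite mulr_gt0.
  have [N hN] := cu (Num.sqrt (a * e)) (etrans (sqrtr_gt0 _) ae).
  exists N => i j Ni Nj; have := hN i j Ni Nj; have := hF (u i) (u j).
  rewrite -nrm_sqr => h1 h2; rewrite -(ltr_pM2l a0); apply: le_lt_trans h1 _.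
  rewrite -[ltRHS](sqr_sqrtr (ltW ae)) ltr_pXn2r // nnegrE; exact: sqrtr_ge0.
have ge v w : let N := hip (v - w) (v - w) in
  [/\ At * prim (fun x => (rdd b (hval v).1 x - rdd b (hval w).1 x) ^+ 2) L <= N,
   At * prim (fun x => (idd b (hval v).1 x - idd b (hval w).1 x) ^+ 2) L <= N,
   m * prim (fun x => (reF (hval v).2 x - reF (hval w).2 x) ^+ 2) L <= N &
   m * prim (fun x => (imF (hval v).2 x - imF (hval w).2 x) ^+ 2) L <= N].
  move=> N; have pvw := parts_sub (self v) (self w); have [_ s1 s2 _ _ _ _ _ _] := pvw.
  have [h1 h2 h3 h4] := parts_ge hL hm hc hAt hkap pvw; split=> //.
    exact: le_trans (alpha_ge At hc hL hkap s1) h1.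
  exact: le_trans (alpha_ge At hc hL hkap s2) h2.
have [g sg hg] := lim (fun v => rdd b (hval v).1) At hAt
  (fun n => parts_s1 (ss n)) (fun v w => let: And4 l _ _ _ := ge v w in l).
have [g' sg' hg'] := lim (fun v => idd b (hval v).1) At hAt
  (fun n => parts_s2 (ss n)) (fun v w => let: And4 _ l _ _ := ge v w in l).
have [r sr hr] := lim (fun v => reF (hval v).2) m hm
  (fun n => parts_s3 (ss n)) (fun v w => let: And4 _ _ l _ := ge v w in l).
have [r' sr' hr'] := lim (fun v => imF (hval v).2) m hm
  (fun n => parts_s4 (ss n)) (fun v w => let: And4 _ _ _ l := ge v w in l).
have pl := parts_exist hL sg sg' sr sr'; have [Hl _ _ _ _ _ _ _ _] := pl.
exists (HState (introT (asboolP _) Hl : _ \in Hpred hL)) => e e0.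
have e2 : 0 < e / 2 by rewrite divr_gt0.
have [d d0 hd] := nrm_le_parts e2.
have [N1 h1] := hg d d0; have [N2 h2] := hg' d d0.
have [N3 h3] := hr d d0; have [N4 h4] := hr' d d0.
exists (maxn (maxn N1 N2) (maxn N3 N4)) => n.
rewrite !geq_max => /andP[/andP[n1 n2] /andP[n3 n4]].
apply: (@le_lt_trans _ _ (e / 2)); last by rewrite ltr_pdivrMr // ltr_pMr // ltr1n.
exact: hd (parts_sub (ss n) (pl : parts (hval (HState _)) _ _ _ _)) (h1 n n1) (h2 n n2) (h3 n n3) (h4 n n4).
Qed.

(** The displacement is controlled by the closed-loop equation with source [y.2]. The velocity of
    [z] is the displacement of [y], whose second derivatives are bounded, so it is a double
    primitive of a bounded sequence. *)
Lemma hcompact (z y : nat -> H) (C : R) :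
  (forall n, closed_loop b k1 (hval (z n)) (hval (y n))) ->
  (forall n, nrm hinner (z n) <= C) -> (forall n, nrm hinner (y n) <= C) ->
  exists2 k : nat -> nat, (forall n, (n <= k n)%N) & hcauchy hinner (fun n => z (k n)).
Proof.
move=> cl zC yC; have [U [UU ooU]] := ultraFilterLemma (@eventually_filter).
have sqC (w : H) : nrm hinner w <= C -> hip w w <= C ^+ 2.
  move=> wC; have w0 : 0 <= nrm hinner w by exact: sqrtr_ge0.
  by rewrite -nrm_sqr ler_pXn2r // nnegrE (le_trans w0).
have zD n := sqC _ (zC n); have yD n := sqC _ (yC n).
set D0 := C ^+ 2 in zD yD; have D00 : 0 <= D0 := sqr_ge0 C.
pose g n := rdd b (hval (z n)).1; pose g' n := idd b (hval (z n)).1.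
pose h n := rdd b (hval (y n)).1; pose h' n := idd b (hval (y n)).1.
have py n := self (y n); have pz n := self (z n).
have sh n : sqint L (h n) by case: (py n).
have sh' n : sqint L (h' n) by case: (py n).
have sg n : sqint L (g n) by case: (pz n).
have sg' n : sqint L (g' n) by case: (pz n).
have clp n := closed_loop_parts hL hc (cl n) (pz n) (py n).
have pz' n : parts (hval (z n)) (g n) (g' n) (prim (prim (h n))) (prim (prim (h' n))).
  have [a1 a2 _ _] := clp n; have [Hz _ _ _ _ _ _ _ _] := pz n.
  exact: (Parts Hz (sg n) (sg' n) (sqint_prim (sqint_prim (sh n))) (sqint_prim (sqint_prim (sh' n)))
    (aeq_refl _ _) (aeq_refl _ _) a1 a2).
have [K K0 hK] := rell_sqr_le (ellcoef b) (beam_B3 b) hc hL.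
have Ah (f : R -> R) (u : H) : sqint L f -> alpha f f <= hip u u -> hip u u <= D0 ->
    prim (fun x => f x ^+ 2) L <= D0 / At.
  move=> sf l1 l2; rewrite ler_pdivlMr // mulrC; apply: le_trans l2; apply: le_trans l1.
  exact: (alpha_ge At hc hL hkap sf).
have hy n := parts_ge hL hm hc hAt hkap (py n); have hz n := parts_ge hL hm hc hAt hkap (pz n).
have hD n : prim (fun x => h n x ^+ 2) L <= D0 / At.
  by have [l _ _ _] := hy n; exact: Ah (sh n) l (yD n).
have hD' n : prim (fun x => h' n x ^+ 2) L <= D0 / At.
  by have [_ l _ _] := hy n; exact: Ah (sh' n) l (yD n).
(* One bound for three quantities: the energy, the norm of the source [- m y.2], and the feedback
   scalar. The [+ 1] lets [X + 1] dominate the square root of [X]. *)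
pose D := D0 + (m * D0 + kk * (K * (D0 / At) + 1)).
have E0 : 0 <= K * (D0 / At) by apply: mulr_ge0 => //; apply: divr_ge0 => //; exact: ltW.
have mD0 : 0 <= m * D0 by apply: mulr_ge0 => //; exact: ltW.
have kD0 : 0 <= kk * (K * (D0 / At) + 1) by apply: mulr_ge0; [exact: ltW|exact: addr_ge0].
have D0D : D0 <= D by rewrite lerDl addr_ge0.
have mDD : m * D0 <= D by apply: le_trans (_ : _ <= m * D0 + kk * (K * (D0 / At) + 1)) _; rewrite ?lerDl ?lerDr.
have kDD : kk * (K * (D0 / At) + 1) <= D.
  by apply: le_trans (_ : _ <= m * D0 + kk * (K * (D0 / At) + 1)) _; rewrite ?lerDl ?lerDr.
have lD (f : R -> R) : sqint L f -> prim (fun x => f x ^+ 2) L <= D0 / At -> `|kk * rell f| <= D.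
  move=> sf fD; rewrite normrM (gtr0_norm hkk); apply: le_trans kDD; rewrite ler_pM2l //.
  rewrite -(@ler_pXn2r _ 2) ?nnegrE ?normr_ge0 ?addr_ge0 // real_normK ?num_real //.
  apply: le_trans (hK f sf) _; have := ler_wpM2l K0 fD.
  by move: E0; move: (K * (D0 / At)) => a a0; move/le_trans; apply; nra.
have sD (f : R -> R) : sqint L f -> m * prim (fun x => f x ^+ 2) L <= D0 ->
    prim (fun x => (- m * f x) ^+ 2) L <= D.
  move=> [_ sf] l; apply: le_trans mDD.
  rewrite (_ : (fun x => (- m * f x) ^+ 2) = (fun x => m * m * f x ^+ 2)); last first.
    by apply/funext => x; rewrite exprMn sqrrN expr2.
  by rewrite (primZ _ sf) -mulrA ler_pM2l.
have cpr : forall e, 0 < e -> exists2 A, U A & forall i j, A i -> A j ->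
    prim (fun x => (g i x - g j x) ^+ 2) L <= e.
  have s2 n : sqint L (fun x => - m * reF (hval (y n)).2 x) by apply: sqintZ; case: (py n).
  apply: (precompact_potential hc hL hAt hkap sg s2 (fun n => lD _ (sh n) (hD n))) => [n|n|n].
  - by have [l _ _ _] := hz n; apply: le_trans l _; exact: le_trans (zD n) D0D.
  - have [_ _ l _] := hy n; apply: sD; [by case: (py n)|exact: le_trans l (yD n)].
  - have [_ _ e _] := clp n; exact: e.
have cpi : forall e, 0 < e -> exists2 A, U A & forall i j, A i -> A j ->
    prim (fun x => (g' i x - g' j x) ^+ 2) L <= e.
  have s2 n : sqint L (fun x => - m * imF (hval (y n)).2 x) by apply: sqintZ; case: (py n).
  apply: (precompact_potential hc hL hAt hkap sg' s2 (fun n => lD _ (sh' n) (hD' n))) => [n|n|n].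
  - by have [_ l _ _] := hz n; apply: le_trans l _; exact: le_trans (zD n) D0D.
  - have [_ _ _ l] := hy n; apply: sD; [by case: (py n)|exact: le_trans l (yD n)].
  - have [_ _ _ e] := clp n; exact: e.
have ppc (f : nat -> R -> R) : (forall n, sqint L (f n)) ->
    (forall n, prim (fun x => f n x ^+ 2) L <= D0 / At) -> forall e, 0 < e ->
    exists2 A, U A & forall i j, A i -> A j ->
    prim (fun x => (prim (prim (f i)) x - prim (prim (f j)) x) ^+ 2) L <= e.
  move=> sf fD e e0; apply: (ucauchy_sqr hL (fun n => sqint_prim (sqint_prim (sf n)))) e0.
  apply: (ucauchy_prim hL (fun n => sqint_prim (sf n)) (C := L ^+ 2 / 2 * (D0 / At))) => n.
  apply: le_trans (poincare (ltW hL) (sf n)) _.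
  by rewrite ler_wpM2l // divr_ge0 // sqr_ge0.
have [e e0|k nk hk] := @ucauchy_subseq R U UU (fun i j => nrm hinner (z i - z j)) ooU.
  have [d d0 hd] := nrm_le_parts e0.
  have [A1 u1 h1] := cpr d d0; have [A2 u2 h2] := cpi d d0.
  have [A3 u3 h3] := ppc h sh hD d d0; have [A4 u4 h4] := ppc h' sh' hD' d d0.
  exists ((A1 `&` A2) `&` (A3 `&` A4)); first by apply: filterI; exact: filterI.
  move=> i j [[i1 i2] [i3 i4]] [[j1 j2] [j3 j4]].
  exact: hd (parts_sub (pz' i) (pz' j)) (h1 i j i1 j1) (h2 i j i2 j2) (h3 i j i3 j3) (h4 i j i4 j4).
exists k => // e e0; have e2 : 0 < e / 2 by rewrite divr_gt0.
have [N hN] := hk _ e2; exists N => i j Ni Nj.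
by apply: le_lt_trans (hN i j Ni Nj) _; rewrite ltr_pdivrMr // ltr_pMr // ltr1n.
Qed.

(** Testing the closed-loop equation with the velocity of [z], which is the displacement of [y],
    cancels the kinetic and elastic terms and leaves only the feedback. *)
Lemma dissipation z y g g' r r' h h' s s' : closed_loop b k1 (hval z) (hval y) ->
  parts (hval z) g g' r r' -> parts (hval y) h h' s s' ->
  hip y z = - kk * (rell h ^+ 2 + rell h' ^+ 2).
Proof.
move=> cl pz py; have [a a' e e'] := closed_loop_parts hL hc cl pz py.
have [_ g1 g2 g3 g4 _ _ _ _] := pz; have [_ h1 h2 h3 h4 _ _ _ _] := py.
rewrite /hip (Hinner_parts hL hc py pz) (alphaC At kap hc hL h1 g1) (alphaC At kap hc hL h2 g2).
rewrite (e h h1) (e' h' h2).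
have X (p q f : R -> R) : sqint L p -> sqint L q -> sqint L f -> aeq L q (prim (prim f)) ->
    prim (fun x => - m * p x * prim (prim f) x) L = - m * prim (fun x => p x * q x) L.
  move=> sp sq sf aq; have sc := sqint_prim (sqint_prim sf).
  rewrite (prim_mul_aeq hL sp sp sq sc (aeq_refl L p) aq) -(primZ (- m) (sqint_mul sp sc)).
  by apply: eq_prim => x _; rewrite mulrA.
rewrite (X s r h h3 g3 h1 a) (X s' r' h' h4 g4 h2 a').
move: (prim _ L) (prim _ L) (rell h) (rell h') => *; ring.
Qed.

(** Eliminating one component from the pair [A v = p], [A p = - l v] shows that the displacement
    parts of both [v] and [p] solve the eigenvalue problem of [alpha] with eigenvalue [l m]. Zero
    pairings in the dissipation identity give [ell = 0] in both cases. *)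
Lemma heigen v p (l : R) : closed_loop b k1 (hval v) (hval p) ->
  closed_loop b k1 (hval p) (hval (- l *: v)) -> 0 <= l -> hip p v = 0 -> nrm hinner v = 0.
Proof.
move=> cl1 cl2 l0 pv0; set q := - l *: v in cl2.
have pv := self v; have pp := self p; have pq := self q.
set g := rdd b (hval v).1 in pv; set g' := idd b (hval v).1 in pv.
set r := reF (hval v).2 in pv; set r' := imF (hval v).2 in pv.
set h := rdd b (hval p).1 in pp; set h' := idd b (hval p).1 in pp.
set s := reF (hval p).2 in pp; set s' := imF (hval p).2 in pp.
have {}pq : parts (hval q) (fun x => 0 + - l * g x) (fun x => 0 + - l * g' x)
    (fun x => 0 + - l * r x) (fun x => 0 + - l * r' x).
  by have := parts_comb hL (- l) (parts0 hL) pv; rewrite add0r.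
have d1 := dissipation cl1 pv pp; have d2 := dissipation cl2 pp pq.
have [a1 a1' e1 e1'] := closed_loop_parts hL hc cl1 pv pp.
have [a2 a2' e2 e2'] := closed_loop_parts hL hc cl2 pp pq.
have [_ g1 g2 g3 g4 _ _ _ _] := pv; have [_ h1 h2 h3 h4 _ _ _ _] := pp.
have nul (A B : R) : 0 = - kk * (A ^+ 2 + B ^+ 2) -> A = 0 /\ B = 0.
  move/esym/eqP; rewrite mulf_eq0 oppr_eq0 gt_eqF //= paddr_eq0 ?sqr_ge0 //.
  by rewrite !sqrf_eq0 => /andP[/eqP -> /eqP ->].
have [lh lh'] := nul _ _ (etrans (esym pv0) d1).
have qp0 : hip q p = 0 by rewrite hipZ hipC pv0 mulr0.
have [lq lq'] := nul _ _ (etrans (esym qp0) d2).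
have s0 := sqint_cst L (0 : R).
(* The second dissipation identity concerns [- l v], so it yields [rell = 0] for [v] itself only if
   [l <> 0], matching the side condition of [alpha_eigen]. *)
have rz f : sqint L f -> rell (fun x => 0 + - l * f x) = 0 -> l * m != 0 -> rell f = 0.
  move=> sf; rewrite (rell_comb _ _ hc hL (- l) s0 sf) (rell0 _ _ hc hL) add0r.
  move=> /eqP; rewrite mulf_eq0 oppr_eq0 => /orP[/eqP ->|/eqP //].
  by rewrite mul0r eqxx.
have lm : 0 <= l * m by apply: mulr_ge0 => //; exact: ltW.
have X (t w f : R -> R) : sqint L t -> sqint L w -> sqint L f -> aeq L t (fun x => - l * w x) ->
    prim (fun x => - m * t x * prim (prim f) x) L = l * m * prim (fun x => w x * prim (prim f) x) L.
  move=> st sw sf atw; have sc := sqint_prim (sqint_prim sf).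
  rewrite -(primZ (l * m) (sqint_mul sw sc)).
  have LL : 0 <= L <= L by rewrite lexx ltW.
  apply: (aeq_prim (sqint_mul (sqintZ (- m) st) sc) (intbleZ _ (sqint_mul sw sc)) _ LL).
  apply: ae_filterS atw => x ex xL.
  by rewrite ex //; ring.
have sZ (f : R -> R) : sqint L f -> sqint L (fun x => 0 + - l * f x).
  by move=> sf; apply: sqintD => //; exact: sqintZ.
have rZ (f w : R -> R) : aeq L f w -> aeq L (fun x => 0 + - l * f x) (fun x => - l * w x).
  by apply: ae_filterS => x ex xL; rewrite ex // add0r.
have ppZ f : sqint L f -> aeq L (prim (prim (fun x => 0 + - l * f x))) (fun x => - l * prim (prim f) x).
  move=> sf; apply: aeW => x; rewrite in_itv => /andP[x0 xL].
  have xL' : 0 <= x <= L by rewrite !ltW.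
  rewrite (prim_prim_comb (- l) s0 sf xL').
  rewrite (eq_prim (g:=fun=> 0)) ?prim_cst ?mul0r ?add0r // ?ltW // => t /andP[t0 _].
  by rewrite prim_cst ?mul0r // ltW.
have hz : prim (fun x => h x ^+ 2) L = 0.
  apply: (alpha_eigen hc hL hAt hkap hb1 hB3 lm h1) => // f sf.
  by rewrite (e2 f sf) lq mulr0 mul0r subr0; exact: X (sZ _ g3) (sqint_prim (sqint_prim h1)) sf (rZ _ _ a1).
have hz' : prim (fun x => h' x ^+ 2) L = 0.
  apply: (alpha_eigen hc hL hAt hkap hb1 hB3 lm h2) => // f sf.
  by rewrite (e2' f sf) lq' mulr0 mul0r subr0; exact: X (sZ _ g4) (sqint_prim (sqint_prim h2)) sf (rZ _ _ a1').
have gz : prim (fun x => g x ^+ 2) L = 0.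
  apply: (alpha_eigen hc hL hAt hkap hb1 hB3 lm g1) => [f sf|]; last exact: rz lq.
  rewrite (e1 f sf) lh mulr0 mul0r subr0.
  exact: X h3 (sqint_prim (sqint_prim g1)) sf (aeq_trans a2 (ppZ _ g1)).
have gz' : prim (fun x => g' x ^+ 2) L = 0.
  apply: (alpha_eigen hc hL hAt hkap hb1 hB3 lm g2) => [f sf|]; last exact: rz lq'.
  rewrite (e1' f sf) lh' mulr0 mul0r subr0.
  exact: X h4 (sqint_prim (sqint_prim g2)) sf (aeq_trans a2' (ppZ _ g2)).
have rle (t f : R -> R) : sqint L t -> sqint L f -> aeq L t (prim (prim f)) ->
    prim (fun x => f x ^+ 2) L = 0 -> prim (fun x => t x ^+ 2) L <= 0.
  move=> st sf at' f0; have sc := sqint_prim (sqint_prim sf).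
  have -> : prim (fun x => t x ^+ 2) L = prim (fun x => prim (prim f) x ^+ 2) L.
    exact: (prim_mul_aeq hL st sc st sc at' at').
  by apply: le_trans (prim_prim_sqr_le hL sf) _; rewrite f0 mulr0.
have le0 (x : R) : x = 0 -> x <= 0 by move=> ->.
have := parts_le hL hm hc hAt hkap pv (lexx 0) (le0 _ gz) (le0 _ gz') (rle r h g3 h1 a1 hz) (rle r' h' g4 h2 a1' hz').
rewrite mulr0 -/(hip v v) -nrm_sqr real_exprn_even_le0 ?num_real //= => /eqP; exact.
Qed.

End Stability.

(** * Transfer of the given semigroup to the real Hilbert space *)

Section Semigroup.
Context {R : realType} {b : beam R} (k1 : R).
Hypotheses (hL : 0 < beam_len b) (hm : 0 < beam_mass b) (hc : 0 < Pcoef b)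
  (hAt : 0 < Atilde b) (hkap : 0 < kappa b).
Context (T : R -> state R -> state R)
  (hT : contraction_semigroup (Hspace b) (Hnorm b) T)
  (hgen : generates (Hspace b) (Hnorm b) (closed_loop b k1) T).

Notation H := (hstate hL).
Notation B := (hinner hL hm hc hAt hkap).
Implicit Types (u v : H).

(** Negative times are clamped to 0: the given [T] is known to preserve the state space only for
    [t >= 0], while the flow must be total. *)
Lemma hflow_subproof t u : T (Num.max t 0) (hval u) \in Hpred hL.
Proof.
apply/asboolP; apply: (semigroup_stable hT); last exact: hval_Hspace.
by rewrite le_max lexx orbT.
Qed.

Definition hflow t u : H := HState (hflow_subproof t u).

Lemma hvalT t u : 0 <= t -> hval (hflow t u) = T t (hval u).
Proof. by move=> t0; rewrite /= max_l. Qed.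

Lemma hflow_lin t (k : R) u v : 0 <= t ->
  nrm B (hflow t (k *: u + v) - (k *: hflow t u + hflow t v)) = 0.
Proof.
move=> t0; rewrite nrm_Hnorm.
have -> : hval (hflow t (k *: u + v) - (k *: hflow t u + hflow t v)) =
  T t (k%:C%C *: hval u + hval v) - (k%:C%C *: T t (hval u) + T t (hval v)).
  by rewrite -!hvalT //= max_l.
by apply: (semigroup_linear hT) => //; exact: hval_Hspace.
Qed.

Lemma hflow_le t u : 0 <= t -> nrm B (hflow t u) <= nrm B u.
Proof.
move=> t0; have := semigroup_contraction hT t0 (hval_Hspace u).
by rewrite -(hvalT u t0).
Qed.

Lemma hflow_contractive : contractive B hflow.
Proof.
have h0 u : nrm B (hflow 0 u - u) = 0.
  rewrite nrm_Hnorm hvalB hvalT //; apply: (semigroup_0 hT); exact: hval_Hspace.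
have z0 : nrm B 0 = 0 := etrans (congr1 Num.sqrt (hip0 (hL:=hL) hc 0)) (sqrtr0 _).
split; last 3 first.
- exact: h0.
- move=> s t u s0 t0; have := semigroup_add hT s0 t0 (hval_Hspace u).
  by rewrite -(hvalT u t0) -(hvalT (hflow t u) s0) -(hvalT u (addr_ge0 s0 t0)).
- move=> u e e0; have /cvg_right0P/(_ e e0)[d d0 hd] := semigroup_continuous hT (hval_Hspace u).
  exists d => // t /andP[]; rewrite le_eqVlt => /predU1P[<- _|t0 td]; first by rewrite h0.
  have := hd t; rewrite t0 td => /(_ isT); rewrite -hvalT ?(ltW t0) // -hvalB -nrm_Hnorm.
  by apply: le_lt_trans; exact: ler_norm.
- by move=> t u v t0; have := hflow_lin 1 u v t0; rewrite !scale1r.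
(* Homogeneity is linearity with second summand 0; as [T t 0] is only known to be a null vector, it
   is carried along and removed by contractivity. *)
- move=> t k u t0; have := hflow_lin k u 0 t0; rewrite addr0 => e.
  have z : nrm B (hflow t 0) = 0.
    apply/eqP; rewrite eq_le sqrtr_ge0 andbT; apply: le_trans (hflow_le 0 t0) _.
    by rewrite z0.
  apply/eqP; rewrite eq_le sqrtr_ge0 andbT.
  rewrite (_ : _ - _ = hflow t (k *: u) - (k *: hflow t u + hflow t 0) + hflow t 0).
    by apply: le_trans (nrmD _ _ _) _; rewrite e z addr0.
  by rewrite opprD addrA subrK.
- exact: hflow_le.
Qed.

Lemma hflow_genP u v : gen B hflow u v <-> closed_loop b k1 (hval u) (hval v).
Proof.
have E t : 0 < t -> nrm B (t^-1 *: (hflow t u - u) - v) =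
    Hnorm b ((t^-1)%:C%C *: (T t (hval u) - hval u) - hval v).
  by move=> t0; rewrite nrm_Hnorm -hvalT // ltW.
rewrite (hgen (hval_Hspace u) (hval_Hspace v)); split=> [h|/cvg_right0P h e e0].
  apply/cvg_right0P => e e0; have [d d0 hd] := h e e0; exists d => // t td.
  have /andP[t0 _] := td; rewrite -E // ger0_norm ?sqrtr_ge0 //; exact: hd.
have [d d0 hd] := h e e0; exists d => // t td; have /andP[t0 _] := td.
by rewrite E //; apply: le_lt_trans (hd t td); exact: ler_norm.
Qed.

End Semigroup.

Unset Implicit Arguments.
Set Strict Implicit.

Theorem theorem5 (R : realType) (b : beam R) (k1 : R)
  (hlen : 0 < beam_len b) (hmass : 0 < beam_mass b) (hvarsigma : 0 < beam_varsigma b)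
  (hbeta : 0 < beam_beta b) (hgamma : 0 < beam_gamma b)
  (hh2 : 0 < beam_h2 b) (hh3 : 0 < beam_h3 b)
  (hA : 0 < beam_A b) (hB1 : 0 < beam_B1 b) (hB2 : 0 < beam_B2 b)
  (hB3 : 0 < beam_B3 b) (hB4 : 0 < beam_B4 b) (hC : 0 < beam_C b)
  (hAtilde : 0 < Atilde b) (hBtilde : 0 < Btilde b) (hk1 : 0 < k1)
  (T : R -> state R -> state R)
  (hT : contraction_semigroup (Hspace b) (Hnorm b) T)
  (hgen : generates (Hspace b) (Hnorm b) (closed_loop b k1) T)
  (Phi0 : state R) (hPhi0 : Hspace b Phi0) :
  Hnorm b (T t Phi0) @[t --> +oo] --> (0 : R).
Proof.
have hc : 0 < Pcoef b.
  by rewrite mulr_gt0 // addr_gt0 // divr_gt0 // !mulr_gt0 // exprn_gt0.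
have hkap : 0 < kappa b by rewrite /kappa !mulr_gt0 // exprn_gt0.
have hb1 : 0 < ellcoef b by rewrite /ellcoef !mulr_gt0.
have hkk : 0 < gain b k1 by rewrite /gain divr_gt0 // mulr_gt0.
pose B := hinner hlen hmass hc hAtilde hkap.
have genP (u v : hstate hlen) := hflow_genP hmass hc hAtilde hkap hT hgen u v.
pose u0 : hstate hlen := HState (introT (asboolP _) hPhi0 : Phi0 \in Hpred hlen).
have cpl : hcomplete B by exact: hinner_complete.
have contr : contractive B (hflow hT) := hflow_contractive hlen hmass hc hAtilde hkap hT.
have comp (z y : nat -> hstate hlen) (C : R) : (forall n, gen B (hflow hT) (z n) (y n)) ->
    (forall n, nrm B (z n) <= C) -> (forall n, nrm B (y n) <= C) ->
    exists2 k : nat -> nat, (forall n, (n <= k n)%N) & hcauchy B (fun n => z (k n)).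
  by move=> g; apply: (hcompact hkk) => n; apply/genP; exact: g.
have eig v p (l : R) : gen B (hflow hT) v p -> gen B (hflow hT) p (- l *: v) -> 0 <= l ->
    B p v = 0 -> nrm B v = 0.
  move=> /genP c1 /genP c2 l0 z; exact: (heigen hmass hc hAtilde hkap hb1 hB3 hkk c1 c2 l0 z).
have st := strong_stability contr cpl comp eig u0.
apply/cvgrPdist_lt => e e0; have [s hs] := st e e0.
exists (Num.max s 0); split; first exact: num_real.
move=> t; rewrite gt_max => /andP[st' t0].
rewrite sub0r normrN ger0_norm ?sqrtr_ge0 //.
by have := hs t (ltW st'); rewrite nrm_Hnorm hvalT // ltW.
Qed.
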